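(* Let $p\in(1,2)$ and consider the ordinary differential equation $$(\ast)\quad (p-1)h'^2h''+(p-3)\left(h'^2\frac{\sin h\cos h}{r^2}-h'\frac{\sin^2 h}{r^3}\right)+\frac{h'^3}{r}+\frac{h''\sin^2 h}{r^2}-\frac{\sin^3 h\cos h}{r^4}=0 .$$ There exists a global classical solution $h\in C^\infty((0,\infty))\cap C^1([0,\infty))$ of $(\ast)$ such that: (a) $h(0)=0$ and $\lim_{r\to\infty}h(r)=\pi/2$. (b) There exists an increasing sequence $(r_n)_{n\ge0}$ of critical points of $h$ with $r_n\to\infty$ as $n\to\infty$, such that the values $h(r_{2n})\in(\pi/2,\pi)$ are local maxima and the values $h(r_{2n+1})\in(0,\pi/2)$ are local minima. Moreover, there exists a positive integer $n_0$ such that $|h(r_n)-\pi/2|$ is decreasing for $n\ge n_0$, and $$\left|h(r_0)-\frac{\pi}{2}\right|=\max\left\{\left|h(r_n)-\frac{\pi}{2}\right|: n\ge0\right\}.$$ (c) For every $l\in(0,\pi/2]$, the minimizer $h_l$ of $G_{p,l}$ over $W^{1,1}(0,1)\cap W^{1,p}_{\mathrm{loc}}(0,1)$ satisfies $h_l(r)=h(\alpha r)$ (or $h_l(r)=\pi-h(\alpha r)$ if $l=\pi/2$) for $r\in[0,1]$, for some suitable $\alpha>0$. (d) Every non-constant finite global solution $\tilde h$ of $(\ast)$ has the form $\tilde h(r)=k\pi\pm h(\alpha r)$ for some $\alpha>0$ and $k\in\mathbb{Z}$. (e) There are infinitely many global solutions of $(\ast)$ which have limit $-\infty$ (respectively $+\infty$)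 as $r\to0^+$. Each of them either is increasing (resp. decreasing) on all of $(0,\infty)$ with limit, as $r\to+\infty$, equal to $+\infty$ (resp. $-\infty$) or to $k\pi$ for some $k\in\mathbb{Z}$; or it increases (resp. decreases) up to some $r_*\in(0,+\infty)$ and after $r_*$ it oscillates around $(2k+1)\frac{\pi}{2}$ for some $k\in\mathbb{Z}$ in the same manner as in (b), with $(2k+1)\frac{\pi}{2}$ in place of $\frac{\pi}{2}$: its critical points form an increasing sequence tending to infinity, starting at $r_*$, at which it alternately has local maxima with values in $((2k+1)\frac{\pi}{2},(k+1)\pi)$ and local minima with values in $(k\pi,(2k+1)\frac{\pi}{2})$, and the distances of these values to $(2k+1)\frac{\pi}{2}$ are eventually decreasing and are largest at $r_*$.
   Context: A global solution of the ODE is a classical solution on $(0,\infty)$. A global solution is called finite if it has a finite limit as $r\to0^+$ (as opposed to the solutions with limit $\pm\infty$ in (e)). For $h:(0,1)\to\mathbb{R}$ let $$E_p(h)=\int_0^1 r\left(h_r^2+\frac{\sin^2h}{r^2}\right)^{p/2}dr\in[0,+\infty],$$ and let $G_{p,l}(h):=E_p(h)$ if $h(1)=l$, $G_{p,l}(h):=+\infty$ otherwise. Functions in $W^{1,1}(0,1)$ are identified with their continuous representatives on $[0,1]$. For $l\in(0,\pi/2]$ the minimizer $h_l$ of $G_{p,l}$ over $W^{1,1}(0,1)\cap W^{1,p}_{\mathrm{loc}}(0,1)$ exists and is unique, except that for $l=\pi/2$ it is unique only up to the reflection $h_l\mapsto\pi-h_l$. *)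

(* Defs.v *)
From HB Require Import structures.
From mathcomp Require Import all_boot all_order all_algebra.
From mathcomp Require Import all_classical all_reals all_analysis.

Set Implicit Arguments.
Unset Strict Implicit.
Unset Printing Implicit Defensive.

Import Order.TTheory GRing.Theory Num.Theory.
Import numFieldNormedType.Exports.

Local Open Scope ring_scope.
Local Open Scope classical_set_scope.

(* Functions on (0, +oo), [0, +oo) or [0, 1] are represented by total functions
   R -> R whose values outside the interval of interest are irrelevant. *)

Definition C_pos (R : realType) (k : nat) (h : R -> R) : Prop :=
  forall r : R, 0 < r ->
    (forall j : nat, (j < k)%N -> derivable (h^`(j)) r 1) /\
    {for r, continuous (h^`(k))}.

Definition smooth_pos (R : realType) (h : R -> R) : Prop :=
  forall k : nat, C_pos k h.

(* At 0 the difference quotient is restricted to [0, +oo), so that g 0 is the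
   right derivative of h. *)
Definition C1_nonneg (R : realType) (h : R -> R) : Prop :=
  exists g : R -> R,
    {within `[0, +oo[%classic, continuous g} /\
    forall x : R, 0 <= x ->
      (h y - h x) / (y - x) @[y --> within `[0, +oo[%classic x^'] --> g x.

Definition ode (R : realType) (p : R) (h : R -> R) (r : R) : Prop :=
  let h0 := h r in
  let h1 := h^`() r in
  let h2 := h^`(2) r in
  (p - 1) * h1 ^+ 2 * h2
  + (p - 3) * (h1 ^+ 2 * (sin h0 * cos h0 / r ^+ 2)
               - h1 * (sin h0 ^+ 2 / r ^+ 3))
  + h1 ^+ 3 / r
  + h2 * sin h0 ^+ 2 / r ^+ 2
  - sin h0 ^+ 3 * cos h0 / r ^+ 4 = 0.

Definition global_solution (R : realType) (p : R) (h : R -> R) : Prop :=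
  C_pos 2 h /\ forall r : R, 0 < r -> ode p h r.

Definition finite_at0 (R : realType) (h : R -> R) : Prop :=
  exists c : R, h r @[r --> 0^'+] --> c.

Definition nonconstant_pos (R : realType) (h : R -> R) : Prop :=
  ~ exists c : R, forall r : R, 0 < r -> h r = c.

Definition increasing_on (R : realType) (A : set R) (f : R -> R) : Prop :=
  forall x y : R, A x -> A y -> x < y -> f x < f y.

Definition decreasing_on (R : realType) (A : set R) (f : R -> R) : Prop :=
  forall x y : R, A x -> A y -> x < y -> f y < f x.

Definition max_above (R : realType) (f : R -> R) (c x : R) : Prop :=
  (\forall y \near x, f y <= f x) /\ c < f x < c + pi / 2.

Definition min_below (R : realType) (f : R -> R) (c x : R) : Prop :=
  (\forall y \near x, f x <= f y) /\ c - pi / 2 < f x < c.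

(* Even (resp. Odd) is the property required of the critical points with even
   (resp. odd) index. *)
Definition oscillates (R : realType) (f : R -> R) (c : R)
    (Even Odd : R -> Prop) (s : nat -> R) : Prop :=
  [/\ forall n : nat, 0 < s n /\ s n < s n.+1,
      s n @[n --> \oo] --> +oo,
      forall n : nat, f^`() (s n) = 0,
      forall n : nat, Even (s n.*2) /\ Odd (s n.*2.+1) &
      (exists2 n0 : nat, (0 < n0)%N & forall n : nat, (n0 <= n)%N ->
         `|f (s n.+1) - c| < `|f (s n) - c|) /\
      (forall n : nat, `|f (s n) - c| <= `|f (s 0%N) - c|)].

Definition all_critical (R : realType) (f : R -> R) (s : nat -> R) : Prop :=
  forall x : R, 0 < x -> f^`() x = 0 -> exists n : nat, x = s n.

Definition odd_half_pi (R : realType) (k : int) : R :=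
  (2 * k + 1)%:~R * (pi / 2).

Definition solutions_from_ninfty (R : realType) (p : R) : set (R -> R) :=
  [set f | global_solution p f /\ f r @[r --> 0^'+] --> -oo].

Definition solutions_from_pinfty (R : realType) (p : R) : set (R -> R) :=
  [set f | global_solution p f /\ f r @[r --> 0^'+] --> +oo].

(* Two total functions agreeing on (0, +oo) represent the same solution:
   solutions are counted through their restrictions. *)
Definition infinitely_many_pos (R : realType) (S : set (R -> R)) : Prop :=
  infinite_set [set f \_ `]0, +oo[%classic | f in S].

Definition C1c_01 (R : realType) (phi : R -> R) : Prop :=
  [/\ forall x : R, derivable phi x 1,
      continuous (phi^`()) &
      exists K : set R, [/\ compact K, K `<=` `]0, 1[%classic &
        forall x : R, ~ K x -> phi x = 0]].

Definition weak_derivative_01 (R : realType) (u v : R -> R) : Prop :=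
  [/\ locally_integrable `]0, 1[%classic u,
      locally_integrable `]0, 1[%classic v &
      forall phi : R -> R, C1c_01 phi ->
        (\int[@lebesgue_measure R]_(x in `]0%R, 1%R[) (u x * phi^`()%classic x)%:E
         = - \int[@lebesgue_measure R]_(x in `]0%R, 1%R[) (v x * phi x)%:E)%E].

(* Well defined up to a null set when u has a weak derivative; 0 otherwise. *)
Definition wderive (R : realType) (u : R -> R) : R -> R :=
  xget (cst 0) [set v | weak_derivative_01 u v].

Definition W11_01 (R : realType) (u : R -> R) : Prop :=
  exists v : R -> R, [/\ weak_derivative_01 u v,
    (@lebesgue_measure R).-integrable `]0, 1[%classic (EFin \o u) &
    (@lebesgue_measure R).-integrable `]0, 1[%classic (EFin \o v)].

Definition W1p_loc_01 (R : realType) (p : R) (u : R -> R) : Prop :=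
  exists v : R -> R, [/\ weak_derivative_01 u v,
    locally_integrable `]0, 1[%classic (fun x : R => `|u x| `^ p) &
    locally_integrable `]0, 1[%classic (fun x : R => `|v x| `^ p)].

(* The continuity clause selects the continuous representative on [0, 1]. *)
Definition admissible (R : realType) (p : R) (u : R -> R) : Prop :=
  [/\ {within `[0, 1]%classic, continuous u}, W11_01 u & W1p_loc_01 p u].

Definition Ep (R : realType) (p : R) (u : R -> R) : \bar R :=
  (\int[@lebesgue_measure R]_(r in `]0%R, 1%R[)
    (r * (wderive u r ^+ 2 + sin (u r) ^+ 2 / r ^+ 2) `^ (p / 2))%:E)%E.

Definition Gpl (R : realType) (p l : R) (u : R -> R) : \bar R :=
  if u 1 == l then Ep p u else +oo%E.

Definition is_minimizer (R : realType) (p l : R) (u : R -> R) : Prop :=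
  admissible p u /\
  forall w : R -> R, admissible p w -> (Gpl p l u <= Gpl p l w)%E.

(* Main.v *)
Require Import Defs.
From HB Require Import structures.
From mathcomp Require Import all_boot all_order all_algebra.
From mathcomp Require Import all_classical all_reals all_analysis.
From mathcomp Require Import measurable_realfun ring lra.
Import Order.TTheory GRing.Theory Num.Theory.
Import numFieldNormedType.Exports.
Local Open Scope ring_scope.
Local Open Scope classical_set_scope.

(* In the variable t = ln r, with x = h and y = r h', the equation becomes the autonomous system
   x' = y, y' = Phi x y, whose right-hand side is globally Lipschitz.  The function
   V = ((p - 1) y^2 - sin^2 x) (y^2 + sin^2 x)^(p/2 - 1) decreases along trajectories: once V < 0, a
   trajectory stays in a strip k pi < x < (k + 1) pi and spirals into its centre, whereas V > 0
   for all times forces x to be monotone.  A trajectory leaving (0, 0) is found by compactness in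
   the invariant wedge sin x cos x <= y <= sin x; it is unique up to time translation, which
   classifies the finite solutions.
   For the minimizers, let sigma(h) = - V / (2 - p), evaluated on the increasing branch of that
   trajectory.  Then r^(2 - p) sigma(h) calibrates the energy: its increments along any competitor
   with values in [0, pi/2] are at most those of the energy, with equality only along dilations
   of the special solution.  Replacing u by its distance to pi Z, which does not increase the
   energy, reduces the general case to this one. *)

(** * Elementary calculus *)

(** In the variable t the energy is the integral of e^((2 - p) t) L(x, y) with L = (y^2 + sin^2
    x)^(p/2), and [V] is the Hamiltonian y L_y - L of L. The weight turns its conservation into the
    loss V' = -(2 - p) y L_y, nonpositive as p < 2. By scaling, the least energy for reaching the
    value h at radius r is r^(2 - p) sigma(h); its Hamilton-Jacobi equation is sigma = - V / (2 - p)
    with sigma' = L_y. Two obstacles shape the proof. Hence the wedge for existence, and for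
    uniqueness the comparison of [V] along two trajectories at equal x. Secondly, competitors have
    only a weak derivative: the calibration inequality is used on small intervals, through
    increments of u and of the energy alone, and is made global by a supremum argument. *)

Section Calculus.
Context {R : realType}.
Implicit Types (f g : R -> R) (x a b l : R).

Definition dv f x l : Prop := is_derive x (1 : R) f l.

Lemma dv_eq {f x l l'} : dv f x l' -> l' = l -> dv f x l.
Proof. by move=> h <-. Qed.
Lemma dv_cst c x : dv (fun _ : R => c) x 0.
Proof. exact: is_derive_cst. Qed.
Lemma dv_id x : dv (fun y : R => y) x 1.
Proof. exact: is_derive_id. Qed.
Lemma dvD {f g x a b} : dv f x a -> dv g x b ->
  dv (fun y => f y + g y) x (a + b).
Proof. by move=> h1 h2; exact: is_deriveD. Qed.
Lemma dvN {f x a} : dv f x a -> dv (fun y => - f y) x (- a).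
Proof. by move=> h1; exact: is_deriveN. Qed.
Lemma dvB {f g x a b} : dv f x a -> dv g x b ->
  dv (fun y => f y - g y) x (a - b).
Proof. by move=> h1 h2; exact: is_deriveB. Qed.
Lemma dvM {f g x a b} : dv f x a -> dv g x b ->
  dv (fun y => f y * g y) x (a * g x + f x * b).
Proof.
move=> h1 h2; apply: (dv_eq (is_deriveM h1 h2)).
by rewrite /GRing.scale /=; ring.
Qed.
Lemma dvV {f x a} : f x != 0 -> dv f x a ->
  dv (fun y => (f y)^-1) x (- a / f x ^+ 2).
Proof.
move=> f0 h1; apply: (dv_eq (is_deriveV f0 h1)).
by rewrite /GRing.scale /= mulNr mulrC mulNr.
Qed.
Lemma dvX {f x a} n : dv f x a ->
  dv (fun y => f y ^+ n) x (n%:R * f x ^+ n.-1 * a).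
Proof.
move=> h1; have -> : (fun y => f y ^+ n) = (f ^+ n)%R.
  by apply/funext => y; rewrite exprfctE.
exact: (dv_eq (is_deriveX n h1)).
Qed.
Lemma dv_comp {f g x a b} : dv f (g x) a -> dv g x b ->
  dv (fun y => f (g y)) x (a * b).
Proof. by move=> h1 h2; exact: is_derive1_comp. Qed.
Lemma dv_sin {g x b} : dv g x b ->
  dv (fun y => sin (g y)) x (cos (g x) * b).
Proof. by move=> h; exact: (dv_comp (is_derive_sin _) h). Qed.
Lemma dv_cos {g x b} : dv g x b ->
  dv (fun y => cos (g y)) x (- sin (g x) * b).
Proof. by move=> h; exact: (dv_comp (is_derive_cos _) h). Qed.
Lemma dv_exp {g x b} : dv g x b ->
  dv (fun y => expR (g y)) x (expR (g x) * b).
Proof. by move=> h; exact: (dv_comp (is_derive_expR _) h). Qed.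
Lemma dv_ln {g x b} : 0 < g x -> dv g x b ->
  dv (fun y => ln (g y)) x ((g x)^-1 * b).
Proof. by move=> g0 h; apply: (dv_comp (f := @ln R)) => //; exact: is_derive1_ln. Qed.
Lemma dv_powR {g x b} (q : R) : 0 < g x -> dv g x b ->
  dv (fun y => g y `^ q) x (q * g x `^ (q - 1) * b).
Proof.
move=> g0 h; apply: (dv_comp (f := fun z => z `^ q)) => //.
exact: is_derive1_powR.
Qed.
Lemma dv_atan {g x b} : dv g x b ->
  dv (fun y => atan (g y)) x ((1 + g x ^+ 2)^-1 * b).
Proof. by move=> h; exact: (dv_comp (is_derive1_atan _) h). Qed.

Lemma dv_near {f g x l} : (\forall y \near x, f y = g y) ->
  dv f x l -> dv g x l.
Proof. by move=> h; exact: near_eq_is_derive h. Qed.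

Lemma dv_derive1 {f x l} : dv f x l -> f^`() x = l.
Proof. by move=> h; rewrite derive1E; case: h. Qed.

Lemma derivable_dv {f x} : derivable f x 1 -> dv f x (derive1 f x).
Proof. by move=> h; rewrite derive1E; exact: DeriveDef. Qed.

Lemma dv_derivable {f x l} : dv f x l -> derivable f x 1.
Proof. by case. Qed.

Lemma dv_cont {f x l} : dv f x l -> {for x, continuous f}.
Proof. by case=> h _; apply/differentiable_continuous/derivable1_diffP. Qed.

Lemma cont_within {f a b} : (forall x, a <= x <= b -> {for x, continuous f}) ->
  {within `[a, b], continuous f}.
Proof.
move=> h; apply: continuous_in_subspaceT => x; rewrite inE /= in_itv /= => xab.
exact: h.
Qed.

Lemma mvt {f} {df : R -> R} {a b} : a < b ->
  (forall x, a <= x <= b -> dv f x (df x)) ->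
  exists2 c, a < c < b & f b - f a = df c * (b - a).
Proof.
move=> ab h; have [||c] := @MVT R f df a b ab.
- by move=> x; rewrite in_itv /= => /andP[/ltW ? /ltW ?]; apply: h; apply/andP.
- by apply: cont_within => x /h /dv_cont.
- by rewrite in_itv /=; exists c.
Qed.

Lemma nondecr_dv {f} {df : R -> R} {a b} : a <= b ->
  (forall x, a <= x <= b -> dv f x (df x)) ->
  (forall x, a < x < b -> 0 <= df x) -> f a <= f b.
Proof.
rewrite le_eqVlt => /orP[/eqP->//|ab] h h'.
have [c cab e] := mvt ab h.
by rewrite -subr_ge0 e mulr_ge0 ?h'// subr_ge0 ltW.
Qed.

Lemma nonincr_dv {f} {df : R -> R} {a b} : a <= b ->
  (forall x, a <= x <= b -> dv f x (df x)) ->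
  (forall x, a < x < b -> df x <= 0) -> f b <= f a.
Proof.
move=> ab h h'; rewrite -lerN2.
apply: (nondecr_dv ab (f := fun x => - f x) (df := fun x => - df x)) => x xab.
  exact/dvN/h.
by rewrite oppr_ge0 h'.
Qed.

Lemma incr_dv {f} {df : R -> R} {a b} : a < b ->
  (forall x, a <= x <= b -> dv f x (df x)) ->
  (forall x, a < x < b -> 0 < df x) -> f a < f b.
Proof.
move=> ab h h'; have [c cab e] := mvt ab h.
by rewrite -subr_gt0 e mulr_gt0 ?h'// subr_gt0.
Qed.

Lemma decr_dv {f} {df : R -> R} {a b} : a < b ->
  (forall x, a <= x <= b -> dv f x (df x)) ->
  (forall x, a < x < b -> df x < 0) -> f b < f a.
Proof.
move=> ab h h'; have [c cab e] := mvt ab h.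
by rewrite -subr_lt0 e nmulr_rlt0 ?h'// subr_gt0.
Qed.

Lemma const_dv {f} {df : R -> R} {a b} : a <= b ->
  (forall x, a <= x <= b -> dv f x (df x)) ->
  (forall x, a < x < b -> df x = 0) -> f a = f b.
Proof.
move=> ab h h'; apply/eqP; rewrite eq_le; apply/andP; split.
  by apply: nondecr_dv ab h _ => x /h' ->.
by apply: nonincr_dv ab h _ => x /h' ->.
Qed.

Lemma ivt {f a b} v : a <= b -> (forall x, a <= x <= b -> {for x, continuous f}) ->
  (f a <= v <= f b) || (f b <= v <= f a) -> exists2 c, a <= c <= b & f c = v.
Proof.
move=> ab h v1.
have [|c] := @IVT R f a b v ab (cont_within h).
  case/orP: v1 => /andP[v1 v2].
    by rewrite (min_idPl (le_trans v1 v2)) (max_idPr (le_trans v1 v2)) v1.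
  by rewrite (min_idPr (le_trans v1 v2)) (max_idPl (le_trans v1 v2)) v1.
by rewrite in_itv /=; exists c.
Qed.

Lemma const_sign {f a b} : a <= b -> (forall x, a <= x <= b -> {for x, continuous f}) ->
  (forall x, a <= x <= b -> f x != 0) -> (0 < f a) = (0 < f b).
Proof.
move=> ab h h0.
have fa : f a != 0 by apply: h0; rewrite lexx ab.
have fb : f b != 0 by apply: h0; rewrite lexx ab.
apply/idP/idP => p0; rewrite ltNge; apply/negP => n0.
  have [|c cab c0] := ivt 0 ab h; first by rewrite n0 (ltW p0) orbT.
  by have := h0 _ cab; rewrite c0 eqxx.
have [|c cab c0] := ivt 0 ab h; first by rewrite n0 (ltW p0).
by have := h0 _ cab; rewrite c0 eqxx.
Qed.

Lemma near_lt {f x} v : {for x, continuous f} -> f x < v -> \forall y \near x, f y < v.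
Proof. by move=> h fv; apply: (h [set z | z < v]); exact: lt_nbhsl. Qed.

Lemma near_gt {f x} v : {for x, continuous f} -> v < f x -> \forall y \near x, v < f y.
Proof. by move=> h fv; apply: (h [set z | v < z]); exact: lt_nbhsr. Qed.

Lemma near_pball {x} {P : R -> Prop} : (\forall y \near x, P y) ->
  exists2 d, 0 < d & forall y, `|y - x| < d -> P y.
Proof.
move=> /nbhs_ballP[d d0 h]; exists d => // y yx; apply: h.
by rewrite /ball /= distrC.
Qed.

Lemma pball_near {x} {P : R -> Prop} d : 0 < d -> (forall y, `|y - x| < d -> P y) ->
  \forall y \near x, P y.
Proof.
by move=> d0 h; apply/nbhs_ballP; exists d => // y; rewrite /ball /= distrC; exact: h.
Qed.

Lemma near_abs {f x e} : {for x, continuous f} -> 0 < e ->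
  exists2 d, 0 < d & forall y, `|y - x| < d -> `|f y - f x| < e.
Proof.
by move=> /cvgrPdist_lt h e0; apply: near_pball; near=> y; rewrite distrC; near: y; exact: h.
Unshelve. all: by end_near. Qed.

End Calculus.

(** The derivative is built from the shape of the function with its value left open; [dstep] then
    asks for the equality of that value with the stated one, a goal for [ring] or [field]. *)
Ltac dtac := repeat first
  [ eassumption | exact: dv_cst | exact: dv_id | apply: dvD | apply: dvB | apply: dvN | apply: dvV
  | apply: dvM | apply: dvX | apply: dv_sin | apply: dv_cos | apply: dv_exp | apply: dv_ln
  | apply: dv_atan | apply: dv_powR ].
Ltac dstep := apply: dv_eq; [dtac | cbv beta].

(** The match excludes differences, which [addr_ge0] would treat as sums with an opposite. *)
Ltac nneg := repeat first [ by [] | exact: sqr_ge0 | by apply: exprn_even_ge0 | by apply: ltW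
  | exact: normr_ge0 | exact: expR_ge0 | exact: powR_ge0
  | lazymatch goal with |- is_true (0 <= _ - _) => fail | |- _ => apply: addr_ge0 end
  | apply: mulr_ge0 | apply: divr_ge0 ].

(** * Primitives of continuous functions on the whole line *)

Section Primitive.
Context {R : realType}.
Local Notation mu := (@lebesgue_measure R).

Lemma primitive_from {f : R -> R} (a : R) : continuous f ->
  exists F : R -> R, forall x, a < x -> dv F x (f x).
Proof.
move=> cf; exists (fun x => \int[mu]_(t in `[a, x]) f t)%R => x ax.
have [||||d e] := @continuous_FTC1_closed R f a x (x + 1).
- by rewrite ltrDl.
- apply: continuous_compact_integrable; first exact: segment_compact.
  by apply: continuous_subspaceT.
- exact: ax.
- exact: cf.
- by rewrite -e; exact: derivable_dv.
Qed.

(** [primitive_from] gives a primitive on each ray above -(n + 1). Normalised at 0, any two agree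
    where both are defined, so the value at x may use the index [Num.bound |x|], and one fixed index
    serves near x. *)
Lemma primitive_exists {f : R -> R} : continuous f ->
  exists F : R -> R, F 0 = 0 /\ forall x, dv F x (f x).
Proof.
move=> cf.
have /choice[G hG] : forall n : nat, exists G : R -> R, G 0 = 0 /\
    forall x, - n.+1%:R < x -> dv G x (f x).
  move=> n; have [G hG] := primitive_from (- n.+1%:R) cf.
  exists (fun x => G x - G 0); rewrite subrr; split=> // x /hG h.
  by dstep; ring.
have GE n m x : - n.+1%:R < x -> - m.+1%:R < x -> G n x = G m x.
  move=> nx mx; have [Gn0 dGn] := hG n; have [Gm0 dGm] := hG m.
  have dz y : - n.+1%:R < y -> - m.+1%:R < y -> dv (fun z => G n z - G m z) y 0.
    by move=> ny my; apply: dv_eq; [apply: dvB; [exact: dGn|exact: dGm]|rewrite subrr].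
  have n0 (k : nat) : - k.+1%:R < 0 :> R by rewrite oppr_lt0.
  apply/eqP; rewrite -subr_eq0; apply/eqP.
  suff -> : G n x - G m x = G n 0 - G m 0 by rewrite Gn0 Gm0 subrr.
  have [x0|x0] := leP 0 x.
    apply/esym; apply: (const_dv x0 (f := fun z => G n z - G m z) (df := fun=> 0)) => //.
    by move=> y /andP[y0 _]; apply: dz; apply: lt_le_trans y0.
  apply: (const_dv (ltW x0) (f := fun z => G n z - G m z) (df := fun=> 0)) => //.
  by move=> y /andP[y0 _]; apply: dz; apply: lt_le_trans y0.
have bd (y : R) : - (Num.bound `|y|).+1%:R < y.
  have h := archi_boundP (normr_ge0 y).
  rewrite ltrNl; apply: (le_lt_trans (y := `|y|)); first by rewrite -normrN ler_norm.
  by apply: (lt_trans h); rewrite ltr_nat.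
exists (fun x => G (Num.bound `|x|) x); split; first exact: (hG _).1.
move=> x; have [_ /(_ x (bd x)) dG] := hG (Num.bound `|x|).
apply: dv_near dG; near=> y; apply: GE => //.
by near: y; apply: lt_nbhsr; exact: bd.
Unshelve. all: by end_near. Qed.

Definition prim (f : R -> R) : R -> R :=
  xget (cst 0) [set F | F 0 = 0 /\ forall x, dv F x (f x)].

Lemma primP {f : R -> R} : continuous f -> prim f 0 = 0 /\ forall x, dv (prim f) x (f x).
Proof. by move=> /primitive_exists[F hF]; rewrite /prim; case: xgetP => [_ -> //|/(_ F)]. Qed.

(** Integration divides the bound by B. In Picard's iteration this weight replaces the restriction
    to a short interval and gives solutions on the whole line at once. *)
Lemma exp_bound_dv {F f : R -> R} {A B : R} : 0 < B -> 0 <= A -> F 0 = 0 ->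
  (forall x, dv F x (f x)) -> (forall x, `|f x| <= A * expR (B * `|x|)) ->
  forall x, `|F x| <= A / B * expR (B * `|x|).
Proof.
move=> B0 A0.
have pos (F' f' : R -> R) : F' 0 = 0 -> (forall x, dv F' x (f' x)) ->
    (forall x, `|f' x| <= A * expR (B * `|x|)) ->
    forall x, 0 <= x -> F' x <= A / B * expR (B * x).
  move=> F0 dF bf x x0; rewrite -subr_ge0.
  apply: le_trans (_ : A / B * expR (B * 0) - F' 0 <= _).
    by rewrite F0 subr0 mulr_ge0 ?expR_ge0// divr_ge0// ltW.
  apply: (nondecr_dv x0 (f := fun x => A / B * expR (B * x) - F' x)
    (df := fun x => A * expR (B * x) - f' x)) => y /andP[y0 _].
    have h := dF y; dstep; by field; rewrite gt_eqF.
  rewrite subr_ge0; apply: le_trans (ler_norm _) _.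
  by have := bf y; rewrite (gtr0_norm y0).
move=> F0 dF bf x.
have [x0|x0] := leP 0 x.
  rewrite (ger0_norm x0) ler_norml; apply/andP; split; last exact: (pos F f).
  rewrite lerNl; apply: (pos (fun y => - F y) (fun y => - f y)) => //.
  - by rewrite F0 oppr0.
  - by move=> y; apply: dvN.
  - by move=> y; rewrite normrN.
rewrite (ltr0_norm x0) ler_norml; apply/andP; split.
  rewrite lerNl -{1}[x]opprK.
  apply: (pos (fun y => - F (- y)) (fun y => f (- y))); last by rewrite oppr_ge0 ltW.
  - by rewrite !oppr0 F0 oppr0.
  - move=> y; apply: dv_eq; first by apply: dvN; apply: (dv_comp (f := F)); [exact: dF|dtac].
    by rewrite mulrN1 opprK.
  - by move=> y; rewrite -(normrN y).
rewrite -{1}[x]opprK.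
apply: (pos (fun y => F (- y)) (fun y => - f (- y))); last by rewrite oppr_ge0 ltW.
- by rewrite !oppr0 F0.
- move=> y; apply: dv_eq; first by apply: (dv_comp (f := F)); [exact: dF|dtac].
  by rewrite mulrN1.
- by move=> y; rewrite normrN -(normrN y).
Qed.

End Primitive.

(** * Picard iteration *)

Section Picard.
Context {R : realType}.

(** The intervals of centre a n and radius d n, the tail of the geometric series, are nested; the
    supremum of their left ends lies in all of them. *)
Lemma geometric_limit (a : nat -> R) (C : R) :
  (forall n, `|a n.+1 - a n| <= C / 2 ^+ n) ->
  exists l, forall n, `|a n - l| <= 2 * C / 2 ^+ n.
Proof.
move=> h; pose d n := 2 * C / 2 ^+ n.
have C0 : 0 <= C by have := h 0%N; rewrite expr0 divr1; apply: le_trans.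
have d0 n : 0 <= d n by rewrite /d divr_ge0// ?mulr_ge0// exprn_ge0.
have dS n : d n.+1 = d n - C / 2 ^+ n.
  by rewrite /d exprS; field; rewrite expf_neq0.
have lo n : a n - d n <= a n.+1 - d n.+1.
  by have := h n; rewrite dS ler_norml => /andP[h1 _]; lra.
have up n : a n.+1 + d n.+1 <= a n + d n.
  by have := h n; rewrite dS ler_norml => /andP[_ h1]; lra.
have lom n k : a n - d n <= a (n + k)%N - d (n + k)%N.
  by elim: k => [|k ih]; rewrite ?addn0// addnS; apply: le_trans ih _.
have upm n k : a (n + k)%N + d (n + k)%N <= a n + d n.
  by elim: k => [|k ih]; rewrite ?addn0// addnS; apply: le_trans (up _) ih.
have lu n m : a n - d n <= a m + d m.
  have := lom n m; have := upm m n; rewrite addnC; have := d0 (n + m)%N; lra.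
pose S := [set z | exists n, z = a n - d n].
exists (sup S) => n; rewrite ler_distl -/(d n); apply/andP; split.
  suff : sup S <= a n + d n by lra.
  apply: sup_le_ub; first by exists (a 0%N - d 0%N), 0%N.
  by move=> _ [m ->].
suff : a n - d n <= sup S by lra.
apply: ub_le_sup; last by exists n.
by exists (a 0%N + d 0%N) => _ [m ->].
Qed.

Lemma le_geometric0 (z C : R) : 0 <= z -> (forall n, z <= C / 2 ^+ n) -> z = 0.
Proof.
move=> z0 h; apply/eqP; rewrite eq_le z0 andbT leNgt; apply/negP => zp.
have C0 : 0 < C by have := h 0%N; rewrite expr0 divr1; apply: lt_le_trans.
have [n _] : exists2 n, True & C / z < 2 ^+ n.
  exists (Num.bound (C / z)) => //.
  apply: lt_trans (archi_boundP _) _; first by apply: divr_ge0; exact: ltW.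
  by rewrite -natrX ltr_nat ltn_expl.
rewrite ltr_pdivrMr// mulrC -ltr_pdivrMr ?exprn_gt0//.
by move/lt_le_trans/(_ (h n)); rewrite ltxx.
Qed.

Lemma geometric_small (C e : R) : 0 < e -> exists n, C / 2 ^+ n < e.
Proof.
move=> e0; have [C0|C0] := leP C 0.
  by exists 0%N; rewrite expr0 divr1 (le_lt_trans C0).
exists (Num.bound (C / e)).
rewrite ltr_pdivrMr ?exprn_gt0// mulrC -ltr_pdivrMr//.
apply: lt_trans (archi_boundP _) _; first by apply: divr_ge0; exact: ltW.
by rewrite -natrX ltr_nat ltn_expl.
Qed.

(** The convergence is uniform on bounded sets only, so the index n is chosen for the unit ball
    around t before the usual argument in thirds. *)
Lemma cont_geometric_limit (u : nat -> R -> R) (v : R -> R) (C B : R) : 0 <= B ->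
  (forall n, continuous (u n)) ->
  (forall n t, `|u n t - v t| <= C * expR (B * `|t|) / 2 ^+ n) -> continuous v.
Proof.
move=> B0 cu h t; apply/cvgrPdist_lt => e e0.
have C0 : 0 <= C.
  have := le_trans (normr_ge0 _) (h 0%N 0).
  by rewrite expr0 divr1 normr0 mulr0 expR0 mulr1.
have e3 : 0 < e / 3 by rewrite divr_gt0.
have [n hn] := geometric_small (C * expR (B * (`|t| + 1))) _ e3.
have hb s : `|s - t| < 1 -> `|u n s - v s| < e / 3.
  move=> st; apply: le_lt_trans (h n s) (le_lt_trans _ hn).
  rewrite ler_pM2r ?invr_gt0 ?exprn_gt0// ler_wpM2l// ler_expR ler_wpM2l//.
  by rewrite -[s](subrK t) addrC; apply: le_trans (ler_normD _ _) _; rewrite lerD2l ltW.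
have [d d0 hd] := near_abs (cu n t) e3.
apply: (pball_near (Num.min 1 d)) => [|s]; first by rewrite lt_min ltr01.
rewrite lt_min => /andP[s1 /hd]; have := hb s s1.
have := hb t; rewrite subrr normr0 => /(_ ltr01).
by rewrite !ltr_norml => /andP[? ?] /andP[? ?] /andP[? ?]; apply/andP; split; lra.
Qed.

(** N exp(-C t) is nonincreasing and N exp(C t) is nondecreasing; the second serves backward in
    time. *)
Lemma gronwall {N dN : R -> R} {C : R} : (forall t, dv N t (dN t)) ->
  (forall t, `|dN t| <= C * N t) -> forall s t, N t <= N s * expR (C * `|t - s|).
Proof.
move=> dd h s t; have [st|ts] := leP s t.
  rewrite ger0_norm ?subr_ge0//.
  have : N t * expR (- C * t) <= N s * expR (- C * s).
    apply: (nonincr_dv st (f := fun t => N t * expR (- C * t))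
      (df := fun t => (dN t - C * N t) * expR (- C * t))) => x _.
      by have := dd x => ?; dstep; ring.
    rewrite pmulr_lle0 ?expR_gt0// subr_le0.
    exact: le_trans (ler_norm _) (h x).
  rewrite -(ler_pM2r (expR_gt0 (C * t))) -!mulrA -!expRD.
  rewrite (_ : - C * t + C * t = 0) ?expR0 ?mulr1; last by ring.
  by rewrite (_ : - C * s + C * t = C * (t - s)) //; ring.
rewrite ltr0_norm ?subr_lt0//.
have : N t * expR (C * t) <= N s * expR (C * s).
  apply: (nondecr_dv (ltW ts) (f := fun t => N t * expR (C * t))
    (df := fun t => (dN t + C * N t) * expR (C * t))) => x _.
    by have := dd x => ?; dstep; ring.
  rewrite mulr_ge0 ?expR_ge0// -lerBlDr sub0r lerNl.
  apply: le_trans (h x); rewrite -normrN; exact: ler_norm.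
rewrite -(ler_pM2r (expR_gt0 (- C * t))) -!mulrA -!expRD.
rewrite (_ : C * t + - C * t = 0) ?expR0 ?mulr1; last by ring.
by rewrite (_ : C * s + - C * t = C * - (t - s)) //; ring.
Qed.

End Picard.

(** * Existence, uniqueness and continuous dependence for a Lipschitz planar system *)

Section PlanarSystem.
Context {R : realType}.
Variables (Phi : R -> R -> R) (L : R).
Hypothesis L1 : 1 <= L.
Hypothesis lipPhi : forall x y x' y',
  `|Phi x y - Phi x' y'| <= L * (`|x - x'| + `|y - y'|).

Definition planar_solution (x y : R -> R) : Prop :=
  forall t, dv x t (y t) /\ dv y t (Phi (x t) (y t)).

Lemma planar_cont {f g : R -> R} {t} : {for t, continuous f} -> {for t, continuous g} ->
  {for t, continuous (fun s => Phi (f s) (g s))}.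
Proof.
move=> cf cg; apply/cvgrPdist_lt => e e0.
have L0 : 0 < L by apply: lt_le_trans L1.
have e2 : 0 < e / (2 * L) by rewrite divr_gt0// mulr_gt0.
have [d1 d10 h1] := near_abs cf e2; have [d2 d20 h2] := near_abs cg e2.
apply: (pball_near (Num.min d1 d2)) => [|s]; first by rewrite lt_min d10.
rewrite lt_min => /andP[/h1 s1 /h2 s2]; rewrite distrC.
apply: le_lt_trans (lipPhi _ _ _ _) _.
rewrite (_ : e = L * (e / (2 * L) + e / (2 * L))); last by field; rewrite gt_eqF.
by rewrite ltr_pM2l// ltrD.
Qed.

Fixpoint picard (x0 y0 : R) (n : nat) : (R -> R) * (R -> R) :=
  if n is n'.+1 then
    let u := picard x0 y0 n' in
    (fun t => x0 + prim u.2 t, fun t => y0 + prim (fun s => Phi (u.1 s) (u.2 s)) t)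
  else (cst x0, cst y0).

Lemma picard_cont x0 y0 n :
  continuous (picard x0 y0 n).1 /\ continuous (picard x0 y0 n).2.
Proof.
elim: n => [|n [ih1 ih2]] /=; first by split=> t; exact: cvg_cst.
have [_ d1] := primP ih2.
have [_ d2] := primP (fun t => planar_cont (ih1 t) (ih2 t)).
by split=> t; apply: (@dv_cont _ _ t); [have := d1 t|have := d2 t] => ?; dtac.
Qed.

Lemma planar_exists (x0 y0 : R) :
  exists x y : R -> R, [/\ planar_solution x y, x 0 = x0 & y 0 = y0].
Proof.
have L0 : 0 < L by apply: lt_le_trans L1.
(* With the weight exp(B |t|), an iteration multiplies the common bound on both differences by 1 / B
   for the first component and by 2 L / B for the second; both factors are at most 1/2. A bounds the
   differences of the first iteration. *)
pose B := 4 * L; pose u := picard x0 y0; pose A := `|y0| + `|Phi x0 y0|.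
have B0 : 0 < B by rewrite mulr_gt0.
have B4 : 4 <= B by rewrite /B -{1}[4 in leLHS]mulr1 ler_pM2l.
have A0 : 0 <= A by rewrite addr_ge0.
have cu := picard_cont x0 y0.
have cP n t : {for t, continuous (fun s => Phi ((u n).1 s) ((u n).2 s))}.
  by apply: planar_cont; [exact: (cu n).1|exact: (cu n).2].
have E1 t : 1 <= expR (B * `|t|) :> R.
  by rewrite -expR0 ler_expR mulr_ge0// ltW.
have step n t : `|(u n.+1).1 t - (u n).1 t| <= A / 2 ^+ n * expR (B * `|t|) /\
                `|(u n.+1).2 t - (u n).2 t| <= A / 2 ^+ n * expR (B * `|t|).
  elim: n t => [|n ih] t.
    rewrite /= /cst expr0 !divr1 !(addrC _ (prim _ _)) !addrK.
    have AB : A / B <= A by rewrite ler_pdivrMr// ler_peMr//; lra.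
    have c0 (c : R) : continuous (fun _ : R => c) by move=> s; exact: cvg_cst.
    split.
      have [p0 dp] := primP (c0 y0).
      apply: le_trans (exp_bound_dv B0 A0 p0 dp _ t) _ => [s|].
        apply: le_trans (_ : A <= _); first by rewrite lerDl.
        by rewrite ler_peMr.
      by rewrite ler_wpM2r// expR_ge0.
    have [p0 dp] := primP (c0 (Phi x0 y0)).
    apply: le_trans (exp_bound_dv B0 A0 p0 dp _ t) _ => [s|].
      apply: le_trans (_ : A <= _); first by rewrite lerDr.
      by rewrite ler_peMr.
    by rewrite ler_wpM2r// expR_ge0.
  have An0 : 0 <= A / 2 ^+ n by rewrite divr_ge0// exprn_ge0.
  have E0 : 0 <= expR (B * `|t|) by exact: expR_ge0.
  split.
    have [p1 d1] := primP (cu n.+1).2; have [p2 d2] := primP (cu n).2.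
    rewrite [_ - _](_ : _ = prim (u n.+1).2 t - prim (u n).2 t); last first.
      by rewrite /=; ring.
    apply: le_trans (exp_bound_dv (F := fun t => prim (u n.+1).2 t - prim (u n).2 t)
      (f := fun t => (u n.+1).2 t - (u n).2 t) B0 An0 _ _ _ t) _.
    - by rewrite p1 p2 subrr.
    - by move=> s; apply: dvB; [exact: d1|exact: d2].
    - by move=> s; exact: (ih s).2.
    rewrite ler_wpM2r// (_ : A / 2 ^+ n.+1 = A / 2 ^+ n / 2); last first.
      by rewrite exprS; field; rewrite expf_neq0.
    by rewrite ler_wpM2l// lef_pV2 ?posrE//; lra.
  have An1 : 0 <= 2 * L * (A / 2 ^+ n) by rewrite mulr_ge0// mulr_ge0// ltW.
  have [p1 d1] := primP (cP n.+1); have [p2 d2] := primP (cP n).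
  rewrite [_ - _](_ : _ = prim (fun s => Phi ((u n.+1).1 s) ((u n.+1).2 s)) t -
    prim (fun s => Phi ((u n).1 s) ((u n).2 s)) t); last by rewrite /=; ring.
  apply: le_trans (exp_bound_dv (F := fun t =>
      prim (fun s => Phi ((u n.+1).1 s) ((u n.+1).2 s)) t -
      prim (fun s => Phi ((u n).1 s) ((u n).2 s)) t)
    (f := fun t => Phi ((u n.+1).1 t) ((u n.+1).2 t) - Phi ((u n).1 t) ((u n).2 t))
    B0 An1 _ _ _ t) _.
  - by rewrite p1 p2 subrr.
  - by move=> s; apply: dvB; [exact: d1|exact: d2].
  - move=> s; apply: le_trans (lipPhi _ _ _ _) _; have [h1 h2] := ih s.
    rewrite (_ : 2 * L * (A / 2 ^+ n) * expR (B * `|s|) =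
      L * (A / 2 ^+ n * expR (B * `|s|) + A / 2 ^+ n * expR (B * `|s|))); last by ring.
    by apply: ler_wpM2l; [exact: ltW|apply: lerD].
  rewrite ler_wpM2r// le_eqVlt; apply/orP; left; apply/eqP; rewrite /B exprS.
  by field; rewrite expf_neq0// gt_eqF.
have lim1 t : exists l, forall n, `|(u n).1 t - l| <= 2 * (A * expR (B * `|t|)) / 2 ^+ n.
  by apply: geometric_limit => n; rewrite mulrAC; exact: (step n t).1.
have lim2 t : exists l, forall n, `|(u n).2 t - l| <= 2 * (A * expR (B * `|t|)) / 2 ^+ n.
  by apply: geometric_limit => n; rewrite mulrAC; exact: (step n t).2.
have [x hx] := choice lim1; have [y hy] := choice lim2.
have cx : continuous x.
  apply: (cont_geometric_limit (fun n => (u n).1) x (2 * A) _ (ltW B0)) => n.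
    exact: (cu n).1.
  by move=> t; rewrite -(mulrA 2); exact: hx.
have cy : continuous y.
  apply: (cont_geometric_limit (fun n => (u n).2) y (2 * A) _ (ltW B0)) => n.
    exact: (cu n).2.
  by move=> t; rewrite -(mulrA 2); exact: hy.
have cPx t : {for t, continuous (fun s => Phi (x s) (y s))}.
  by apply: planar_cont; [exact: cx|exact: cy].
have [py0 dpy] := primP cy; have [pp0 dpp] := primP cPx.
have A2 n : 0 <= 2 * A / 2 ^+ n by rewrite divr_ge0 ?exprn_ge0// mulr_ge0.
have hx' n t : `|(u n).1 t - x t| <= 2 * A / 2 ^+ n * expR (B * `|t|).
  by apply: le_trans (hx t n) _; rewrite mulrA mulrAC.
have hy' n t : `|(u n).2 t - y t| <= 2 * A / 2 ^+ n * expR (B * `|t|).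
  by apply: le_trans (hy t n) _; rewrite mulrA mulrAC.
(* Both sides are limits of the same iterates, so their distance is below every C / 2^n. *)
have xE t : x t = x0 + prim y t.
  apply/eqP; rewrite -subr_eq0 -normr_eq0; apply/eqP.
  apply: (le_geometric0 _ (4 * A * expR (B * `|t|))) => // n.
  have [p1 d1] := primP (cu n).2.
  have h1 := hx' n.+1 t.
  have h2 : `|prim (u n).2 t - prim y t| <= 2 * A / 2 ^+ n / B * expR (B * `|t|).
    apply: (exp_bound_dv (F := fun t => prim (u n).2 t - prim y t)
      (f := fun t => (u n).2 t - y t)) => //.
    - by rewrite p1 py0 subrr.
    - by move=> s; apply: dvB; [exact: d1|exact: dpy].
  have -> : x t - (x0 + prim y t) =
      - ((u n.+1).1 t - x t) + (prim (u n).2 t - prim y t) by rewrite /=; ring.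
  apply: le_trans (ler_normD _ _) _; rewrite normrN.
  apply: le_trans (lerD h1 h2) _; rewrite -mulrDl.
  rewrite [leRHS]mulrAC ler_wpM2r ?expR_ge0//.
  have : 2 * A / 2 ^+ n / B <= 2 * A / 2 ^+ n.
    by rewrite ler_pdivrMr// ler_peMr//; lra.
  rewrite (_ : 2 * A / 2 ^+ n.+1 = A / 2 ^+ n); last first.
    by rewrite exprS; field; rewrite expf_neq0.
  by have := A2 n; lra.
have yE t : y t = y0 + prim (fun s => Phi (x s) (y s)) t.
  apply/eqP; rewrite -subr_eq0 -normr_eq0; apply/eqP.
  apply: (le_geometric0 _ (4 * A * expR (B * `|t|))) => // n.
  have [p1 d1] := primP (cP n).
  have h1 := hy' n.+1 t.
  have h2 : `|prim (fun s => Phi ((u n).1 s) ((u n).2 s)) t -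
      prim (fun s => Phi (x s) (y s)) t|
      <= 2 * L * (2 * A / 2 ^+ n) / B * expR (B * `|t|).
    apply: (exp_bound_dv (F := fun t => prim (fun s => Phi ((u n).1 s) ((u n).2 s)) t -
      prim (fun s => Phi (x s) (y s)) t)
      (f := fun t => Phi ((u n).1 t) ((u n).2 t) - Phi (x t) (y t))) => //.
    - by rewrite !mulr_ge0// ltW.
    - by rewrite p1 pp0 subrr.
    - by move=> s; apply: dvB; [exact: d1|exact: dpp].
    - move=> s; apply: le_trans (lipPhi _ _ _ _) _; 
      rewrite (_ : 2 * L * (2 * A / 2 ^+ n) * expR (B * `|s|) =
        L * (2 * A / 2 ^+ n * expR (B * `|s|) + 2 * A / 2 ^+ n * expR (B * `|s|))); last by ring.
      by apply: ler_wpM2l; [exact: ltW|apply: lerD].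
  have -> : y t - (y0 + prim (fun s => Phi (x s) (y s)) t) =
      - ((u n.+1).2 t - y t) + (prim (fun s => Phi ((u n).1 s) ((u n).2 s)) t -
      prim (fun s => Phi (x s) (y s)) t) by rewrite /=; ring.
  apply: le_trans (ler_normD _ _) _; rewrite normrN.
  apply: le_trans (lerD h1 h2) _; rewrite -mulrDl.
  rewrite [leRHS]mulrAC ler_wpM2r ?expR_ge0//.
  rewrite (_ : 2 * L * (2 * A / 2 ^+ n) / B = A / 2 ^+ n); last first.
    by rewrite /B; field; rewrite expf_neq0// gt_eqF.
  rewrite (_ : 2 * A / 2 ^+ n.+1 = A / 2 ^+ n); last first.
    by rewrite exprS; field; rewrite expf_neq0.
  by have := A2 n; lra.
exists x, y; split.
- move=> t; split.
    apply: (dv_near (f := fun t => x0 + prim y t)); first by near=> s; rewrite xE.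
    by have := dpy t => ?; dstep; ring.
  apply: (dv_near (f := fun t => y0 + prim (fun s => Phi (x s) (y s)) t)).
    by near=> s; rewrite yE.
  by have := dpp t => ?; dstep; ring.
- by rewrite xE py0 addr0.
- by rewrite yE pp0 addr0.
Unshelve. all: by end_near. Qed.

(** The squared distance is differentiable even where the trajectories meet. With a and b the
    differences in x and y, its derivative is at most 2 |a| |b| + 2 L |b| (|a| + |b|), hence at most
    4 L (a^2 + b^2) as L >= 1. *)
Lemma planar_gronwall {x y x' y' : R -> R} :
  planar_solution x y -> planar_solution x' y' -> forall s t,
  (x t - x' t) ^+ 2 + (y t - y' t) ^+ 2 <=
  ((x s - x' s) ^+ 2 + (y s - y' s) ^+ 2) * expR (4 * L * `|t - s|).
Proof.
move=> h h'.
apply: (gronwall (N := fun t => (x t - x' t) ^+ 2 + (y t - y' t) ^+ 2)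
  (dN := fun t => 2 * (x t - x' t) * (y t - y' t) +
    2 * (y t - y' t) * (Phi (x t) (y t) - Phi (x' t) (y' t)))) => t.
  have [? ?] := h t; have [? ?] := h' t.
  dstep; rewrite /=; ring.
have := lipPhi (x t) (y t) (x' t) (y' t).
set a := x t - x' t; set b := y t - y' t; set c := _ - _ => hc.
have L0 : 0 < L by apply: lt_le_trans L1.
apply: (le_trans (y := 2 * `|a| * `|b| + 2 * `|b| * `|c|)).
  by apply: le_trans (ler_normD _ _) _; rewrite !normrM (ger0_norm (ler0n _ 2)).
rewrite -(real_normK (num_real a)) -(real_normK (num_real b)).
have := normr_ge0 a; have := normr_ge0 b; have := normr_ge0 c.
move: (`|a|) (`|b|) (`|c|) hc => {}a {}b {}c hc c0 b0 a0.
have h1 : b * c <= b * (L * (a + b)) by rewrite ler_wpM2l.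
have h2 : 2 * a * b <= a ^+ 2 + b ^+ 2 by have := sqr_ge0 (a - b); lra.
have h3 : L * (2 * a * b) <= L * (a ^+ 2 + b ^+ 2) by rewrite ler_wpM2l// ltW.
have h4 : 0 <= (L - 1) * (a ^+ 2 + b ^+ 2) by rewrite mulr_ge0 ?subr_ge0// addr_ge0 ?sqr_ge0.
have h5 : 0 <= L * a ^+ 2 by rewrite mulr_ge0 ?sqr_ge0// ltW.
lra.
Qed.

Lemma planar_unique {x y x' y' : R -> R} (s : R) :
  planar_solution x y -> planar_solution x' y' -> x s = x' s -> y s = y' s ->
  forall t, x t = x' t /\ y t = y' t.
Proof.
move=> h h' xs ys t; have := planar_gronwall h h' s t.
rewrite xs ys !subrr expr0n addr0 mul0r => hle.
have : (x t - x' t) ^+ 2 + (y t - y' t) ^+ 2 == 0.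
  by rewrite eq_le hle addr_ge0 ?sqr_ge0.
rewrite paddr_eq0 ?sqr_ge0// !sqrf_eq0 !subr_eq0.
by case/andP => /eqP -> /eqP ->.
Qed.

Lemma planar_shift {x y : R -> R} (c : R) : planar_solution x y ->
  planar_solution (fun t => x (t + c)) (fun t => y (t + c)).
Proof.
move=> h t; have [h1 h2] := h (t + c).
have dc : dv (fun t : R => t + c) t 1 by dstep; ring.
by split; apply: dv_eq (dv_comp _ dc) _; [exact: h1|rewrite mulr1|exact: h2|rewrite mulr1].
Qed.
End PlanarSystem.

(** * The autonomous system *)

Section Field.
Context {R : realType} {p : R} (hp1 : 1 < p) (hp2 : p < 2).

(* The system obeyed by (h, r h') in the variable ln r. Where both y and sin x
   vanish the quotient is 0 / 0 = 0, which is its limit. *)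
Definition Phi (x y : R) : R :=
  ((p - 2) * y * (y ^+ 2 + sin x ^+ 2)
   + sin x * cos x * ((3 - p) * y ^+ 2 + sin x ^+ 2))
  / ((p - 1) * y ^+ 2 + sin x ^+ 2).

Lemma quot_lip (N N' D D' C d : R) : 0 < D -> 0 < D' ->
  `|N * D' - N' * D| <= C * d * (D * D') -> `|N / D - N' / D'| <= C * d.
Proof.
move=> D0 D'0 h.
have -> : N / D - N' / D' = (N * D' - N' * D) / (D * D').
  by field; rewrite !gt_eqF.
by rewrite normrM normfV (gtr0_norm (mulr_gt0 D0 D'0)) ler_pdivrMr// mulr_gt0.
Qed.

Let k := p - 1.
Let k0 : 0 < k. Proof. by rewrite /k subr_gt0. Qed.
Let k1 : k < 1. Proof. rewrite /k; have := hp2; lra. Qed.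

Lemma den_ge0 (y s : R) : 0 <= k * y ^+ 2 + s ^+ 2.
Proof. by rewrite addr_ge0 ?sqr_ge0// mulr_ge0 ?sqr_ge0// ltW. Qed.

Lemma den_eq0 (y s : R) : k * y ^+ 2 + s ^+ 2 = 0 -> y = 0 /\ s = 0.
Proof.
move/eqP; rewrite paddr_eq0 ?sqr_ge0//; last by rewrite mulr_ge0 ?sqr_ge0// ltW.
by rewrite mulf_eq0 gt_eqF//= !sqrf_eq0 => /andP[/eqP-> /eqP->].
Qed.

Lemma den_cases (y s : R) : (y = 0 /\ s = 0) \/ 0 < k * y ^+ 2 + s ^+ 2.
Proof.
have := den_ge0 y s; rewrite le_eqVlt => /orP[/eqP/esym/den_eq0|]; by [left|right].
Qed.

(** Dividing by the denominator of [Phi] leaves this term and [bet] (see [PhiE]). Both are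
    homogeneous of degree one in (y, s), so their difference quotients stay bounded up to the origin
    although they are not differentiable there. *)
Let gam (y s : R) := y ^+ 3 / (k * y ^+ 2 + s ^+ 2).
Let bet (y s : R) := s * y ^+ 2 / (k * y ^+ 2 + s ^+ 2).
(** A value that fits the four quotient bounds below: where both denominators are positive, k^2
    times the factor multiplying the difference is at most 4 times their product. *)
Let C := 4 / k ^+ 2.

Lemma C_ge (a DD : R) : 0 <= DD -> k ^+ 2 * a <= 4 * DD -> a <= C * DD.
Proof.
move=> D0 h; rewrite /C mulrAC ler_pdivlMr ?exprn_gt0//; lra.
Qed.

Lemma gam_y y y' s : `|gam y s - gam y' s| <= C * `|y - y'|.
Proof.
have aux u : `|u / k| <= C * `|u|.
  apply: C_ge => //; rewrite normrM normfV (gtr0_norm k0).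
  rewrite [leLHS](_ : _ = k * `|u|); last by field; rewrite gt_eqF.
  by rewrite ler_wpM2r//; have := k1; lra.
have gs u : gam u 0 = u / k.
  rewrite /gam expr0n addr0; have [->|u0] := eqVneq u 0; first by rewrite expr0n !mul0r.
  by field; rewrite u0 gt_eqF.
have [[-> ->]|D0] := den_cases y s.
  by rewrite !gs -mulrBl.
have [[-> ->]|D'0] := den_cases y' s.
  by rewrite !gs -mulrBl.
apply: quot_lip => //.
rewrite (_ : _ - _ = (y - y') * (k * (y * y') ^+ 2 + s ^+ 2 * (y ^+ 2 + y * y' + y' ^+ 2))); last by ring.
rewrite normrM mulrC [leRHS]mulrAC ler_wpM2r//; apply: C_ge; first by rewrite mulr_ge0// ltW.
have a0 : 0 <= s ^+ 2 * (y + y') ^+ 2 by rewrite mulr_ge0 ?sqr_ge0.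
have a1 : 0 <= s ^+ 2 * (y - y') ^+ 2 by rewrite mulr_ge0 ?sqr_ge0.
have a2 : 0 <= s ^+ 2 * y ^+ 2 by rewrite mulr_ge0 ?sqr_ge0.
have a3 : 0 <= s ^+ 2 * y' ^+ 2 by rewrite mulr_ge0 ?sqr_ge0.
have a4 : 0 <= k * (y * y') ^+ 2 by rewrite mulr_ge0 ?sqr_ge0// ltW.
have a5 : 0 <= s ^+ 4 by rewrite exprn_even_ge0.
rewrite ger0_norm; last lra.
have kk : k ^+ 2 <= k by rewrite expr2 ger_pMr// ltW.
set E := y ^+ 2 + y * y' + y' ^+ 2.
have h1 : k * (k * (k * (y * y') ^+ 2 + s ^+ 2 * E)) <= 1 * (k * (k * (y * y') ^+ 2 + s ^+ 2 * E)).
  rewrite ler_wpM2r ?(ltW k1)//; apply: mulr_ge0; first exact: ltW.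
  by rewrite /E; lra.
have h2 : k * (s ^+ 2 * E) <= k * (2 * (s ^+ 2 * (y ^+ 2 + y' ^+ 2))).
  by rewrite ler_wpM2l ?(ltW k0)// /E; lra.
have h3 : 0 <= k * (s ^+ 2 * (y ^+ 2 + y' ^+ 2)).
  by apply: mulr_ge0; [exact: ltW|apply: mulr_ge0; rewrite ?addr_ge0 ?sqr_ge0].
have h4 : 0 <= k * (k * (y * y') ^+ 2) by rewrite mulr_ge0// ltW.
rewrite [X in _ <= 4 * X](_ : _ = k * (k * (y * y') ^+ 2) + k * (s ^+ 2 * (y ^+ 2 + y' ^+ 2)) + s ^+ 4); last by ring.
rewrite expr2 -mulrA; lra.
Qed.

Lemma gam_s y s s' : `|gam y s - gam y s'| <= C * `|s - s'|.
Proof.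
have g0 u : gam 0 u = 0 by rewrite /gam expr0n mul0r.
have z u : 0 <= C * `|u| by rewrite mulr_ge0// /C divr_ge0// sqr_ge0.
have [[-> _]|D0] := den_cases y s; first by rewrite !g0 subrr normr0.
have [[-> _]|D'0] := den_cases y s'; first by rewrite !g0 subrr normr0.
apply: quot_lip => //.
rewrite (_ : _ - _ = (s - s') * - (y ^+ 3 * (s + s'))); last by ring.
rewrite normrM mulrC [leRHS]mulrAC ler_wpM2r// normrN; apply: C_ge; first by rewrite mulr_ge0// ltW.
have b0 u : k ^+ 2 * `|y ^+ 3 * u| <= k ^+ 2 * y ^+ 4 + k * (y ^+ 2 * u ^+ 2).
  have y4 : `|y ^+ 3 * u| <= y ^+ 4 + y ^+ 2 * u ^+ 2.
    rewrite ler_norml; have q1 := sqr_ge0 (y * (y + u)); have q2 := sqr_ge0 (y * (y - u)).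
    have q3 := sqr_ge0 (y * u); have q4 := sqr_ge0 (y * y).
    apply/andP; split; lra.
  apply: le_trans (_ : k ^+ 2 * (y ^+ 4 + y ^+ 2 * u ^+ 2) <= _).
    by rewrite ler_wpM2l ?sqr_ge0.
  rewrite mulrDr lerD2l ler_wpM2r//; first by rewrite mulr_ge0 ?sqr_ge0.
  by rewrite expr2 ger_pMr// ltW.
have := b0 s; have := b0 s'.
have nn : 0 <= s ^+ 2 * s' ^+ 2 by rewrite mulr_ge0 ?sqr_ge0.
have n4 : 0 <= k ^+ 2 * y ^+ 4 by nneg.
have n5 u : 0 <= k * (y ^+ 2 * u ^+ 2) by nneg.
have := n5 s; have := n5 s'.
have : k ^+ 2 * `|y ^+ 3 * (s + s')| <= k ^+ 2 * `|y ^+ 3 * s| + k ^+ 2 * `|y ^+ 3 * s'|.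
  by rewrite -mulrDr ler_wpM2l ?sqr_ge0// mulrDr ler_normD.
rewrite [X in _ -> _ -> _ -> _ -> _ -> _ <= 4 * X](_ : _ =
  k ^+ 2 * y ^+ 4 + k * (y ^+ 2 * s ^+ 2) + k * (y ^+ 2 * s' ^+ 2) + s ^+ 2 * s' ^+ 2); last by ring.
lra.
Qed.

Lemma bet_y y y' s : `|bet y s - bet y' s| <= C * `|y - y'|.
Proof.
have g0 u : bet u 0 = 0 by rewrite /bet !mul0r.
have z u : 0 <= C * `|u| by rewrite mulr_ge0// /C divr_ge0// sqr_ge0.
have [[_ ->]|D0] := den_cases y s; first by rewrite !g0 subrr normr0.
have [[_ ->]|D'0] := den_cases y' s; first by rewrite !g0 subrr normr0.
apply: quot_lip => //.
rewrite (_ : _ - _ = (y - y') * (s ^+ 3 * (y + y'))); last by ring.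
rewrite normrM mulrC [leRHS]mulrAC ler_wpM2r//; apply: C_ge; first by rewrite mulr_ge0// ltW.
have kk : k ^+ 2 <= k by rewrite expr2 ger_pMr// ltW.
have b0 u : k ^+ 2 * `|s ^+ 3 * u| <= s ^+ 4 + k * (s ^+ 2 * u ^+ 2).
  have y4 : `|s ^+ 3 * u| <= s ^+ 4 + s ^+ 2 * u ^+ 2.
    rewrite ler_norml; have q1 := sqr_ge0 (s * (s + u)); have q2 := sqr_ge0 (s * (s - u)).
    have q3 := sqr_ge0 (s * u); have q4 := sqr_ge0 (s * s).
    apply/andP; split; lra.
  apply: le_trans (_ : k ^+ 2 * (s ^+ 4 + s ^+ 2 * u ^+ 2) <= _).
    by rewrite ler_wpM2l ?sqr_ge0.
  rewrite mulrDr lerD//; last by rewrite ler_wpM2r// mulr_ge0 ?sqr_ge0.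
  by rewrite ler_piMl ?exprn_even_ge0// (le_trans kk)// ltW.
have := b0 y; have := b0 y'.
have n4 : 0 <= s ^+ 4 by nneg.
have n3 : 0 <= k ^+ 2 * (y ^+ 2 * y' ^+ 2) by nneg.
have n5 u : 0 <= k * (s ^+ 2 * u ^+ 2) by nneg.
have := n5 y; have := n5 y'.
have : k ^+ 2 * `|s ^+ 3 * (y + y')| <= k ^+ 2 * `|s ^+ 3 * y| + k ^+ 2 * `|s ^+ 3 * y'|.
  by rewrite -mulrDr ler_wpM2l ?sqr_ge0// mulrDr ler_normD.
rewrite [X in _ -> _ -> _ -> _ -> _ -> _ <= 4 * X](_ : _ =
  s ^+ 4 + k * (s ^+ 2 * y ^+ 2) + k * (s ^+ 2 * y' ^+ 2) + k ^+ 2 * (y ^+ 2 * y' ^+ 2)); last by ring.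
lra.
Qed.

Lemma bet_s y s s' : `|bet y s - bet y s'| <= C * `|s - s'|.
Proof.
have g0 u : bet 0 u = 0 by rewrite /bet expr0n mulr0 mul0r.
have z u : 0 <= C * `|u| by rewrite mulr_ge0// /C divr_ge0// sqr_ge0.
have [[-> _]|D0] := den_cases y s; first by rewrite !g0 subrr normr0.
have [[-> _]|D'0] := den_cases y s'; first by rewrite !g0 subrr normr0.
apply: quot_lip => //.
rewrite (_ : _ - _ = (s - s') * (y ^+ 2 * (k * y ^+ 2 - s * s'))); last by ring.
rewrite normrM mulrC [leRHS]mulrAC ler_wpM2r//; apply: C_ge; first by rewrite mulr_ge0// ltW.
have kk : k ^+ 2 <= k by rewrite expr2 ger_pMr// ltW.
have b0 : `|y ^+ 2 * (k * y ^+ 2 - s * s')| <= k * y ^+ 4 + (y ^+ 2 * s ^+ 2 + y ^+ 2 * s' ^+ 2).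
  have q1 := sqr_ge0 (y * (s + s')); have q2 := sqr_ge0 (y * (s - s')).
  have q3 := sqr_ge0 (y * s); have q4 := sqr_ge0 (y * s').
  have q5 : 0 <= k * y ^+ 4 by rewrite mulr_ge0 ?(ltW k0)// exprn_even_ge0.
  rewrite ler_norml; apply/andP; split; lra.
apply: le_trans (ler_wpM2l (sqr_ge0 k) b0) _.
have n4 : k ^+ 2 * (k * y ^+ 4) <= 1 * (k ^+ 2 * y ^+ 4).
  rewrite mulrCA ler_wpM2r ?(ltW k1)// mulr_ge0 ?sqr_ge0// exprn_even_ge0//.
have n3 : k ^+ 2 * (y ^+ 2 * s ^+ 2 + y ^+ 2 * s' ^+ 2) <= k * (y ^+ 2 * s ^+ 2 + y ^+ 2 * s' ^+ 2).
  by rewrite ler_wpM2r// addr_ge0// mulr_ge0 ?sqr_ge0.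
have n5 u : 0 <= k * (y ^+ 2 * u ^+ 2) by nneg.
have := n5 s; have := n5 s'.
have n6 : 0 <= s ^+ 2 * s' ^+ 2 by nneg.
have n7 : 0 <= k ^+ 2 * y ^+ 4 by nneg.
rewrite [X in _ -> _ -> _ <= 4 * X](_ : _ =
  k ^+ 2 * y ^+ 4 + k * (y ^+ 2 * s ^+ 2 + y ^+ 2 * s' ^+ 2) + s ^+ 2 * s' ^+ 2); last by ring.
rewrite mulrDr; lra.
Qed.

Lemma sin_lip (x x' : R) : `|sin x - sin x'| <= `|x - x'|.
Proof.
wlog lt : x x' / x < x'.
  move=> h; case: (ltgtP x x') => [/h//|/h|->]; last by rewrite !subrr normr0.
  by rewrite distrC [leRHS]distrC.
have [c _ e] : exists2 c, x < c < x' & sin x' - sin x = cos c * (x' - x).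
  by apply: mvt => // t _; exact: is_derive_sin.
rewrite distrC [leRHS]distrC e normrM ler_piMl// -[leRHS](normr1 R) -ler_sqr ?nnegrE//.
rewrite -!normrX !ger0_norm ?sqr_ge0 ?expr1n// -(cos2Dsin2 c) lerDl sqr_ge0//.
Qed.

Lemma cosE (x : R) : cos x = sin (x + pi / 2).
Proof. by rewrite sinDpihalf. Qed.

Lemma cos_lip (x x' : R) : `|cos x - cos x'| <= `|x - x'|.
Proof.
rewrite !cosE; apply: le_trans (sin_lip _ _) _.
by rewrite le_eqVlt; apply/orP; left; apply/eqP; congr `|_|; ring.
Qed.

Lemma norm_cos_le1 (x : R) : `|cos x| <= 1.
Proof. by rewrite cosE sin_max. Qed.

Lemma PhiE (x y : R) : Phi x y = (p - 2) * y - (2 - p) ^+ 2 * gam y (sin x)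
  + sin x * cos x + 2 * (2 - p) * (cos x * bet y (sin x)).
Proof.
rewrite /Phi /gam /bet -/k.
have [[-> ->]|D0] := den_cases y (sin x).
  by rewrite !expr0n /= ?mulr0n !(mulr0, mul0r, addr0, add0r, subr0, oppr0).
move: D0; rewrite /k => D0; have D0' := lt0r_neq0 D0; field; exact: D0'.
Qed.

Lemma C_ge1 : 1 <= C.
Proof.
rewrite /C ler_pdivlMr ?exprn_gt0// mul1r.
have : k ^+ 2 <= k by rewrite expr2 ger_pMr// ltW.
have := k1; lra.
Qed.

(** The terms of [PhiE] contribute at most 2 + 5 C for the variation of x and 1 + 3 C for that of
    y. *)
Definition lipC : R := 3 + 5 * C.

Lemma lipC_ge1 : 1 <= lipC.
Proof. by rewrite /lipC; have := C_ge1; lra. Qed.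

Lemma Phi_lip (x y x' y' : R) :
  `|Phi x y - Phi x' y'| <= lipC * (`|x - x'| + `|y - y'|).
Proof.
have gl : `|gam y (sin x) - gam y' (sin x')| <= C * `|y - y'| + C * `|x - x'|.
  rewrite -(subrKA (gam y' (sin x))); apply: le_trans (ler_normD _ _) _.
  apply: lerD; first exact: gam_y.
  apply: le_trans (gam_s _ _ _) _; apply: ler_wpM2l; last exact: sin_lip.
  by have := C_ge1; lra.
have bl : `|bet y (sin x) - bet y' (sin x')| <= C * `|y - y'| + C * `|x - x'|.
  rewrite -(subrKA (bet y' (sin x))); apply: le_trans (ler_normD _ _) _.
  apply: lerD; first exact: bet_y.
  apply: le_trans (bet_s _ _ _) _; apply: ler_wpM2l; last exact: sin_lip.
  by have := C_ge1; lra.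
have bb : `|bet y (sin x)| <= C.
  have := bet_s y (sin x) 0; rewrite /bet !mul0r !subr0 => /le_trans; apply.
  rewrite ler_piMr ?sin_max//; by have := C_ge1; lra.
have mulb (a b a' b' M : R) : `|a'| <= 1 -> `|b| <= M ->
    `|a * b - a' * b'| <= M * `|a - a'| + `|b - b'|.
  move=> a1 bM; rewrite (_ : _ - _ = b * (a - a') + a' * (b - b')); last by ring.
  apply: le_trans (ler_normD _ _) _; rewrite !normrM lerD ?ler_wpM2r//.
  by rewrite ler_piMl.
have sc := mulb (sin x) (cos x) (sin x') (cos x') 1 (sin_max _) (norm_cos_le1 _).
have cb := mulb (cos x) (bet y (sin x)) (cos x') (bet y' (sin x')) C (norm_cos_le1 _) bb.
have cl := cos_lip x x'; have sl := sin_lip x x'.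
rewrite !PhiE.
set g := gam _ _ in gl *; set g' := gam _ _ in gl *.
set b := bet _ _ in bl cb *; set b' := bet _ _ in bl cb *.
rewrite (_ : _ - _ = (p - 2) * (y - y') - (2 - p) ^+ 2 * (g - g') +
  (sin x * cos x - sin x' * cos x') + 2 * (2 - p) * (cos x * b - cos x' * b')); last by ring.
have p01 : 0 <= 2 - p <= 1 by have := hp1; have := hp2; move=> *; apply/andP; split; lra.
case/andP: p01 => p0 p1.
have n1 : `|(p - 2) * (y - y')| <= `|y - y'|.
  by rewrite normrM ler_piMl// -normrN opprB ger0_norm.
have n2 : `|(2 - p) ^+ 2 * (g - g')| <= `|g - g'|.
  by rewrite normrM ler_piMl// normrX ger0_norm// expr_le1.
have n3 : `|2 * (2 - p) * (cos x * b - cos x' * b')| <= 2 * `|cos x * b - cos x' * b'|.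
  by rewrite -mulrA normrM ger0_norm// ler_wpM2l// normrM ler_piMl// ger0_norm.
apply: le_trans (ler_normD _ _) _.
apply: le_trans (lerD (ler_normD _ _) (lexx _)) _.
apply: le_trans (lerD (lerD (ler_normB _ _) (lexx _)) (lexx _)) _.
have C1 : C * `|cos x - cos x'| <= C * `|x - x'|.
  by rewrite ler_wpM2l//; have := C_ge1; lra.
have C2 : 0 <= C * `|y - y'| by apply: mulr_ge0 => //; have := C_ge1; lra.
have d1 := normr_ge0 (x - x'); have d2 := normr_ge0 (y - y').
rewrite /lipC; move: (C) gl bl cb C1 C2 => c gl bl cb C1 C2; lra.
Qed.

Definition sol (x y : R -> R) : Prop := planar_solution Phi x y.

Lemma sol_exists (x0 y0 : R) : exists x y, [/\ sol x y, x 0 = x0 & y 0 = y0].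
Proof. exact: (planar_exists _ _ lipC_ge1 Phi_lip). Qed.

Lemma sol_gronwall {x y x' y' : R -> R} : sol x y -> sol x' y' -> forall s t,
  (x t - x' t) ^+ 2 + (y t - y' t) ^+ 2 <=
  ((x s - x' s) ^+ 2 + (y s - y' s) ^+ 2) * expR (4 * lipC * `|t - s|).
Proof. exact: (planar_gronwall _ _ lipC_ge1 Phi_lip). Qed.

Lemma sol_unique {x y x' y' : R -> R} (s : R) :
  sol x y -> sol x' y' -> x s = x' s -> y s = y' s -> forall t, x t = x' t /\ y t = y' t.
Proof. exact: (planar_unique _ _ lipC_ge1 Phi_lip). Qed.

Lemma sol_shift {x y : R -> R} (c : R) : sol x y ->
  sol (fun t => x (t + c)) (fun t => y (t + c)).
Proof. exact: planar_shift. Qed.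

Lemma Phi_cont {f g : R -> R} {t} : {for t, continuous f} -> {for t, continuous g} ->
  {for t, continuous (fun s => Phi (f s) (g s))}.
Proof. exact: (planar_cont _ _ lipC_ge1 Phi_lip). Qed.

Lemma PhiN (x y : R) : Phi (- x) (- y) = - Phi x y.
Proof. by rewrite /Phi sinN cosN !sqrrN -mulNr; congr (_ / _); ring. Qed.

Lemma PhiDpi (x y : R) : Phi (x + pi) y = Phi x y.
Proof. by rewrite /Phi sinDpi cosDpi !sqrrN mulrNN. Qed.

Lemma int_period (f : R -> R) : (forall x, f (x + pi) = f x) ->
  forall (n : int) x, f (x + n%:~R * pi) = f x.
Proof.
move=> h n x.
have hn (m : nat) z : f (z + m%:R * pi) = f z.
  elim: m => [|m ih]; first by rewrite mul0r addr0.
  by rewrite -natr1 mulrDl mul1r addrA h ih.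
case: n => m; first exact: hn.
by rewrite NegzE mulrNz -[LHS](hn m.+1) -pmulrn; congr f; ring.
Qed.

Lemma Phi_int (n : int) (x y : R) : Phi (x + n%:~R * pi) y = Phi x y.
Proof. exact: (int_period (Phi ^~ y) (PhiDpi ^~ y)). Qed.

Lemma solN {x y : R -> R} : sol x y -> sol (fun t => - x t) (fun t => - y t).
Proof. by move=> h t; have [h1 h2] := h t; rewrite PhiN; split; apply: dvN. Qed.

Lemma sol_int {x y : R -> R} (n : int) : sol x y -> sol (fun t => x t + n%:~R * pi) y.
Proof.
move=> h t; have [h1 h2] := h t; rewrite Phi_int; split=> //.
by dstep; rewrite addr0.
Qed.

Lemma Phi0 (x : R) : Phi x 0 = sin x * cos x.
Proof.
rewrite /Phi expr0n !(mulr0, mul0r, add0r).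
have [->|s0] := eqVneq (sin x) 0; first by rewrite !mul0r.
by field; rewrite s0.
Qed.

(** Since [Phi x 0] is sin x cos x, the point at time t is an equilibrium, and uniqueness makes the
    solution constant. *)
Lemma sol_eq {x y : R -> R} (t : R) : sol x y -> y t = 0 -> sin (x t) * cos (x t) = 0 ->
  forall s, x s = x t /\ y s = 0.
Proof.
move=> h y0 sc s; apply: (sol_unique t h (x' := cst (x t)) (y' := cst 0)) => // r.
by rewrite /cst Phi0 sc; split; exact: dv_cst.
Qed.

Lemma sin_int (n : int) (x : R) : sin (x + n%:~R * pi) ^+ 2 = sin x ^+ 2.
Proof. by apply: (int_period (fun x => sin x ^+ 2)) => z; rewrite sinDpi sqrrN. Qed.

Lemma pi_decomp (x : R) : exists (n : int) (u : R), 0 <= u < pi /\ x = u + n%:~R * pi.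
Proof.
have pi0 : 0 < pi :> R by exact: pi_gt0.
exists (Num.floor (x / pi)), (x - (Num.floor (x / pi))%:~R * pi); split; last by ring.
have /andP[h1 h2] := floor_itv (x / pi).
rewrite subr_ge0 -ler_pdivlMr// h1 /= ltrBlDr -{1}(mul1r pi) -mulrDl -ltr_pdivrMr//.
by rewrite addrC -intrD1.
Qed.

Lemma sin_eq0 (x : R) : sin x = 0 -> exists n : int, x = n%:~R * pi.
Proof.
have [n [u [/andP[u0 up] ->]]] := pi_decomp x; move=> s0; exists n.
suff -> : u = 0 by rewrite add0r.
apply/eqP; rewrite eq_le u0 andbT leNgt; apply/negP => up0.
have := @sin_gt0_pi _ u; rewrite up0 up => /(_ isT).
have := sin_int n u; rewrite s0 expr0n => /esym/eqP; rewrite sqrf_eq0 => /eqP ->.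
by rewrite ltxx.
Qed.

End Field.

Arguments Phi {R} p x y.
Arguments sol {R} p x y.
Arguments lipC {R} p.

(** * Regularity classes on (0, +oo) *)

Section Regularity.
Context {R : realType}.
Implicit Types (f g : R -> R) (k : nat) (r : R).

Lemma C_pos0 f : C_pos 0 f <-> forall r, 0 < r -> {for r, continuous f}.
Proof. by split=> h r /h; [case|split]. Qed.

Lemma C_posS k f : C_pos k.+1 f <-> (forall r, 0 < r -> derivable f r 1) /\ C_pos k (derive1 f).
Proof.
split=> [h|[h1 h2] r r0].
  split=> r r0; first by have [/(_ 0%N isT)] := h r r0.
  have [h1 h2] := h r r0; split=> [j jk|].
    by rewrite -derive1Sn; apply: h1.
  by rewrite -derive1Sn.
have [h3 h4] := h2 r r0; split=> [[|j] jk|]; first exact: h1.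
  by rewrite derive1Sn; exact: h3.
by rewrite derive1Sn.
Qed.

Lemma near_pos (P : R -> Prop) (r : R) : 0 < r -> (forall s : R, 0 < s -> P s) -> \forall s \near r, P s.
Proof. by move=> r0 h; near=> s; apply: h; near: s; exact: lt_nbhsr. Unshelve. all: by end_near. Qed.

Lemma cont_near {f g} {x : R} : (\forall y \near x, f y = g y) ->
  {for x, continuous f} -> {for x, continuous g}.
Proof.
move=> h cf; suff : g @ x --> f x by rewrite (nbhs_singleton h : f x = g x).
by apply: cvg_trans cf; apply: near_eq_cvg; apply: filterS h => y ->.
Qed.

(** The derivative of f is tied to g on (0, +oo) only, so continuity and derivability are
    transferred by equality near each point. *)
Lemma C_pos_dv k f g : (forall r, 0 < r -> dv f r (g r)) -> C_pos k g -> C_pos k.+1 f.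
Proof.
elim: k f g => [|k ih] f g h.
  move=> /C_pos0 cg; apply/C_posS; split=> [r /h/dv_derivable//|].
  apply/C_pos0 => r r0; apply: cont_near (cg r r0).
  by apply: near_pos => // s s0; rewrite (dv_derive1 (h s s0)).
move=> /C_posS[dg cg]; apply/C_posS; split=> [r /h/dv_derivable//|].
apply: (ih _ (derive1 g)) => // r r0.
apply: (dv_near (f := g)); last exact/derivable_dv/dg.
by apply: near_pos => // s s0; rewrite (dv_derive1 (h s s0)).
Qed.

Lemma C_pos_inv k f : C_pos k.+1 f -> (forall r, 0 < r -> dv f r (derive1 f r)) /\ C_pos k (derive1 f).
Proof. by case/C_posS => h1 h2; split=> // r /h1/derivable_dv. Qed.

Lemma C_posW k f : C_pos k.+1 f -> C_pos k f.
Proof.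
elim: k f => [|k ih] f /C_pos_inv[h1 h2]; first by apply/C_pos0 => r /h1/dv_cont.
by apply: C_pos_dv h1 _; exact: ih.
Qed.

Lemma C_pos_cst k (c : R) : C_pos k (fun=> c).
Proof.
elim: k c => [|k ih] c; first by apply/C_pos0 => r _; exact: cvg_cst.
by apply: C_pos_dv (ih 0) => r _; exact: dv_cst.
Qed.

Lemma C_pos_id k : C_pos k (fun r : R => r).
Proof.
case: k => [|k]; first by apply/C_pos0 => r _; exact: cvg_id.
by apply: C_pos_dv (C_pos_cst k 1) => r _; exact: dv_id.
Qed.

Lemma C_posD k f g : C_pos k f -> C_pos k g -> C_pos k (fun r => f r + g r).
Proof.
elim: k f g => [|k ih] f g.
  by move=> /C_pos0 cf /C_pos0 cg; apply/C_pos0 => r r0; apply: cvgD; [exact: cf|exact: cg].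
move=> /C_pos_inv[df cf] /C_pos_inv[dg cg]; apply: C_pos_dv (ih _ _ cf cg) => r r0.
by have ? := df r r0; have ? := dg r r0; dtac.
Qed.

Lemma C_posM k f g : C_pos k f -> C_pos k g -> C_pos k (fun r => f r * g r).
Proof.
elim: k f g => [|k ih] f g.
  by move=> /C_pos0 cf /C_pos0 cg; apply/C_pos0 => r r0; apply: cvgM; [exact: cf|exact: cg].
move=> hf hg; have [df cf] := C_pos_inv _ _ hf; have [dg cg] := C_pos_inv _ _ hg.
apply: C_pos_dv (C_posD _ _ _ (ih _ _ cf (C_posW _ _ hg)) (ih _ _ (C_posW _ _ hf) cg)) => r r0.
by have ? := df r r0; have ? := dg r r0; dtac.
Qed.

Lemma C_posX k n f : C_pos k f -> C_pos k (fun r => f r ^+ n).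
Proof.
move=> h; elim: n => [|n ih]; first exact: C_pos_cst.
under [X in C_pos _ X]eq_fun do rewrite exprS; exact: C_posM.
Qed.

Lemma C_posV k f : (forall r, 0 < r -> f r != 0) -> C_pos k f -> C_pos k (fun r => (f r)^-1).
Proof.
move=> f0; elim: k => [|k ih].
  by move=> /C_pos0 cf; apply/C_pos0 => r r0; apply: cvgV; [exact: f0|exact: cf].
move=> hf; have [df cf] := C_pos_inv _ _ hf.
have iv := ih (C_posW _ _ hf).
apply: C_pos_dv (C_posM _ _ _ (C_posM _ _ _ (C_pos_cst _ (-1)) cf) (C_posM _ _ _ iv iv)) => r r0.
have ? := df r r0; have ? := f0 r r0; dstep => //.
by rewrite -expr2 exprVn mulN1r.
Qed.

Lemma C_pos_sincos k f : C_pos k f ->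
  C_pos k (fun r => sin (f r)) /\ C_pos k (fun r => cos (f r)).
Proof.
elim: k => [|k ih].
  move=> /C_pos0 cf; split; apply/C_pos0 => r r0.
    by apply: continuous_comp; [exact: cf|exact: continuous_sin].
  by apply: continuous_comp; [exact: cf|exact: continuous_cos].
move=> hf; have [df cf] := C_pos_inv _ _ hf.
have [cs cc] := ih (C_posW _ _ hf); split.
  apply: C_pos_dv (C_posM _ _ _ cc cf) => r r0.
  by have ? := df r r0; dtac.
apply: C_pos_dv (C_posM _ _ _ (C_posM _ _ _ (C_pos_cst _ (-1)) cs) cf) => r r0.
by have ? := df r r0; dstep; rewrite mulN1r.
Qed.
End Regularity.

(** * Passage between the equation in r and the system in ln r *)

Section Transfer.
Context {R : realType} {p : R} (hp1 : 1 < p) (hp2 : p < 2).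

(** Where y and sin x do not both vanish, the equation can be solved for the second derivative.
    Elsewhere it is void, and continuity takes over: if the error [e] were nonzero at t it would be
    nonzero nearby, so y and sin x would both vanish near t, and then both terms of [e] would be 0
    at t. *)
Lemma sol_of_global {f : R -> R} : global_solution p f ->
  sol p (fun t => f (expR t)) (fun t => expR t * derive1 f (expR t)).
Proof.
case=> cf hode.
have [df cf1] := C_pos_inv _ _ cf; have [df1 /C_pos0 cf2] := C_pos_inv _ _ cf1.
pose y t := expR t * derive1 f (expR t).
pose z t := expR t * derive1 f (expR t) + expR t * (derive1 (derive1 f) (expR t) * expR t).
have e0 (t : R) : 0 < expR t by exact: expR_gt0.
have dF t : dv (fun t => f (expR t)) t (y t).
  apply: dv_eq (dv_comp (df _ (e0 t)) (is_derive_expR t)) _; exact: mulrC.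
have dE (t : R) : dv (@expR R) t (expR t) by exact: is_derive_expR.
have dy t : dv y t (z t).
  have d1 := dv_comp (df1 _ (e0 t)) (dE t); have ? := dE t.
  by dstep.
have cE t : {for t, continuous (@expR R)} by exact: continuous_expR.
have cz t : {for t, continuous z}.
  apply: cvgD; first exact: (dv_cont (dy t)).
  apply: cvgM; first exact: cE.
  apply: cvgM; last exact: cE.
  by apply: (continuous_comp (f := expR)); [exact: cE|exact: cf2].
have alg t : 0 < (p - 1) * y t ^+ 2 + sin (f (expR t)) ^+ 2 -> z t = Phi p (f (expR t)) (y t).
  move=> D0; rewrite /Phi; apply: canRL (mulfK _) _; first exact: lt0r_neq0.
  have := hode _ (e0 t); rewrite /ode /y /z.
  rewrite derive1nS derive1n1.
  set r := expR t; set a := derive1 f r; set b := derive1 _ r; set s := sin _; set c := cos _ => h.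
  apply/eqP; rewrite -subr_eq0; apply/eqP; rewrite -[RHS](mulr0 (r ^+ 4)) -h.
  by field; exact: lt0r_neq0 (e0 t).
move=> t; split; first exact: dF.
apply: dv_eq (dy t) _.
pose e t := z t - Phi p (f (expR t)) (y t).
have ce : {for t, continuous e}.
  apply: cvgB; first exact: cz.
  by apply: (Phi_cont hp1 hp2); [exact: (dv_cont (dF t))|exact: (dv_cont (dy t))].
apply/eqP; rewrite -subr_eq0 -/(e t); apply/negPn/negP => et.
have ne : \forall s \near t, e s != 0.
  have [d d0 hd] := near_abs ce (etrans (normr_gt0 _) et).
  apply: pball_near d0 _ => s /hd h; apply/eqP => es.
  by move: h; rewrite es sub0r normrN ltxx.
have y0 : \forall s \near t, cst 0 s = y s.
  near=> s.
  have [[-> _]//|D0] := den_cases hp1 (y s) (sin (f (expR s))).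
  suff : e s != 0 by rewrite /e alg// subrr eqxx.
  by near: s.
have zt : z t = 0.
  rewrite -(dv_derive1 (dy t)); apply: dv_derive1; apply: dv_near y0 _; exact: dv_cst.
have [[yt st]|D0] := den_cases hp1 (y t) (sin (f (expR t))); last first.
  by move: et; rewrite /e alg// subrr eqxx.
by move: et; rewrite /e zt yt Phi0// st mul0r subrr eqxx.
Unshelve. all: by end_near. Qed.

Context {x y : R -> R} (hs : sol p x y) {f : R -> R} (fE : forall r, 0 < r -> f r = x (ln r)).

Let dln (r : R) : 0 < r -> dv (@ln R) r r^-1.
Proof. exact: is_derive1_ln. Qed.

Lemma dv_global r : 0 < r -> dv f r (y (ln r) / r).
Proof.
move=> r0; apply: (dv_near (f := fun s => x (ln s))).
  by apply: near_pos => // s s0; rewrite fE.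
exact: (dv_comp (hs (ln r)).1 (dln _ r0)).
Qed.

Lemma dv_global1 r : 0 < r -> dv (fun r => y (ln r) / r) r ((Phi p (x (ln r)) (y (ln r)) - y (ln r)) / r ^+ 2).
Proof.
move=> r0; have h1 := dv_comp (hs (ln r)).2 (dln _ r0).
dstep; first by rewrite gt_eqF.
by field; rewrite gt_eqF.
Qed.

Lemma derive_global r : 0 < r -> derive1 f r = y (ln r) / r.
Proof. by move=> /dv_global/dv_derive1. Qed.

Lemma global_of_sol : global_solution p f.
Proof.
have d2 r : 0 < r -> dv (derive1 f) r ((Phi p (x (ln r)) (y (ln r)) - y (ln r)) / r ^+ 2).
  move=> r0; apply: (dv_near (f := fun r => y (ln r) / r)); last exact: dv_global1.
  by apply: near_pos => // s s0; rewrite derive_global.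
have cln (r : R) : 0 < r -> {for r, continuous (@ln R)} by move=> r0; exact: (dv_cont (dln r r0)).
split.
  apply: C_pos_dv dv_global _; apply: C_pos_dv dv_global1 _; apply/C_pos0 => r r0.
  have cx : {for r, continuous (fun r => x (ln r))}.
    by apply: (continuous_comp (f := @ln R)); [exact: cln|exact: (dv_cont (hs _).1)].
  have cy : {for r, continuous (fun r => y (ln r))}.
    by apply: (continuous_comp (f := @ln R)); [exact: cln|exact: (dv_cont (hs _).2)].
  apply: cvgM; first by apply: cvgB => //; exact: (Phi_cont hp1 hp2).
  apply: cvgV; first by rewrite expf_neq0// gt_eqF.
  have dsq : dv (fun r : R => r ^+ 2) r (2 * r) by dstep; rewrite /=; ring.
  exact: dv_cont dsq.
move=> r r0; rewrite /ode derive1nS derive1n1 (dv_derive1 (d2 r r0)) derive_global// fE//.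
set a := x _; set b := y _.
have [[-> ->]|D0] := den_cases hp1 b (sin a).
  by rewrite !(mul0r, mulr0, expr0n, addr0, subr0)/=.
by rewrite /Phi; field; rewrite !gt_eqF.
Qed.

(** Bootstrap on the pair f, g = f': g' is a rational expression in r, g, sin f and cos f whose
    denominators do not vanish, by hypothesis. *)
Lemma smooth_of_sol : (forall t, ~ (y t = 0 /\ sin (x t) = 0)) -> smooth_pos f.
Proof.
move=> nd; pose g r := y (ln r) / r.
suff h k : C_pos k f /\ C_pos k g by move=> k; have [] := h k.
have rg r : 0 < r -> r * g r = y (ln r).
  by move=> r0; rewrite /g mulrC divfK// gt_eqF.
have D0 r : 0 < r -> (p - 1) * (r * g r) ^+ 2 + sin (f r) ^+ 2 != 0.
  move=> r0; rewrite rg// fE//.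
  have [/nd//|] := den_cases hp1 (y (ln r)) (sin (x (ln r))).
  exact: lt0r_neq0.
elim: k => [|k [cf cg]].
  split; apply/C_pos0 => r r0; first exact: (dv_cont (dv_global r r0)).
  exact: (dv_cont (dv_global1 r r0)).
split; first exact: C_pos_dv dv_global cg.
have [cs cc] := C_pos_sincos _ _ cf.
have crg := C_posM _ _ _ (C_pos_id k) cg.
apply: (C_pos_dv _ _ (fun r => (((p - 2) * (r * g r) * ((r * g r) ^+ 2 + sin (f r) ^+ 2)
   + sin (f r) * cos (f r) * ((3 - p) * (r * g r) ^+ 2 + sin (f r) ^+ 2))
  * ((p - 1) * (r * g r) ^+ 2 + sin (f r) ^+ 2)^-1 + (-1) * (r * g r)) * (r ^+ 2)^-1)).
  move=> r r0; apply: dv_eq (dv_global1 r r0) _.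
  by rewrite /Phi fE// rg// mulN1r.
have cV2 := C_posV _ _ (fun r (r0 : 0 < r) => expf_neq0 2 (lt0r_neq0 r0)) (C_posX k 2 _ (C_pos_id k)).
apply: C_posM => //; apply: C_posD; last exact: C_posM (C_pos_cst _ _) crg.
have c := C_pos_cst k; have q := C_posX k 2 _ crg; have q' := C_posX k 2 _ cs.
apply: C_posM; last first.
  by apply: C_posV => //; apply: C_posD => //; apply: C_posM.
apply: C_posD; apply: C_posM.
- exact: C_posM.
- exact: C_posD.
- exact: C_posM.
- by apply: C_posD => //; apply: C_posM.
Qed.
End Transfer.

(** * The Lyapunov function *)

Section Limits.
Context {R : realType}.

Definition tends (f : R -> R) (l : R) : Prop :=
  forall e, 0 < e -> exists T, forall t, T <= t -> `|f t - l| < e.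

Lemma tends_nonincr {f : R -> R} {T m : R} :
  (forall s t, T <= s -> s <= t -> f t <= f s) -> (forall t, T <= t -> m <= f t) ->
  exists l, tends f l /\ forall t, T <= t -> l <= f t.
Proof.
move=> mono lb; pose S := [set z | exists2 t, T <= t & z = f t].
have hS : has_inf S by split; [exists (f T), T|exists m => _ [t tT ->]; exact: lb].
have lbi t : T <= t -> inf S <= f t.
  by move=> tT; apply: ge_inf; [case: hS|exists t].
exists (inf S); split=> // e e0.
have [_ [t tT ->] h] := inf_adherent e0 hS.
exists t => s ts; have sT := le_trans tT ts; have := mono _ _ tT ts.
by have := lbi s sT; rewrite ltr_norml => *; apply/andP; split; lra.
Qed.

Lemma tends_unique {f : R -> R} {l l' : R} : tends f l -> tends f l' -> l = l'.
Proof.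
move=> h h'; apply/eqP; apply/negPn/negP => ll.
have e0 : 0 < `|l - l'| / 2 by rewrite divr_gt0// normr_gt0 subr_eq0.
have [T hT] := h _ e0; have [T' hT'] := h' _ e0.
have := hT (Num.max T T'); have := hT' (Num.max T T').
rewrite !le_max !lexx orbT => /(_ isT) h1 /(_ isT) h2.
have : `|l - l'| <= `|f (Num.max T T') - l'| + `|f (Num.max T T') - l|.
  by rewrite -[`|_ - l|]normrN; apply: le_trans (ler_normD _ _); rewrite le_eqVlt; apply/orP; left; apply/eqP; congr `|_|; ring.
by move=> *; lra.
Qed.

Lemma tends_le {f : R -> R} {l T c : R} : tends f l -> (forall t, T <= t -> f t <= c) -> l <= c.
Proof.
move=> h hc; rewrite leNgt; apply/negP => cl.
have [S hS] := h (l - c) ltac:(by rewrite subr_gt0).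
have := hS (Num.max S T); have := hc (Num.max S T).
rewrite !le_max !lexx orbT => /(_ isT) h1 /(_ isT); rewrite ltr_norml => /andP[? ?]; lra.
Qed.

Lemma tends_ge {f : R -> R} {l T c : R} : tends f l -> (forall t, T <= t -> c <= f t) -> c <= l.
Proof.
move=> h hc; rewrite leNgt; apply/negP => cl.
have [S hS] := h (c - l) ltac:(by rewrite subr_gt0).
have := hS (Num.max S T); have := hc (Num.max S T).
rewrite !le_max !lexx orbT => /(_ isT) h1 /(_ isT); rewrite ltr_norml => /andP[? ?]; lra.
Qed.

Lemma tends_sq {f : R -> R} : tends (fun t => f t ^+ 2) 0 -> tends f 0.
Proof.
move=> h e e0; have [T hT] := h (e ^+ 2) ltac:(by rewrite exprn_gt0).
exists T => t /hT; rewrite !subr0 normrX; rewrite ltr_sqr ?nnegrE//; exact: ltW.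
Qed.

Lemma lip_dv {f df : R -> R} {T M : R} : (forall t, T <= t -> dv f t (df t)) ->
  (forall t, T <= t -> `|df t| <= M) ->
  forall s t, T <= s -> T <= t -> `|f t - f s| <= M * `|t - s|.
Proof.
move=> h b s t; wlog st : s t / s < t.
  move=> hw sT tT; case: (ltgtP s t) => [st|ts|->]; first exact: hw.
    by rewrite distrC [`|t - s|]distrC; exact: hw.
  by rewrite !subrr normr0 mulr0.
move=> sT tT; have [|c /andP[sc ct] ->] := mvt st (f := f) (df := df).
  by move=> u /andP[su _]; apply: h; apply: le_trans su.
by rewrite normrM ler_wpM2r// b// (le_trans sT)// ltW.
Qed.

(** Barbalat's lemma for a lower bound k of |g'|. Since g converges, on [t, t + d] there is a point
    c with |g' c| < e / 2, hence k c < e / 2, and the Lipschitz bound carries this to t at a cost L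
    d <= e / 2. The L + 1 in d covers L = 0. *)
Lemma barbalat {g dg k : R -> R} {T L l : R} : 0 <= L ->
  (forall t, T <= t -> dv g t (dg t)) -> (forall t, T <= t -> 0 <= k t <= `|dg t|) ->
  (forall s t, T <= s -> T <= t -> `|k t - k s| <= L * `|t - s|) ->
  tends g l -> tends k 0.
Proof.
move=> L0 hg hk hL hl e e0.
pose d := e / (2 * (L + 1)).
have d0 : 0 < d by rewrite divr_gt0// mulr_gt0// ltr_wpDl.
have ed : 0 < e * d / 4 by rewrite divr_gt0// mulr_gt0.
have [S hS] := hl _ ed.
exists (Num.max S T) => t; rewrite ge_max => /andP[St Tt].
have td : t < t + d by rewrite ltrDl.
have [|c /andP[tc cd] gc] := mvt td (f := g) (df := dg).
  by move=> u /andP[tu _]; apply: hg; apply: le_trans tu.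
have Tc : T <= c by rewrite (le_trans Tt)// ltW.
have h1 := hS _ St; have h2 := hS (t + d) (le_trans St (ltW td)).
have /andP[kt0 _] := hk _ Tt; have /andP[kc0 kc] := hk _ Tc.
rewrite subr0 ger0_norm//.
have h3 := hL c t Tc Tt.
have dgd : `|dg c| * d < e * d / 2.
  have -> : `|dg c| * d = `|(g (t + d) - l) - (g t - l)|.
    rewrite (_ : _ - _ = g (t + d) - g t); last by ring.
    by rewrite gc addrAC subrr add0r normrM (gtr0_norm d0).
  apply: le_lt_trans (ler_normB _ _) _; lra.
have dgc : `|dg c| < e / 2 by rewrite -(ltr_pM2r d0); lra.
have Ld : L * `|t - c| <= e / 2.
  apply: le_trans (_ : (L + 1) * d <= _); last first.
    by rewrite /d le_eqVlt; apply/orP; left; apply/eqP; field; rewrite gt_eqF// ltr_wpDl.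
  apply: ler_pM => //; first by lra.
  by rewrite ltr0_norm; lra.
by move: h3; rewrite ler_norml => /andP[? ?]; lra.
Qed.

Lemma tends_abs {k : R -> R} : tends (fun t => `|k t|) 0 -> tends k 0.
Proof. by move=> h e /h[T hT]; exists T => t /hT; rewrite !subr0 normr_id. Qed.

Lemma lip_abs (a b : R) : `| `|a| - `|b| | <= `|a - b|.
Proof. exact: ler_dist_dist. Qed.

Lemma barbalat_dv {g k : R -> R} {T L l : R} : 0 <= L ->
  (forall t, T <= t -> dv g t (k t)) ->
  (forall s t, T <= s -> T <= t -> `|k t - k s| <= L * `|t - s|) ->
  tends g l -> tends k 0.
Proof.
move=> L0 hg hL hl; apply: tends_abs.
apply: (barbalat (g := g) (dg := k) (k := fun t => `|k t|) L0 hg _ _ hl) => [t _|s t sT tT].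
  by rewrite normr_ge0 lexx.
by apply: le_trans (lip_abs _ _) _; exact: hL.
Qed.

End Limits.

(** * Decrease of [V] and convergence inside a strip *)

Section Lyapunov.
Context {R : realType} {p : R} (hp1 : 1 < p) (hp2 : p < 2).
Local Ltac plra := move: (hp1) (hp2) => ? ?; lra.

Definition V (x y : R) : R :=
  ((p - 1) * y ^+ 2 - sin x ^+ 2) * (y ^+ 2 + sin x ^+ 2) `^ (p / 2 - 1).

Definition nontrivial (x y : R -> R) : Prop :=
  forall t, ~ (y t = 0 /\ sin (x t) * cos (x t) = 0).

Lemma nontrivial1 {x y : R -> R} (t : R) : sol p x y ->
  ~ (y t = 0 /\ sin (x t) * cos (x t) = 0) -> nontrivial x y.
Proof.
move=> h nt s [ys scs]; have [xt yt] := sol_eq hp1 hp2 s h ys scs t.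
by apply: nt; rewrite xt yt.
Qed.

Lemma V_lt0 (x y : R) : 0 < y ^+ 2 + sin x ^+ 2 -> (V x y < 0) = ((p - 1) * y ^+ 2 < sin x ^+ 2).
Proof. by move=> N0; rewrite /V pmulr_llt0 ?powR_gt0// subr_lt0. Qed.

Lemma V_gt0 (x y : R) : 0 < y ^+ 2 + sin x ^+ 2 -> (0 < V x y) = (sin x ^+ 2 < (p - 1) * y ^+ 2).
Proof. by move=> N0; rewrite /V pmulr_lgt0 ?powR_gt0// subr_gt0. Qed.

Section Trajectory.
Context {x y : R -> R} (hs : sol p x y) (nt : nontrivial x y).

Lemma cont_x t : {for t, continuous x}. Proof. exact: dv_cont (hs t).1. Qed.
Lemma cont_y t : {for t, continuous y}. Proof. exact: dv_cont (hs t).2. Qed.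

Lemma N_gt0 t : 0 < y t ^+ 2 + sin (x t) ^+ 2.
Proof.
rewrite lt_neqAle addr_ge0 ?sqr_ge0// andbT eq_sym paddr_eq0 ?sqr_ge0// !sqrf_eq0.
by apply/negP => /andP[/eqP y0 /eqP s0]; apply: (nt t); rewrite y0 s0 mul0r.
Qed.

Lemma dv_V t : dv (fun t => V (x t) (y t)) t
  (- ((2 - p) * p * y t ^+ 2 * (y t ^+ 2 + sin (x t) ^+ 2) `^ (p / 2 - 1))).
Proof.
have [dx dy] := hs t; have N0 := N_gt0 t.
rewrite /V; dstep.
have D0 : (p - 1) * y t ^+ 2 + sin (x t) ^+ 2 != 0.
  have [[y0 s0]|] := den_cases hp1 (y t) (sin (x t)); last exact: lt0r_neq0.
  by exfalso; apply: (nt t); rewrite y0 s0 mul0r.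
have -> : (y t ^+ 2 + sin (x t) ^+ 2) `^ (p / 2 - 1 - 1) =
    (y t ^+ 2 + sin (x t) ^+ 2) `^ (p / 2 - 1) / (y t ^+ 2 + sin (x t) ^+ 2).
  by rewrite (@powRB _ _ (p / 2 - 1)) ?powRr1 ?(ltW N0)// lt0r_neq0// implybT.
set Q := _ `^ _; rewrite /Phi /=.
by field; rewrite D0 lt0r_neq0.
Qed.

Lemma V_nonincr s t : s <= t -> V (x t) (y t) <= V (x s) (y s).
Proof.
move=> st; apply: (nonincr_dv st (f := fun t => V (x t) (y t))) => [u _|u _].
  exact: dv_V.
rewrite oppr_le0; nneg; plra.
Qed.

(** Equal values at s and t would make [V] constant in between, hence y zero there by [dv_V]; then
    y' = sin x cos x vanishes too and the trajectory sits at an equilibrium. *)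
Lemma V_decr s t : s < t -> V (x t) (y t) < V (x s) (y s).
Proof.
move=> st; rewrite lt_neqAle V_nonincr 1?ltW// andbT; apply/eqP => e.
have y0 u : s < u < t -> y u = 0.
  case/andP=> su ut.
  have d0 : dv (fun t => V (x t) (y t)) u 0.
    apply: (dv_near (f := cst (V (x s) (y s)))); last exact: dv_cst.
    near=> w; apply/eqP; rewrite eq_le /cst.
    have sw : s <= w by apply/ltW; near: w; exact: lt_nbhsr.
    have wt : w <= t by apply/ltW; near: w; exact: lt_nbhsl.
    by rewrite (V_nonincr _ _ sw) andbT -e V_nonincr.
  have := dv_derive1 (dv_V u); rewrite (dv_derive1 d0) => /esym/eqP.
  have Q0 := powR_gt0 (p / 2 - 1) (N_gt0 u).
  rewrite oppr_eq0 mulf_eq0 (gt_eqF Q0) orbF mulf_eq0 sqrf_eq0 mulf_eq0 => /orP[/orP[]|/eqP//] /eqP; plra.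
pose u := (s + t) / 2.
have su : s < u by rewrite /u; plra.
have ut : u < t by rewrite /u; plra.
have yu := y0 u; rewrite su ut in yu; have {}yu := yu isT.
apply: (nt u); split=> //.
have := (hs u).2; rewrite yu (Phi0) // => dy.
have d0 : dv y u 0.
  apply: (dv_near (f := cst 0)); last exact: dv_cst.
  near=> w; rewrite y0//; apply/andP; split; near: w; [exact: lt_nbhsr|exact: lt_nbhsl].
by rewrite -(dv_derive1 dy) (dv_derive1 d0).
Unshelve. all: by end_near. Qed.

Lemma sin_neq0 t : V (x t) (y t) < 0 -> sin (x t) != 0.
Proof.
rewrite V_lt0 ?N_gt0//; apply: contraTneq => ->.
by rewrite expr0n -leNgt mulr_ge0 ?sqr_ge0// subr_ge0 ltW.
Qed.

Lemma strip {a b : R} : a <= b -> (forall t, a <= t <= b -> sin (x t) != 0) ->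
  (0 < x a < pi) = (0 < x b < pi).
Proof.
move=> ab h.
have h1 : (0 < x a) = (0 < x b).
  apply: (const_sign ab) => [t _|t /h]; first exact: cont_x.
  by apply: contra_neq => ->; rewrite sin0.
have h2 : (0 < pi - x a) = (0 < pi - x b).
  apply: (const_sign (f := fun t => pi - x t) ab) => [t _|t /h].
    by apply: cvgB; [exact: cvg_cst|exact: cont_x].
  by apply: contra_neq => /eqP; rewrite subr_eq0 => /eqP <-; rewrite sinpi.
by rewrite h1 -(subr_gt0 (x a)) h2 subr_gt0.
Qed.

Lemma y_bound t : V (x t) (y t) < 0 -> y t ^+ 2 <= (p - 1)^-1.
Proof.
rewrite V_lt0 ?N_gt0// => h; have p0 : 0 < p - 1 by plra.
rewrite -[leRHS]mul1r ler_pdivlMr// mulrC; apply: le_trans (ltW h) _.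
by rewrite -(cos2Dsin2 (x t)) lerDr sqr_ge0.
Qed.

Lemma y_bound' t : V (x t) (y t) < 0 -> `|y t| <= (p - 1)^-1.
Proof.
move=> /y_bound h; have p0 : 0 < p - 1 by plra.
rewrite -ler_sqr ?nnegrE ?invr_ge0 ?(ltW p0)//.
rewrite real_normK ?num_real//; apply: le_trans h _.
rewrite expr2 ler_peMl ?invr_ge0 ?(ltW p0)// invf_ge1//; plra.
Qed.

Lemma Phi_bound (a b : R) : `|Phi p a b| <= 1 + lipC p * `|b|.
Proof.
rewrite -{1}(subrK (Phi p a 0) (Phi p a b)) [X in `|X|]addrC.
apply: le_trans (ler_normD _ _) (lerD _ _).
  by rewrite Phi0 normrM -[leRHS]mulr1; apply: ler_pM; rewrite ?normr_ge0 ?sin_max ?norm_cos_le1.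
apply: le_trans (Phi_lip hp1 hp2 _ _ _ _) _.
by rewrite subrr normr0 add0r subr0.
Qed.

(** The exponent p/2 - 1 is negative, so removing y^2 from both factors gives -V <= |sin x|^p <=
    |sin x|. As [V] decreases, a trajectory with V < 0 stays uniformly away from the multiples of
    pi. *)
Lemma sin_lower t v : v <= - V (x t) (y t) -> 0 < v -> v <= `|sin (x t)|.
Proof.
move=> hv v0; have s0 : sin (x t) != 0 by apply: sin_neq0; plra.
have s2 : 0 < sin (x t) ^+ 2 by rewrite exprn_even_gt0.
apply: le_trans hv _; rewrite /V -mulNr opprB.
have N0 := N_gt0 t.
have e : (y t ^+ 2 + sin (x t) ^+ 2) `^ (p / 2 - 1) <= (sin (x t) ^+ 2) `^ (p / 2 - 1).
  rewrite -[p / 2 - 1]opprK !(powRN _ (- (p / 2 - 1))) lef_pV2 ?posrE ?powR_gt0//.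
  by apply: ge0_ler_powR; rewrite ?nnegrE ?(ltW N0) ?(ltW s2)//; [plra|rewrite lerDr sqr_ge0].
apply: le_trans (_ : sin (x t) ^+ 2 * (sin (x t) ^+ 2) `^ (p / 2 - 1) <= _).
  apply: le_trans (_ : sin (x t) ^+ 2 * (y t ^+ 2 + sin (x t) ^+ 2) `^ (p / 2 - 1) <= _).
    rewrite ler_wpM2r ?powR_ge0// gerBl mulr_ge0 ?sqr_ge0//; plra.
  by rewrite ler_wpM2l// ltW.
rewrite mulr_powRB1 ?(ltW s2)//; last by plra.
rewrite -sqrtr_sqr -powR12_sqrt ?(ltW s2)//; apply: ger_powR; last by plra.
by rewrite s2 -(cos2Dsin2 (x t)) lerDr sqr_ge0.
Qed.

Lemma V_zero t : y t = 0 -> V (x t) (y t) = - (sin (x t) ^+ 2) `^ (p / 2).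
Proof.
move=> y0; rewrite /V y0 expr0n mulr0 !add0r mulNr mulr_powRB1 ?sqr_ge0//; plra.
Qed.

(** [V] decreases and is bounded below, so it converges. Barbalat's lemma applied to [V] gives y ->
    0 and, applied to y, gives y' -> 0. By the Lipschitz bound sin x cos x -> 0, and |sin x| is
    bounded below. *)
Lemma converge T : V (x T) (y T) < 0 -> 0 < x T < pi -> tends x (pi / 2) /\ tends y 0.
Proof.
move=> VT xT; have p0 : 0 < p - 1 by plra.
have Vn t : T <= t -> V (x t) (y t) < 0 by move=> /V_nonincr/le_lt_trans; apply.
have xs t : T <= t -> 0 < x t < pi.
  by move=> Tt; rewrite -(strip Tt)// => u /andP[Tu _]; apply: sin_neq0; exact: Vn.
pose Y : R := (p - 1)^-1; pose M := 1 + lipC p * Y.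
have Y0 : 0 < Y by rewrite invr_gt0.
have lc0 : 0 < lipC p by apply: lt_le_trans (lipC_ge1 hp1 hp2).
have M0 : 0 < M by rewrite ltr_wpDr// mulr_ge0// ltW.
have yb t : T <= t -> `|y t| <= Y by move=> /Vn/y_bound'.
have zb t : T <= t -> `|Phi p (x t) (y t)| <= M.
  move=> /yb h; apply: le_trans (Phi_bound _ _) _.
  by rewrite lerD2l ler_wpM2l// ltW.
have lx := lip_dv (fun t (_ : T <= t) => (hs t).1) yb.
have ly := lip_dv (fun t (_ : T <= t) => (hs t).2) zb.
have [l [Vl _]] : exists l, tends (fun t => V (x t) (y t)) l /\ forall t, T <= t -> l <= V (x t) (y t).
  apply: (tends_nonincr (m := -1)) => [s t _|t /Vn Vt]; first exact: V_nonincr.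
  rewrite lerNl; apply: le_trans (sin_lower t _ (lexx _) _) (sin_max _).
  by rewrite oppr_gt0.
(* [Nm] bounds y^2 + sin^2 x and the exponent is negative, so kap y^2 is a lower bound of |V'|, to
   which Barbalat's lemma applies. *)
pose Nm : R := Y + 1; pose kap := (2 - p) * p * Nm `^ (p / 2 - 1).
have Nm0 : 0 < Nm by rewrite addr_gt0.
have kap0 : 0 < kap by rewrite /kap !mulr_gt0 ?powR_gt0//; plra.
have ty2 : tends (fun t => kap * y t ^+ 2) 0.
  apply: (barbalat (T := T) (L := kap * (2 * Y * M)) _ (fun t _ => dv_V t) _ _ Vl).
  - by nneg.
  - move=> t Tt; rewrite mulr_ge0 ?sqr_ge0 ?(ltW kap0)//= normrN ger0_norm; last first.
      by nneg; plra.
    rewrite /kap [leLHS]mulrAC ler_wpM2l//.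
      by nneg; plra.
    rewrite -[p / 2 - 1]opprK !(powRN _ (- (p / 2 - 1))) lef_pV2 ?posrE ?powR_gt0 ?N_gt0//.
    apply: ge0_ler_powR; rewrite ?nnegrE ?(ltW (N_gt0 _))//; [plra|plra|].
    rewrite lerD//; first exact: y_bound (Vn _ Tt).
  - move=> s t sT tT; rewrite -mulrBr normrM (gtr0_norm kap0) -[leRHS]mulrA ler_wpM2l ?(ltW kap0)//.
    rewrite subr_sqr normrM mulrC -[leRHS]mulrA; apply: ler_pM => //; last exact: ly.
    by apply: le_trans (ler_normD _ _) _; have := yb _ sT; have := yb _ tT; plra.
have ty : tends y 0.
  apply: tends_sq => e e0; have [S hS] := ty2 (kap * e) (mulr_gt0 kap0 e0).
  exists S => t /hS; rewrite !subr0 normrM (gtr0_norm kap0) ltr_pM2l//.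
split=> //.
have tz : tends (fun t => Phi p (x t) (y t)) 0.
  apply: (barbalat_dv (T := T) (L := lipC p * (Y + M)) _ (fun t _ => (hs t).2) _ ty).
    by nneg.
  move=> s t sT tT; apply: le_trans (Phi_lip hp1 hp2 _ _ _ _) _.
  by rewrite -mulrA ler_wpM2l ?(ltW lc0)// mulrDl lerD ?lx ?ly.
pose v := - V (x T) (y T); have v0 : 0 < v by rewrite oppr_gt0.
have sv t : T <= t -> v <= `|sin (x t)|.
  by move=> Tt; apply: sin_lower => //; rewrite lerN2 V_nonincr.
have tc : tends (fun t => cos (x t)) 0.
  move=> e e0; have e1 : 0 < v * e / 2 by rewrite divr_gt0// mulr_gt0.
  have [S1 hS1] := tz _ e1; have e2 : 0 < v * e / (2 * lipC p) by rewrite divr_gt0// mulr_gt0.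
  have [S2 hS2] := ty _ e2.
  exists (Num.max T (Num.max S1 S2)) => t; rewrite !ge_max => /and3P[tT /hS1 t1 /hS2 t2].
  move: t1 t2; rewrite !subr0 => t1 t2.
  have h := Phi_lip hp1 hp2 (x t) (y t) (x t) 0.
  rewrite subrr normr0 add0r subr0 Phi0// in h.
  have h2 : lipC p * `|y t| < v * e / 2.
    by rewrite (_ : v * e / 2 = lipC p * (v * e / (2 * lipC p))) ?ltr_pM2l//; field; rewrite gt_eqF.
  have h3 : `|sin (x t) * cos (x t)| < v * e.
    rewrite (_ : _ * _ = Phi p (x t) (y t) - (Phi p (x t) (y t) - sin (x t) * cos (x t))); last by ring.
    apply: le_lt_trans (ler_normB _ _) _; plra.
  rewrite -(ltr_pM2l v0); apply: le_lt_trans h3; rewrite normrM ler_wpM2r//.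
  exact: sv.
move=> e e0.
(* Inside the strip x is recovered as acos (cos x). *)
have ca : {for (0 : R), continuous acos} by apply: continuous_acos; rewrite ltrN10 ltr01.
have [d d0 hd] := near_abs ca e0.
have [S hS] := tc d d0.
exists (Num.max T S) => t; rewrite ge_max => /andP[tT /hS/hd].
rewrite acos0 cosK// in_itv/=; have /andP[? ?] := xs t tT; apply/andP; split; exact: ltW.
Qed.

End Trajectory.
End Lyapunov.
Arguments V {R} p x y.

(** * Enumeration of simple zeros *)

Section Zeros.
Context {R : realType}.

(** In Caratheodory's form of the derivative the factor g is continuous at t with value l, so it
    keeps the sign of l nearby. *)
Lemma simple_zero {f : R -> R} {t l : R} : dv f t l -> f t = 0 -> l != 0 ->
  exists2 d, 0 < d & forall u, `|u - t| < d -> exists g, f u = g * (u - t) /\ 0 < g * l.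
Proof.
move=> /is_derive1_caratheodory[g [hg cg gl]] f0 l0.
have cgl : {for t, continuous (fun u => g u * l)} by apply: cvgM => //; exact: cvg_cst.
have [|d d0 hd] := near_pball (near_gt 0 cgl _).
  by rewrite gl -expr2 exprn_even_gt0.
by exists d => // u /hd h; exists (g u); rewrite -hg f0 subr0.
Qed.

Section SimpleZeros.
Context {f : R -> R} (cf : forall t, {for t, continuous f}).
Hypothesis simple : forall t, f t = 0 -> exists2 l, dv f t l & l != 0.

Lemma isolated_zero {t : R} : f t = 0 ->
  exists2 d, 0 < d & forall u, u != t -> `|u - t| < d -> f u != 0.
Proof.
move=> f0; have [l dl l0] := simple t f0.
have [d d0 hd] := simple_zero dl f0 l0.
exists d => // u ut /hd[g [-> gl]]; rewrite mulf_neq0 ?subr_eq0//.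
by apply: contraTneq gl => ->; rewrite mul0r ltxx.
Qed.

(** The infimum of the zeros beyond a is a zero by continuity, and it differs from a because zeros
    are isolated. *)
Lemma next_zero (a : R) : (exists2 z, a < z & f z = 0) ->
  exists b, [/\ a < b, f b = 0 & forall t, a < t -> t < b -> f t != 0].
Proof.
case=> z az fz; pose S := [set t | a < t /\ f t = 0].
have hS : has_inf S by split; [exists z|exists a => t [/ltW]].
have lb t : S t -> inf S <= t by move=> St; apply: ge_inf => //; case: hS.
have ab : a <= inf S by apply: lb_le_inf; [exists z|move=> t [/ltW]].
have fb : f (inf S) = 0.
  apply/eqP/negPn/negP => fb.
  have [|d d0 hd] := near_abs (cf (inf S)) (_ : 0 < `|f (inf S)|).
    by rewrite normr_gt0.
  have [t St] := inf_adherent d0 hS; have := lb t St; case: St => _ ft bt tb.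
  have /hd : `|t - inf S| < d by rewrite ger0_norm ?subr_ge0// ltrBlDl.
  by rewrite ft sub0r normrN ltxx.
have ab' : a < inf S.
  rewrite lt_neqAle ab andbT; apply/eqP => e; rewrite -e in fb.
  have [d d0 hd] := isolated_zero fb.
  have [t St] := inf_adherent d0 hS; case: St => at0 ft; rewrite -e => tb.
  have := hd t (negbT (gt_eqF at0)); rewrite gtr0_norm ?subr_gt0// ltrBlDl => /(_ tb).
  by rewrite ft eqxx.
exists (inf S); split=> // t at0 tb; apply/eqP => ft.
by have := lb t (conj at0 ft); rewrite leNgt tb.
Qed.

(** Iterating [next_zero] from a lists every zero: were the list bounded, its supremum would be a
    zero that is not isolated. *)
Lemma zero_sequence (a : R) : (forall t, t <= a -> f t != 0) ->
  (forall T, exists2 t, T < t & f t = 0) ->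
  exists s : nat -> R,
    [/\ a < s 0%N, forall n, s n < s n.+1, forall T, exists n, T < s n,
        (forall t, t < s 0%N -> f t != 0) /\ (forall n t, s n < t -> t < s n.+1 -> f t != 0)
      & (forall n, f (s n) = 0) /\ forall t, f t = 0 -> exists n, t = s n].
Proof.
move=> fa unb.
have /choice[nz hnz] : forall b, exists c, [/\ b < c, f c = 0 & forall t, b < t -> t < c -> f t != 0].
  by move=> b; exact/next_zero/unb.
pose s n := iter n nz (nz a).
have sS (n : nat) : s n < s n.+1 by rewrite /s iterS; case: (hnz (iter n nz (nz a))).
have s0 (n : nat) : f (s n) = 0.
  case: n => [|n]; first by rewrite /s /=; case: (hnz a).
  by rewrite /s iterS; case: (hnz (iter n nz (nz a))).
have as0 : a < s 0%N by rewrite /s /=; case: (hnz a).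
have smono (n m : nat) : (n <= m)%N -> s n <= s m.
  elim: m => [|m ih]; first by rewrite leqn0 => /eqP->.
  by rewrite leq_eqVlt => /orP[/eqP->//|/ih h]; apply: le_trans h (ltW (sS m)).
have sunb (T : R) : exists n : nat, T < s n.
  apply: contrapT => /forallNP h.
  have hS : has_sup (range s).
    split; first by exists (s 0%N), 0%N.
    by exists T => _ [n _ <-]; rewrite leNgt; apply/negP/h.
  pose m := sup (range s).
  have ub (n : nat) : s n <= m by apply: ub_le_sup; [case: hS|exists n].
  have ub' (n : nat) : s n < m by apply: lt_le_trans (sS n) (ub n.+1).
  have fm : f m = 0.
    apply/eqP/negPn/negP => fb.
    have [|d d0 hd] := near_abs (cf m) (_ : 0 < `|f m|); first by rewrite normr_gt0.
    have [_ [n _ <-] sn] := sup_adherent d0 hS.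
    have /hd : `|s n - m| < d.
      by rewrite ltr0_norm ?subr_lt0// opprB ltrBlDr -ltrBlDl.
    by rewrite s0 sub0r normrN ltxx.
  have [d d0 hd] := isolated_zero fm.
  have [_ [n _ <-] sn] := sup_adherent d0 hS.
  have sd : `|s n - m| < d by rewrite ltr0_norm ?subr_lt0// opprB ltrBlDr -ltrBlDl.
  by have := hd (s n) (negbT (lt_eqF (ub' n))) sd; rewrite s0 eqxx.
have n0 t : t < s 0%N -> f t != 0.
  move=> ts; have [ta|at0] := leP t a; first exact: fa.
  by have [_ _] := hnz a; apply.
have nS (n : nat) t : s n < t -> t < s n.+1 -> f t != 0.
  by rewrite /s iterS; case: (hnz (iter n nz (nz a))) => _ _; apply.
exists s; split=> //; split=> // t ft.
have ex : exists n : nat, t <= s n by have [n /ltW h] := sunb t; exists n.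
case: (ex_minnP ex) => n tn min; exists n; apply/eqP; rewrite eq_le tn/= leNgt; apply/negP => ltn.
case: n tn min ltn => [|n] tn min ltn; first by move: (n0 t ltn); rewrite ft eqxx.
have [tsn|snt] := leP t (s n); first by have := min _ tsn; rewrite ltnn.
by have := nS n t snt ltn; rewrite ft eqxx.
Qed.
End SimpleZeros.
End Zeros.

(** * Unboundedness of the set of critical times *)

Section Oscillation.
Context {R : realType} {p : R} (hp1 : 1 < p) (hp2 : p < 2).
Local Ltac plra := move: (hp1) (hp2) => ? ?; lra.

Lemma sol_refl {x y : R -> R} : sol p x y -> sol p (fun t => pi - x t) (fun t => - y t).
Proof.
move=> /solN/(sol_int 1) h; rewrite (_ : (fun t => pi - x t) = (fun t => - x t + 1%:~R * pi))//.
by apply/funext => t; rewrite mul1r addrC.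
Qed.

Lemma cos_lt0_pi (z : R) : pi / 2 < z < pi -> cos z < 0.
Proof.
case/andP=> z1 z2; have pi0 : 0 < pi :> R := pi_gt0 R.
by rewrite -(cos_pihalf R) ltr_cos// in_itv /=; apply/andP; split; lra.
Qed.

Section Trajectory.
Context {x y : R -> R} (hs : sol p x y) (nt : nontrivial x y).

Lemma strip_after T t : V p (x T) (y T) < 0 -> 0 < x T < pi -> T <= t -> 0 < x t < pi.
Proof.
move=> VT xT Tt; rewrite -(strip hs Tt)// => u /andP[Tu _].
by apply: (sin_neq0 hp1 nt); apply: le_lt_trans VT; exact: (V_nonincr hp1 hp2 hs nt).
Qed.

Lemma y_simple t : y t = 0 -> exists2 l, dv y t l & l != 0.
Proof.
move=> y0; exists (sin (x t) * cos (x t)); first by have := (hs t).2; rewrite y0 Phi0.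
by apply/eqP => sc; apply: (nt t).
Qed.

(* Along y <> 0 the quotient Q = y / cos x satisfies Q' >= (1 + Q^2) / 4 near the
   centre, so that atan Q would be unbounded. *)
Lemma y_zero_after T : V p (x T) (y T) < 0 -> 0 < x T < pi ->
  forall T', exists2 t, T' < t & y t = 0.
Proof.
move=> VT xT T'; apply: contrapT => nz.
have {}nz t : T' < t -> y t != 0.
  by move=> Tt; apply/eqP => yt; apply: nz; exists t.
have [tx ty] := converge hp1 hp2 hs nt T VT xT.
have p0 : 0 < p - 1 by plra.
have cx := cont_x hs; have cy := cont_y hs.
have [T1 hT1] : exists T1, forall t, T1 <= t -> 3 / 4 <= sin (x t) /\ y t ^+ 2 <= (p - 1) / 4.
  have cs : {for pi / 2, continuous (@sin R)} by exact: continuous_sin.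
  have q4 : 0 < 1 / 4 :> R by rewrite divr_gt0.
  have [d d0 hd] := near_abs cs q4; have [S1 h1] := tx d d0.
  have [S2 h2] := ty ((p - 1) / 4) (divr_gt0 p0 (ltr0n _ 4)).
  exists (Num.max S1 S2) => t; rewrite ge_max => /andP[/h1/hd + /h2].
  rewrite sin_pihalf subr0 ltr_norml => /andP[? ?] yt; split; first by lra.
  rewrite -real_normK ?num_real// expr2 -[leRHS]mul1r; apply: ler_pM => //; last exact: ltW.
  by apply: ltW; apply: lt_trans yt _; plra.
pose T2 := Num.max T (Num.max T1 (T' + 1)).
have T2' t : T2 <= t -> T' < t.
  by rewrite !ge_max => /and3P[_ _]; apply: lt_le_trans; rewrite ltrDl.
have T21 t : T2 <= t -> T1 <= t by rewrite !ge_max => /and3P[].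
have T20 t : T2 <= t -> 0 < x t < pi.
  by rewrite !ge_max => /and3P[Tt _ _]; exact: (strip_after T t VT xT Tt).
have sgn a b : T2 <= a -> a <= b -> (0 < y a) = (0 < y b).
  move=> Ta ab; apply: (const_sign ab) => t; first by move=> _; exact: cy.
  by case/andP => at0 _; apply: nz; apply: T2'; apply: le_trans at0.
(* As y keeps its sign, x tends to pi/2 monotonically, from one side; so y and cos x have the same
   sign and Q is positive. *)
have side t : T2 <= t -> 0 < y t * cos (x t).
  move=> T2t; have /andP[x0 xp] := T20 t T2t.
  have t1 : t < t + 1 by rewrite ltrDl.
  have [yt|yt] := boolP (0 < y t).
    have yu u : t <= u -> 0 < y u by move=> tu; rewrite -(sgn _ _ T2t tu).
    apply: mulr_gt0; first exact: yt.
    apply: cos_gt0_pihalf; apply/andP; split.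
      by apply: lt_trans x0; rewrite oppr_lt0 divr_gt0// pi_gt0.
    apply: (@lt_le_trans _ _ (x (t + 1))).
      apply: (incr_dv t1 (f := x) (df := y)) => [w _|w /andP[/ltW/yu]//]; exact: (hs w).1.
    apply: (tends_ge (T := t + 1)) tx _ => u tu.
    apply: (nondecr_dv tu (f := x) (df := y)) => [w _|w /andP[/ltW tw _]]; first exact: (hs w).1.
    by apply/ltW/yu; apply: le_trans tw; exact: ltW.
  have yu u : t <= u -> y u < 0.
    by move=> tu; rewrite lt_neqAle leNgt -(sgn _ _ T2t tu) yt andbT nz// T2'// (le_trans T2t).
  rewrite nmulr_rgt0 ?yu//; apply: cos_lt0_pi; rewrite xp andbT.
  apply: (@le_lt_trans _ _ (x (t + 1))).
    apply: (tends_le (T := t + 1)) tx _ => u tu.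
    apply: (nonincr_dv tu (f := x) (df := y)) => [w _|w /andP[/ltW tw _]]; first exact: (hs w).1.
    by apply/ltW/yu; apply: le_trans tw; exact: ltW.
  apply: (decr_dv t1 (f := x) (df := y)) => [w _|w /andP[/ltW/yu]//]; exact: (hs w).1.
pose Q t := y t / cos (x t).
pose dQ t := Phi p (x t) (y t) / cos (x t) + sin (x t) * Q t ^+ 2.
have c0 t : T2 <= t -> cos (x t) != 0.
  by move=> /side; apply: contraTneq => ->; rewrite mulr0 ltxx.
have dvQ t : T2 <= t -> dv Q t (dQ t).
  move=> /c0 ct; have [dx dy] := hs t; rewrite /Q; dstep => //.
  by rewrite /dQ /Q; field.
have Q0 t : T2 <= t -> 0 < Q t.
  move=> T2t; have := side t T2t.
  rewrite -(pmulr_lgt0 (y t * cos (x t)) (x := (cos (x t) ^- 2))) ?invr_gt0 ?exprn_even_gt0//= ?c0//.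
  by rewrite /Q => h; apply: (lt_le_trans h); rewrite le_eqVlt; apply/orP; left; apply/eqP; field; exact: c0.
have lower t : T2 <= t -> (1 + Q t ^+ 2) / 4 <= dQ t.
  move=> T2t; have [s34 y2] := hT1 t (T21 t T2t).
  have qt := Q0 t T2t; have ct := c0 t T2t.
  have yQ : y t = Q t * cos (x t) by rewrite /Q divfK.
  set s := sin (x t) in s34 *.
  have s2 : 9 / 16 <= s ^+ 2.
    by have := ler_pM (_ : 0 <= 3 / 4 :> R) (_ : 0 <= 3 / 4 :> R) s34 s34; rewrite -expr2; lra.
  have D0 : 0 < (p - 1) * y t ^+ 2 + s ^+ 2.
    by apply: ltr_wpDl; [nneg; plra|lra].
  have e : dQ t = (s * ((3 - p) * y t ^+ 2 + s ^+ 2) - (2 - p) * Q t * (y t ^+ 2 + s ^+ 2))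
      / ((p - 1) * y t ^+ 2 + s ^+ 2) + s * Q t ^+ 2.
    rewrite /dQ /Phi -/s; congr (_ + _).
    by rewrite yQ in D0 *; field; rewrite ct lt0r_neq0.
  have h1 : s <= s * ((3 - p) * y t ^+ 2 + s ^+ 2) / ((p - 1) * y t ^+ 2 + s ^+ 2).
    rewrite ler_pdivlMr// ler_wpM2l//; first by lra.
    rewrite lerD2r ler_wpM2r ?sqr_ge0//; plra.
  have h2 : (2 - p) * Q t * (y t ^+ 2 + s ^+ 2) / ((p - 1) * y t ^+ 2 + s ^+ 2) <= Q t.
    rewrite ler_pdivrMr// -mulrA mulrCA ler_wpM2l ?(ltW qt)//.
    have a1 : (3 - 2 * p) * y t ^+ 2 <= 1 * y t ^+ 2 by rewrite ler_wpM2r ?sqr_ge0//; plra.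
    have a2 : (p - 1) * (9 / 16) <= (p - 1) * s ^+ 2 by rewrite ler_wpM2l// ltW.
    plra.
  have h3 : 3 / 4 * Q t ^+ 2 <= s * Q t ^+ 2 by rewrite ler_wpM2r ?sqr_ge0.
  (* Here Q' >= 3/4 - Q + (3/4) Q^2, and Q <= (1 + Q^2) / 2. *)
  rewrite e mulrBl; have := sqr_ge0 (Q t - 1); lra.
(* At a rate of at least 1/4 over a time 4 pi, atan Q would gain pi, the length of its open
   range. *)
have p4 : 0 < 4 * pi :> R by rewrite mulr_gt0// pi_gt0.
have TT : T2 <= T2 + 4 * pi by rewrite lerDl ltW.
have : atan (Q T2) - T2 / 4 <= atan (Q (T2 + 4 * pi)) - (T2 + 4 * pi) / 4.
  apply: (nondecr_dv TT (f := fun t => atan (Q t) - t / 4)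
    (df := fun t => (1 + Q t ^+ 2)^-1 * dQ t - 1 / 4)) => t /andP[T2t _].
    by have := dvQ t T2t => ?; dstep; ring.
  move: T2t => /ltW/lower h.
  rewrite subr_ge0 [leRHS]mulrC ler_pdivlMr; last by rewrite ltr_wpDr// sqr_ge0.
  by lra.
have := atan_ltpi2 (Q (T2 + 4 * pi)); have := atan_gtNpi2 (Q T2).
lra.
Qed.
End Trajectory.
End Oscillation.

(** * The sequence of critical points *)

Section OscillationSequence.
Context {R : realType} {p : R} (hp1 : 1 < p) (hp2 : p < 2).
Local Ltac plra := move: (hp1) (hp2) => ? ?; lra.

(** At t, y falls from positive values to 0, and y' = sin x cos x is nonzero off the equilibria,
    hence negative: x t is in the right half of the strip, and y stays negative until its next
    zero. *)
Lemma turning {x y : R -> R} {a t t' : R} : sol p x y -> nontrivial x y ->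
  a < t -> (forall u, a < u -> u < t -> 0 < y u) -> y t = 0 ->
  (forall u, t < u -> u < t' -> y u != 0) -> 0 < x t < pi ->
  pi / 2 < x t /\ forall u, t < u -> u < t' -> y u < 0.
Proof.
move=> hs nt at0 ypos yt nz /andP[x0 xp].
have dy := (hs t).2; rewrite yt Phi0 in dy.
have l0 : sin (x t) * cos (x t) != 0 by apply/eqP => l0; apply: (nt t).
have [d d0 hd] := simple_zero dy yt l0.
have s0 : 0 < sin (x t) by apply: sin_gt0_pi; rewrite x0.
have lneg : sin (x t) * cos (x t) < 0.
  pose h := Num.min d (t - a) / 2.
  have m0 : 0 < Num.min d (t - a) by rewrite lt_min d0 subr_gt0.
  have h0 : 0 < h by rewrite divr_gt0.
  have hm : h < Num.min d (t - a) by rewrite /h; lra.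
  have [hd' hta] : h < d /\ h < t - a by move: hm; rewrite lt_min => /andP.
  have [|g [gy gl]] := hd (t - h).
    by rewrite addrAC subrr add0r normrN gtr0_norm.
  have : 0 < y (t - h) by apply: ypos; lra.
  rewrite gy addrAC subrr add0r mulrN oppr_gt0 pmulr_llt0// => g0.
  by move: gl; rewrite nmulr_rgt0.
have c0 : cos (x t) < 0 by move: lneg; rewrite pmulr_rlt0.
split.
  rewrite ltNge; apply/negP => xt; move: c0; rewrite ltNge cos_ge0_pihalf// xt andbT.
  by apply: le_trans (ltW x0); rewrite oppr_le0 divr_ge0// ltW// pi_gt0.
move=> u tu ut'.
pose m := Num.min u (t + d / 2).
have tm : t < m by rewrite lt_min tu ltrDl divr_gt0.
have mu : m <= u by rewrite ge_min lexx.
have ym : y m < 0.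
  have md : m <= t + d / 2 by rewrite ge_min lexx orbT.
  have [|g [gy gl]] := hd m; first by rewrite gtr0_norm ?subr_gt0//; lra.
  rewrite gy pmulr_llt0 ?subr_gt0//; rewrite nmulr_lgt0// in gl.
have sg : (0 < y m) = (0 < y u).
  apply: (const_sign mu) => w; first by move=> _; exact: (cont_y hs).
  by case/andP => mw wu; apply: nz; [apply: lt_le_trans mw|apply: le_lt_trans ut'].
by rewrite lt_neqAle nz//= leNgt -sg -leNgt ltW.
Qed.

Section Trajectory.
Context {x y : R -> R} (hs : sol p x y) (nt : nontrivial x y).

Lemma strip_any T t : V p (x T) (y T) < 0 -> 0 < x T < pi -> V p (x t) (y t) < 0 -> 0 < x t < pi.
Proof.
move=> VT xT Vt; have [Tt|tT] := leP T t; first exact: (strip_after hp1 hp2 hs nt T).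
rewrite (strip hs (ltW tT))// => u /andP[tu _].
by apply: (sin_neq0 hp1 nt); apply: le_lt_trans Vt; exact: (V_nonincr hp1 hp2 hs nt).
Qed.

(** With y = 0, -V = |sin x|^p. Used mostly in contrapositive form: as long as V >= 0, y cannot
    vanish. *)
Lemma V_crit t : y t = 0 -> V p (x t) (y t) < 0.
Proof.
move=> y0; rewrite (V_zero hp1)// oppr_lt0 powR_gt0// exprn_even_gt0//=.
by apply/eqP => s0; apply: (nt t); rewrite s0 mul0r.
Qed.

(** The sign (-1)^n; critical times of odd index are reduced to even ones by the reflection x -> pi
    - x. *)
Definition par (n : nat) : R := if odd n then -1 else 1.

Lemma parS n : par n.+1 = - par n.
Proof. by rewrite /par /=; case: odd; rewrite /= ?opprK. Qed.

Lemma turning_par {n a t t'} : a < t -> (forall u, a < u -> u < t -> 0 < par n * y u) -> y t = 0 ->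
  (forall u, t < u -> u < t' -> y u != 0) -> 0 < x t < pi ->
  0 < par n * (x t - pi / 2) /\ forall u, t < u -> u < t' -> 0 < par n.+1 * y u.
Proof.
rewrite parS /par; case: (odd n) => at0 pos yt nz xt.
  have nt' : nontrivial (fun t => pi - x t) (fun t => - y t).
    move=> u [/eqP]; rewrite oppr_eq0 => /eqP yu; rewrite [pi - _]addrC sinDpi cosDpi sinN cosN.
    by rewrite mulrNN mulNr => /eqP; rewrite oppr_eq0 => /eqP scu; apply: (nt u).
  have [||||h1 h2] := turning (t' := t') (sol_refl hs) nt' at0.
  - by move=> u au ut; have := pos u au ut; rewrite mulN1r.
  - by rewrite yt oppr0.
  - by move=> u tu ut; rewrite oppr_eq0 nz.
  - by case/andP: xt => *; apply/andP; split; lra.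
  split; first by lra.
  by move=> u tu ut; have := h2 u tu ut; rewrite opprK mul1r oppr_lt0.
have [|h1 h2] := turning (t' := t') hs nt at0 _ yt nz xt.
  by move=> u au ut; have := pos u au ut; rewrite mul1r.
split; first by lra.
by move=> u tu ut; have := h2 u tu ut; rewrite mulN1r oppr_gt0.
Qed.

(** Positivity of y up to a gives the sequence of zeros a first element; signs then alternate by
    [turning_par], and each zero lies in the strip because V < 0 there. *)
Lemma oscillation_times T a : V p (x T) (y T) < 0 -> 0 < x T < pi ->
  (forall t, t <= a -> 0 < y t) ->
  exists s : nat -> R,
    [/\ forall n, s n < s n.+1, forall T, exists n, T < s n,
        (forall t, t < s 0%N -> 0 < y t),
        (forall n, [/\ y (s n) = 0, 0 < x (s n) < pi, 0 < par n * (x (s n) - pi / 2),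
            (exists2 b, b < s n & forall u, b < u -> u < s n -> 0 < par n * y u)
            & forall u, s n < u -> u < s n.+1 -> 0 < par n.+1 * y u])
      & forall t, y t = 0 -> exists n, t = s n].
Proof.
move=> VT xT ya.
have [s [as0 sS unb [n0 nS] [s0 sall]]] := zero_sequence (cont_y hs) (y_simple hs nt) a
  (fun t ta => lt0r_neq0 (ya t ta)) (y_zero_after hp1 hp2 hs nt T VT xT).
have ypos t : t < s 0%N -> 0 < y t.
  move=> ts; have [ta|at0] := leP t a; first exact: ya.
  rewrite -(const_sign (ltW at0) (f := y)) ?ya// => u; first by move=> _; exact: (cont_y hs).
  by case/andP => _ ut; apply: n0; apply: le_lt_trans ts.
have xs n : 0 < x (s n) < pi by apply: (strip_any T) => //; exact: V_crit.
exists s; split=> //.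
have inv n : exists2 b, b < s n & forall u, b < u -> u < s n -> 0 < par n * y u.
  elim: n => [|n [b bs hb]].
    by exists (s 0%N - 1) => [|u _ /ypos]; rewrite ?mul1r// ltrBlDr ltrDl.
  have [_ h] := turning_par bs hb (s0 n) (nS n) (xs n).
  by exists (s n).
move=> n; have [b bs hb] := inv n.
have [h1 h2] := turning_par bs hb (s0 n) (nS n) (xs n).
by split=> //; exists b.
Qed.

(** At a critical time -V = (sin^2 x)^(p/2), and sin x = cos |x - pi/2|; so the strict decrease of
    [V] is that of the distance to pi/2. *)
Lemma amplitude_decr t t' : t < t' -> y t = 0 -> y t' = 0 -> 0 < x t < pi -> 0 < x t' < pi ->
  `|x t' - pi / 2| < `|x t - pi / 2|.
Proof.
move=> tt yt yt' xt xt'.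
have := V_decr hp1 hp2 hs nt t t' tt; rewrite !(V_zero hp1)// ltrN2 => h.
have s0 := sin_gt0_pi xt; have s0' := sin_gt0_pi xt'.
have lt : sin (x t) < sin (x t').
  rewrite ltNge; apply/negP => le; move: h; rewrite ltNge => /negP; apply.
  apply: ge0_ler_powR; rewrite ?nnegrE ?sqr_ge0//; first by plra.
  by rewrite ler_sqr ?nnegrE// ltW.
have se (u : R) : sin u = cos `|u - pi / 2|.
  by rewrite -[u in LHS](subrK (pi / 2)) sinDpihalf; case: (ger0P (u - pi / 2)) => // _; rewrite cosN.
rewrite !se ltr_cos in lt => //.
- by rewrite in_itv/= normr_ge0/= ler_norml; case/andP: xt => *; have := pi_gt0 R => ?; apply/andP; split; lra.
- by rewrite in_itv/= normr_ge0/= ler_norml; case/andP: xt' => *; have := pi_gt0 R => ?; apply/andP; split; lra.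
Qed.

Context {f : R -> R} (fE : forall r, 0 < r -> f r = x (ln r)).

Lemma oscillates_of_sol T a : V p (x T) (y T) < 0 -> 0 < x T < pi ->
  (forall t, t <= a -> 0 < y t) ->
  exists s : nat -> R,
    [/\ increasing_on `]0, s 0%N]%classic f,
        oscillates f (pi / 2) (max_above f (pi / 2)) (min_below f (pi / 2)) s
      & all_critical f s].
Proof.
move=> VT xT ya; have [s [sS unb ypos hsn sall]] := oscillation_times T a VT xT ya.
have smono n m : (n <= m)%N -> s n <= s m.
  elim: m => [|m ih]; first by rewrite leqn0 => /eqP->.
  by rewrite leq_eqVlt => /orP[/eqP->//|/ih h]; apply: le_trans h (ltW (sS m)).
have fs n : f (expR (s n)) = x (s n) by rewrite fE ?expR_gt0// expRK.
have df r : 0 < r -> derive1 f r = y (ln r) / r by exact: (derive_global hs fE).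
have around (n : nat) : exists2 b, b < s n &
    forall u, b < u -> u < s n.+1 -> 0 <= par n * (x (s n) - x u).
  have [ys _ _ [b bs hb] hb'] := hsn n; exists b => // u bu us.
  have dpx w : dv (fun w => par n * x w) w (par n * y w).
    by have := (hs w).1 => ?; dstep; ring.
  rewrite mulrBr subr_ge0; have [us'|su] := leP u (s n).
    apply: (nondecr_dv us' (f := fun w => par n * x w)) => [w _|w /andP[uw ws]]; first exact: dpx.
    by rewrite ltW// hb// (lt_trans bu).
  apply: (nonincr_dv (ltW su) (f := fun w => par n * x w)) => [w _|w /andP[sw wu]]; first exact: dpx.
  have := hb' w sw (lt_trans wu us).
  by rewrite parS mulNr oppr_gt0 => /ltW.
have nearE (n : nat) (P : R -> Prop) (b : R) : b < s n ->
    (forall u, b < u -> u < s n.+1 -> P u) -> \forall r \near expR (s n), 0 < r /\ P (ln r).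
  move=> bs hP; near=> r.
  have r0 : 0 < r by near: r; apply: lt_nbhsr; exact: expR_gt0.
  split=> //; apply: hP.
    rewrite -ltr_expR lnK ?posrE//; near: r; apply: lt_nbhsr; by rewrite ltr_expR.
  rewrite -ltr_expR lnK ?posrE//; near: r; apply: lt_nbhsl; by rewrite ltr_expR.
exists (fun n => expR (s n)); split.
- move=> r r' /=; rewrite !in_itv/= => /andP[r0 rs] /andP[r'0 rs'] rr'.
  rewrite !fE//; have ll : ln r < ln r' by rewrite ltr_ln ?posrE.
  apply: (incr_dv ll (f := x) (df := y)) => [w _|w /andP[_ wl]]; first exact: (hs w).1.
  by apply: ypos; apply: lt_le_trans wl _; rewrite -ler_expR lnK ?posrE.
- split.
  + by move=> n; rewrite expR_gt0 ltr_expR sS.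
  + apply/cvgryPge => A; have [n hn] := unb A.
    exists n => // m /= nm; apply: le_trans (ltW hn) _; apply: le_trans (smono _ _ nm) _.
    by apply: le_trans (expR_ge1Dx _); rewrite lerDr.
  + by move=> n; rewrite df ?expR_gt0// expRK; case: (hsn n) => ->; rewrite mul0r.
  + move=> n; split.
      have [_ xs px _ _] := hsn n.*2; have [b bs hb] := around n.*2.
      split; last first.
        by move: px xs; rewrite fs /par odd_double mul1r => ? /andP[? ?]; apply/andP; split; lra.
      apply: filterS (nearE _ _ _ bs hb) => r [r0]; rewrite fs fE//.
      by rewrite /par odd_double mul1r subr_ge0.
    have [_ xs px _ _] := hsn n.*2.+1; have [b bs hb] := around n.*2.+1.
    split; last first.
      by move: px xs; rewrite fs parS /par odd_double mulN1r => ? /andP[? ?]; apply/andP; split; lra.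
    apply: filterS (nearE _ _ _ bs hb) => r [r0]; rewrite fs fE//.
    by rewrite parS /par odd_double mulN1r opprB subr_ge0.
  + have dec n : `|f (expR (s n.+1)) - pi / 2| < `|f (expR (s n)) - pi / 2|.
      rewrite !fs; have [y1 x1 _ _ _] := hsn n; have [y2 x2 _ _ _] := hsn n.+1.
      exact: amplitude_decr.
    (* The decrease holds from index 0 on; 1 is given because [n0] must be positive. *)
    split; first by exists 1%N => // n _; exact: dec.
    by elim=> [//|n ih]; apply: le_trans ih; exact: ltW.
- move=> r r0; rewrite df// => /eqP; rewrite mulf_eq0 invr_eq0 (gt_eqF r0) orbF => /eqP.
  by move=> /sall[n e]; exists n; rewrite -e lnK.
Unshelve. all: by end_near. Qed.

End Trajectory.
End OscillationSequence.

(** * The special solution *)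

Section RealLemmas.
Context {R : realType}.

Lemma first_hit_in {f : R -> R} {a b v : R} : a <= b ->
  (forall t, a <= t -> t <= b -> {for t, continuous f}) ->
  f a < v -> v <= f b -> exists c, [/\ a < c, c <= b, f c = v & forall t, a <= t -> t < c -> f t < v].
Proof.
move=> ab cf fa fb; pose S := [set t | a <= t /\ v <= f t].
have hS : has_inf S by split; [exists b|exists a => t []].
pose c := inf S.
have lb t : S t -> c <= t by move=> St; apply: ge_inf => //; case: hS.
have ac : a <= c by apply: lb_le_inf; [exists b|move=> t []].
have below t : a <= t -> t < c -> f t < v.
  by move=> at0 tc; rewrite ltNge; apply/negP => vt; have := lb t (conj at0 vt); rewrite leNgt tc.
have cb : c <= b by apply: lb.
have vc : v <= f c.
  rewrite leNgt; apply/negP => fcv.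
  have [d d0 hd] := near_pball (near_lt v (cf c ac cb) fcv).
  have [t St] := inf_adherent d0 hS; rewrite -/c => td; have := lb t St => ct.
  have : f t < v by apply: hd; rewrite ger0_norm ?subr_ge0// ltrBlDl.
  by case: St => _; rewrite leNgt => /negP.
have ac' : a < c.
  by rewrite lt_neqAle ac andbT; apply/eqP => e; move: vc; rewrite -e leNgt fa.
exists c; split=> //.
apply/eqP; rewrite eq_le vc andbT leNgt; apply/negP => vfc.
have [d d0 hd] := near_pball (near_gt v (cf c ac cb) vfc).
pose t := c - Num.min d (c - a) / 2.
have m0 : 0 < Num.min d (c - a) by rewrite lt_min d0 subr_gt0.
have md : Num.min d (c - a) <= d by rewrite ge_min lexx.
have mc : Num.min d (c - a) <= c - a by rewrite ge_min lexx orbT.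
have tc : t < c by rewrite /t; lra.
have at0 : a <= t by rewrite /t; lra.
have := below t at0 tc; rewrite ltNge => /negP; apply; apply/ltW/hd.
by rewrite ltr0_norm ?subr_lt0// /t; lra.
Qed.

Lemma first_hit {f : R -> R} {a b v : R} : a <= b -> (forall t, {for t, continuous f}) ->
  f a < v -> v <= f b -> exists c, [/\ a < c, c <= b, f c = v & forall t, a <= t -> t < c -> f t < v].
Proof. by move=> ab cf; apply: first_hit_in. Qed.

(** The inequality is available only where u > 0. If u t > 0, the last zero s of u before t is a
    first hit in reversed time, and Gronwall's argument on [s, t] starts from the value 0. *)
Lemma barrier {u du : R -> R} {a b M : R} : (forall t, dv u t (du t)) ->
  (forall t, a <= t -> t <= b -> 0 < u t -> du t <= M * u t) -> u a <= 0 ->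
  forall t, a <= t -> t <= b -> u t <= 0.
Proof.
move=> hu h ua t at0 tb; rewrite leNgt; apply/negP => ut.
have cu s : {for s, continuous u} by exact: dv_cont (hu s).
have cur s : {for s, continuous (fun s => - u (- s))}.
  have d1 : dv (fun s : R => - s) s (-1) by dstep; ring.
  by apply: cvgN; apply: (continuous_comp (f := fun s : R => - s)); [exact: dv_cont d1|exact: cu].
have tam : - t <= - a by rewrite lerN2.
have [||c [tc ca uc hc]] := first_hit (f := fun s => - u (- s)) (v := 0) tam cur.
- by rewrite opprK oppr_lt0.
- by rewrite opprK oppr_ge0.
pose s := - c; have st : s < t by rewrite /s ltrNl.
have as0 : a <= s by rewrite /s lerNr.
have us : u s = 0 by apply/eqP; rewrite -oppr_eq0 /s uc.
have pos w : s < w -> w <= t -> 0 < u w.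
  move=> sw wt; have := hc (- w); rewrite opprK oppr_lt0; apply; first by rewrite lerN2.
  by rewrite ltrNl.
have : u t * expR (- M * t) <= u s * expR (- M * s).
  apply: (nonincr_dv (ltW st) (f := fun t => u t * expR (- M * t))
      (df := fun t => (du t - M * u t) * expR (- M * t))) => w.
    by move=> _; have := hu w => ?; dstep; ring.
  case/andP => sw wt; rewrite pmulr_lle0 ?expR_gt0// subr_le0; apply: h.
  - by rewrite (le_trans as0)// ltW.
  - by rewrite (le_trans (ltW wt)).
  - by apply: pos => //; exact: ltW.
by rewrite us mul0r leNgt pmulr_lgt0 ?expR_gt0// ut.
Qed.

(** The cluster point is the limit superior, the supremum of the levels reached at arbitrarily large
    indices. *)
Lemma cluster_point (b : nat -> R) (m M : R) : (forall n, m <= b n <= M) ->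
  exists l, forall e N, 0 < e -> exists2 n, (N <= n)%N & `|b n - l| < e.
Proof.
move=> hb; pose S := [set c | forall N, exists2 n, (N <= n)%N & c <= b n].
have hS : has_sup S.
  split; first by exists m => N; exists N => //; case/andP: (hb N).
  by exists M => c /(_ 0%N)[n _ cn]; apply: le_trans cn _; case/andP: (hb n).
exists (sup S) => e N e0.
have [N' hN'] : exists N', forall n, (N' <= n)%N -> b n < sup S + e.
  apply: contrapT => /forallNP hN.
  suff : sup S + e <= sup S by rewrite gerDl leNgt e0.
  apply: ub_le_sup; [by case: hS|move=> K].
  have /existsNP[n /not_implyP[Kn /negP]] := hN K.
  by rewrite -leNgt => ?; exists n.
have [c cS ce] := sup_adherent e0 hS.
have [n Nn cn] := cS (maxn N N').
move: Nn; rewrite geq_max => /andP[Nn N'n]; exists n => //.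
by have := hN' n N'n; rewrite ltr_norml => ?; apply/andP; split; lra.
Qed.

Lemma sin_le_id (u : R) : 0 <= u -> sin u <= u.
Proof.
move=> u0; rewrite -subr_ge0.
have : 0 - sin 0 <= u - sin u :> R.
  apply: (nondecr_dv u0 (f := fun u => u - sin u) (df := fun u => 1 - cos u)) => [w _|w _].
    by dstep; ring.
  by rewrite subr_ge0; apply: le_trans (ler_norm _) (norm_cos_le1 _).
by rewrite sin0 subrr.
Qed.

End RealLemmas.

(** * The invariant wedge and the compactness argument *)

Section Special.
Context {R : realType} {p : R} (hp1 : 1 < p) (hp2 : p < 2).
Local Ltac plra := move: (hp1) (hp2) => ? ?; lra.
Let pi_pos : 0 < pi :> R := pi_gt0 R.

(** On the edge y = sin x the right-hand side is the derivative of sin x along the flow, so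
    trajectories do not cross this edge upwards. Once the denominator is cleared the gap is 2 (2 -
    p) (1 - cos x) sin^3 x. *)
Lemma Phi_upper (x : R) : 0 < sin x -> Phi p x (sin x) <= cos x * sin x.
Proof.
move=> s0; rewrite /Phi; set s := sin x; set c := cos x.
have D0 : 0 < (p - 1) * s ^+ 2 + s ^+ 2.
  by rewrite -[X in _ + X]mul1r -mulrDl mulr_gt0 ?exprn_gt0//; plra.
rewrite ler_pdivrMr// -subr_ge0.
rewrite (_ : _ - _ = 2 * (2 - p) * (1 - c) * s ^+ 3); last by ring.
have c1 : c <= 1 by apply: le_trans (ler_norm _) (norm_cos_le1 _).
by rewrite mulr_ge0 ?exprn_ge0 ?(ltW s0)// mulr_ge0 ?subr_ge0// mulr_ge0//; plra.
Qed.

(** The counterpart on the edge y = sin x cos x, where the left-hand side is the derivative of sin x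
    cos x along the flow. *)
Lemma Phi_lower (x : R) : 0 < sin x -> 0 <= cos x ->
  (cos x ^+ 2 - sin x ^+ 2) * (sin x * cos x) <= Phi p x (sin x * cos x).
Proof.
move=> s0 c0; rewrite /Phi.
have D0 : 0 < (p - 1) * (sin x * cos x) ^+ 2 + sin x ^+ 2.
  by apply: ltr_wpDl; [nneg; plra|rewrite exprn_gt0].
rewrite ler_pdivlMr// -subr_ge0; set s := sin x; set c := cos x.
rewrite (_ : _ - _ = s ^+ 3 * c * ((p - 1) + c ^+ 2 - (c ^+ 2 - s ^+ 2) * ((p - 1) * c ^+ 2 + 1))); last by ring.
have -> : (p - 1) + c ^+ 2 - (c ^+ 2 - s ^+ 2) * ((p - 1) * c ^+ 2 + 1) =
    (1 - c ^+ 2) * ((p - 1) * (1 + 2 * c ^+ 2) + 1).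
  by rewrite /s sin2cos2 -/c; ring.
rewrite /c -sin2cos2; apply: mulr_ge0; first by apply: mulr_ge0 => //; rewrite exprn_ge0// ltW.
by nneg; plra.
Qed.

(** [lipC p] pays for the displacement of y off the edge, 1 for the factors cos x and cos^2 x -
    sin^2 x. *)
Let M0 : R := lipC p + 1.

Let lc0 : 0 < lipC p.
Proof. exact: lt_le_trans (lipC_ge1 hp1 hp2). Qed.

Section Wedge.
Context {x y : R -> R} (hs : sol p x y) {a b : R} (ab : a <= b).
Hypothesis quad : forall t, a <= t -> t <= b -> 0 < x t <= pi / 2.

Let sc t : a <= t -> t <= b -> 0 < sin (x t) /\ 0 <= cos (x t).
Proof.
move=> at0 tb; have /andP[x0 xp] := quad t at0 tb; split.
  by apply: sin_gt0_pi; rewrite x0/= (le_lt_trans xp)//; have := pi_pos; lra.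
apply: cos_ge0_pihalf; rewrite xp andbT; apply: le_trans (ltW x0).
by rewrite oppr_le0 divr_ge0// ltW.
Qed.

Lemma wedge_upper : y a <= sin (x a) -> forall t, a <= t -> t <= b -> y t <= sin (x t).
Proof.
move=> ya t at0 tb; rewrite -subr_le0.
apply: (barrier (u := fun t => y t - sin (x t))
  (du := fun t => Phi p (x t) (y t) - cos (x t) * y t) (M := M0)) at0 tb.
- by move=> w; have [? ?] := hs w; dtac.
- move=> w aw wb uw; have [s0 _] := sc w aw wb.
  have h1 := Phi_upper _ s0; have h2 := Phi_lip hp1 hp2 (x w) (y w) (x w) (sin (x w)).
  rewrite subrr normr0 add0r (gtr0_norm uw) in h2.
  have h3 := le_trans (ler_norm _) h2.
  have c1 := norm_cos_le1 (x w).
  have h4 : - cos (x w) * (y w - sin (x w)) <= 1 * (y w - sin (x w)).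
    by rewrite ler_wpM2r ?(ltW uw)//; apply: le_trans c1; rewrite -normrN ler_norm.
  by rewrite /M0; lra.
- by rewrite subr_le0.
Qed.

Lemma wedge_lower : sin (x a) * cos (x a) <= y a ->
  forall t, a <= t -> t <= b -> sin (x t) * cos (x t) <= y t.
Proof.
move=> ya t at0 tb; rewrite -subr_le0.
apply: (barrier (u := fun t => sin (x t) * cos (x t) - y t)
  (du := fun t => (cos (x t) ^+ 2 - sin (x t) ^+ 2) * y t - Phi p (x t) (y t)) (M := M0)) at0 tb.
- by move=> w; have [? ?] := hs w; dstep; ring.
- move=> w aw wb uw; have [s0 c0] := sc w aw wb.
  have h1 := Phi_lower _ s0 c0.
  have h2 := Phi_lip hp1 hp2 (x w) (sin (x w) * cos (x w)) (x w) (y w).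
  rewrite subrr normr0 add0r (gtr0_norm uw) in h2.
  have h3 := le_trans (ler_norm _) h2.
  have h4 : - (cos (x w) ^+ 2 - sin (x w) ^+ 2) * (sin (x w) * cos (x w) - y w)
      <= 1 * (sin (x w) * cos (x w) - y w).
    rewrite ler_wpM2r ?(ltW uw)// -(cos2Dsin2 (x w)).
    by have := sqr_ge0 (cos (x w)); have := sqr_ge0 (sin (x w)); lra.
  by rewrite /M0; lra.
- by rewrite subr_le0.
Qed.
End Wedge.

Definition wedge (x y : R -> R) (t : R) : Prop :=
  [/\ 0 <= x t, x t <= pi / 4, sin (x t) * cos (x t) <= y t & y t <= sin (x t)].

(** Start on the upper edge at x = (pi/4) exp(-n) and stop when x reaches pi/4. As y <= sin x <= x,
    x grows at most like exp(t), so this takes a time at least n; the clock is then shifted to end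
    at 0. *)
Lemma approximate_solution (n : nat) : exists x y : R -> R,
  [/\ sol p x y, x 0 = pi / 4 & forall t, - n%:R <= t -> t <= 0 -> wedge x y t].
Proof.
pose e : R := pi / 4 * expR (- n%:R).
have e0 : 0 < e by rewrite mulr_gt0 ?expR_gt0// divr_gt0.
have e4 : e <= pi / 4.
  by rewrite /e ler_piMr ?expR_le1 ?oppr_le0 ?ler0n// ltW// divr_gt0.
have [x [y [hs x0 y0]]] := sol_exists hp1 hp2 e (sin e).
have se : 0 < sin e by apply: sin_gt0_pi; rewrite e0/=; have := pi_pos; lra.
have nt : nontrivial x y.
  by apply: (nontrivial1 hp1 hp2 0 hs) => -[]; rewrite y0 => s0; move: se; rewrite s0 ltxx.
have V0 : V p (x 0) (y 0) < 0.
  rewrite V_lt0 ?(N_gt0 nt)// x0 y0 -[X in _ < X]mul1r ltr_pM2r ?exprn_gt0//; plra.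
have x0p : 0 < x 0 < pi by rewrite x0 e0/=; have := pi_pos; lra.
have [tx _] := converge hp1 hp2 hs nt 0 V0 x0p.
have p4 : 0 < pi / 4 :> R by rewrite divr_gt0.
have [S hS] := tx _ p4.
have pos t : 0 <= t -> 0 < x t by move=> t0; have /andP[] := strip_after hp1 hp2 hs nt 0 t V0 x0p t0.
have [T [T0 xT hT]] : exists T, [/\ 0 <= T, x T = pi / 4 & forall t, 0 <= t -> t < T -> x t < pi / 4].
  (* For n = 0 the start is already at pi/4, whereas [first_hit] asks for a strict inequality. *)
  have [e4'|e4'] := eqVneq e (pi / 4).
    by exists 0; split; rewrite ?x0// => t t0 /lt_geF; rewrite t0.
  have [|||c [c0 _ xc hc]] := first_hit (f := x) (a := 0) (b := Num.max 0 S) (v := pi / 4) _ (cont_x hs).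
  - by rewrite le_max lexx.
  - by rewrite x0 lt_neqAle e4' e4.
  - have := hS (Num.max 0 S); rewrite le_max lexx orbT => /(_ isT).
    by rewrite ltr_norml => /andP[? _]; have := pi_pos; lra.
  - by exists c; split=> //; exact: ltW.
have hT' t : 0 <= t -> t <= T -> x t <= pi / 4.
  by move=> t0; rewrite le_eqVlt => /orP[/eqP->|/(hT t t0)/ltW//]; rewrite xT.
have quad t : 0 <= t -> t <= T -> 0 < x t <= pi / 2.
  by move=> t0 tT; rewrite pos//=; have := hT' t t0 tT; have := pi_pos; lra.
have ylo := wedge_lower hs quad; have yup := wedge_upper hs quad.
have {}ylo t : 0 <= t -> t <= T -> sin (x t) * cos (x t) <= y t.
  apply: ylo; rewrite x0 y0 ler_piMr ?(ltW se)//.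
have {}yup t : 0 <= t -> t <= T -> y t <= sin (x t).
  by apply: yup; rewrite x0 y0.
have nT : n%:R <= T.
  have : x T * expR (- T) <= x 0 * expR (- 0).
    apply: (nonincr_dv T0 (f := fun t => x t * expR (- t)) (df := fun t => (y t - x t) * expR (- t))).
      by move=> w _; have [? ?] := hs w; dstep; ring.
    move=> w /andP[/ltW w0 /ltW wT]; rewrite pmulr_lle0 ?expR_gt0// subr_le0.
    apply: le_trans (yup w w0 wT) _; apply: sin_le_id; exact/ltW/pos.
  rewrite xT x0 oppr0 expR0 mulr1 /e ler_pM2l// ler_expR lerN2//.
exists (fun t => x (t + T)), (fun t => y (t + T)); split.
- exact: sol_shift hs.
- by rewrite add0r.
- move=> t nt0 t0; have t1 : 0 <= t + T by lra.
  have t2 : t + T <= T by lra.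
  by split; [exact/ltW/pos|exact: hT'|exact: ylo|exact: yup].
Qed.

(** A cluster value l of the slopes y n 0 gives the initial condition (pi/4, l). At each fixed t <=
    0 Gronwall's inequality makes the solution a limit of approximate ones, and the wedge is closed.
    Finally X t = 0 would force Y t = 0, an equilibrium. *)
Lemma special_solution : exists x y : R -> R,
  [/\ sol p x y, x 0 = pi / 4 & forall t, t <= 0 -> 0 < x t /\ wedge x y t].
Proof.
have /choice[x /choice[y hxy]] := approximate_solution.
have bb n : 0 <= y n 0 <= 1.
  have [hs x0 hw] := hxy n; have [|w1 w2 w3 w4] := hw 0 _ (lexx 0); first by rewrite oppr_le0 ler0n.
  rewrite (le_trans w4) ?andbT; last by apply: le_trans (ler_norm _) (sin_max _).
  apply: le_trans w3; rewrite x0 mulr_ge0//.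
    by apply: sin_ge0_pi; have := pi_pos; move=> *; apply/andP; split; lra.
  by apply: cos_ge0_pihalf; have := pi_pos; move=> *; apply/andP; split; lra.
have [l hl] := cluster_point _ _ _ bb.
have [X [Y [hS X0 Y0]]] := sol_exists hp1 hp2 (pi / 4) l.
have close t e : t <= 0 -> 0 < e ->
    exists2 n, wedge (x n) (y n) t & `|X t - x n t| <= e /\ `|Y t - y n t| <= e.
  move=> t0 e0; pose E := expR (4 * lipC p * `|t - 0|).
  have E0 : 0 < E by exact: expR_gt0.
  have E1 : 1 <= E by rewrite /E -expR0 ler_expR; nneg; exact: ltW.
  have [n Nn hn] := hl (e / E) (Num.bound `|t|) (divr_gt0 e0 E0).
  have [hs x0 hw] := hxy n; exists n.
    apply: hw => //; rewrite lerNl; apply: (le_trans (y := `|t|)); first by rewrite -normrN ler_norm.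
    apply: le_trans (ltW (archi_boundP (normr_ge0 t))) _; by rewrite ler_nat.
  have h := sol_gronwall hp1 hp2 hS hs 0 t.
  rewrite X0 x0 Y0 subrr expr0n add0r -/E in h.
  have h2 : (l - y n 0) ^+ 2 * E <= e ^+ 2.
    rewrite -real_normK ?num_real// distrC.
    apply: le_trans (_ : (e / E) ^+ 2 * E ^+ 2 <= _); last first.
      by rewrite expr_div_n divfK// sqrf_eq0 gt_eqF.
    apply: ler_pM; rewrite ?sqr_ge0 ?(ltW E0)//.
      by rewrite ler_sqr ?nnegrE ?(ltW hn)// divr_ge0// ltW.
    by rewrite expr2 ler_peMl// ltW.
  have {}h := le_trans h h2.
  split; rewrite -ler_sqr ?nnegrE ?(ltW e0)// real_normK ?num_real//; apply: le_trans h.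
    by rewrite lerDl sqr_ge0.
  by rewrite lerDr sqr_ge0.
(* Each condition of the wedge reads F >= 0 with F Lipschitz of constant 3. If F < 0 in the limit,
   an approximate solution within -F / 12 in both coordinates changes F by at most half of |F| and
   still violates the condition. *)
have lim t (F : R -> R -> R) : t <= 0 ->
    (forall x y x' y', `|F x y - F x' y'| <= 3 * (`|x - x'| + `|y - y'|)) ->
    (forall n, wedge (x n) (y n) t -> 0 <= F (x n t) (y n t)) -> 0 <= F (X t) (Y t).
  move=> t0 lipF hF; rewrite leNgt; apply/negP => Fn.
  have e0 : 0 < - F (X t) (Y t) / 12 by rewrite divr_gt0 ?oppr_gt0.
  have [n /hF hn [h1 h2]] := close t _ t0 e0.
  have := lipF (X t) (Y t) (x n t) (y n t); rewrite ler_norml => /andP[h3 _].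
  by lra.
have W t : t <= 0 -> wedge X Y t.
  move=> t0; have sl := @sin_lip R; have cl := @cos_lip R.
  split.
  - apply: (lim t (fun x y => x)) => // [u v u' v'|n []//].
    by have := normr_ge0 (u - u'); have := normr_ge0 (v - v'); lra.
  - rewrite -subr_ge0; apply: (lim t (fun x y => pi / 4 - x)) => // [u v u' v'|n []]; last by rewrite subr_ge0.
    rewrite (_ : _ - _ = - (u - u')) ?normrN; last by ring.
    by have := normr_ge0 (u - u'); have := normr_ge0 (v - v'); lra.
  - rewrite -subr_ge0; apply: (lim t (fun x y => y - sin x * cos x)) => // [u v u' v'|n []]; last by rewrite subr_ge0.
    rewrite (_ : _ - _ = (v - v') + (- ((sin u - sin u') * cos u) - sin u' * (cos u - cos u'))); last by ring.
    apply: le_trans (ler_normD _ _) _; apply: le_trans (lerD (lexx _) (ler_normB _ _)) _.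
    rewrite normrN !normrM.
    have h1 : `|sin u - sin u'| * `|cos u| <= `|u - u'|.
      by apply: le_trans (sl u u'); rewrite ler_piMr// norm_cos_le1.
    have h2 : `|sin u'| * `|cos u - cos u'| <= `|u - u'|.
      by apply: le_trans (cl u u'); rewrite ler_piMl// sin_max.
    by have := normr_ge0 (u - u'); have := normr_ge0 (v - v'); lra.
  - rewrite -subr_ge0; apply: (lim t (fun x y => sin x - y)) => // [u v u' v'|n []]; last by rewrite subr_ge0.
    rewrite (_ : _ - _ = (sin u - sin u') - (v - v')); last by ring.
    apply: le_trans (ler_normB _ _) _.
    by have := sl u u'; have := normr_ge0 (u - u'); have := normr_ge0 (v - v'); lra.
exists X, Y; split=> // t t0; split; last exact: W.
have [w1 w2 w3 w4] := W t t0; rewrite lt_neqAle w1 andbT; apply/eqP => xt.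
have Yt : Y t = 0 by apply/eqP; rewrite eq_le; move: w3 w4; rewrite -xt sin0 mul0r => -> ->.
have sc0 : sin (X t) * cos (X t) = 0 by rewrite -xt sin0 mul0r.
have [h _] := sol_eq hp1 hp2 t hS Yt sc0 0.
by move: h; rewrite X0 -xt; have := pi_pos; lra.
Qed.

End Special.

(** * Rates, strip and inverse branch of the special solution *)

Section SpecialSolution.
Context {R : realType} {p : R} (hp1 : 1 < p) (hp2 : p < 2).
Local Ltac plra := move: (hp1) (hp2) => ? ?; lra.
Let pi_pos : 0 < pi :> R := pi_gt0 R.

(** In this region -V is a product of two positive decreasing functions of y; hence at fixed x the
    value of [V] determines y. *)
Lemma W_decr (x y1 y2 : R) : 0 <= y1 -> y1 < y2 -> (p - 1) * y2 ^+ 2 < sin x ^+ 2 ->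
  V p x y1 < V p x y2.
Proof.
move=> y10 y12 h; rewrite -ltrN2 /V -[X in X < _]mulNr -[X in _ < X]mulNr !opprB.
have sq : y1 ^+ 2 < y2 ^+ 2 by rewrite ltr_sqr ?nnegrE// (le_trans y10)// ltW.
have k0 : 0 < p - 1 by plra.
have s0 : 0 < sin x ^+ 2 by apply: le_lt_trans h; nneg.
have N1 : 0 < y1 ^+ 2 + sin x ^+ 2 by rewrite ltr_wpDl ?sqr_ge0.
have N2 : 0 < y2 ^+ 2 + sin x ^+ 2 by rewrite ltr_wpDl ?sqr_ge0.
apply: ltr_pM; [by lra|exact: powR_ge0| |].
  by rewrite ltrD2l ltrN2 ltr_pM2l.
rewrite -[p / 2 - 1]opprK !(powRN _ (- (p / 2 - 1))) ltf_pV2 ?posrE ?powR_gt0//.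
by apply: gt0_ltr_powR; rewrite ?nnegrE ?(ltW N1) ?(ltW N2)//; [plra|rewrite ltrD2r].
Qed.

(** Up to the factor p, this is the derivative in y of the convex function (y^2 + sin^2 x)^(p/2). *)
Lemma Gy_incr (x y1 y2 : R) : 0 < sin x ^+ 2 -> 0 <= y1 -> y1 < y2 ->
  y1 * (y1 ^+ 2 + sin x ^+ 2) `^ (p / 2 - 1) < y2 * (y2 ^+ 2 + sin x ^+ 2) `^ (p / 2 - 1).
Proof.
move=> s0 y10 y12.
have N0 y : 0 < y ^+ 2 + sin x ^+ 2 by rewrite ltr_wpDl ?sqr_ge0.
apply: (incr_dv y12 (f := fun y => y * (y ^+ 2 + sin x ^+ 2) `^ (p / 2 - 1))
  (df := fun y => (y ^+ 2 + sin x ^+ 2) `^ (p / 2 - 1 - 1) * ((p - 1) * y ^+ 2 + sin x ^+ 2))).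
  move=> y _; have ? := N0 y; dstep.
  have -> : (y ^+ 2 + sin x ^+ 2) `^ (p / 2 - 1 - 1) =
      (y ^+ 2 + sin x ^+ 2) `^ (p / 2 - 1) / (y ^+ 2 + sin x ^+ 2).
    by rewrite (@powRB _ _ (p / 2 - 1)) ?powRr1 ?(ltW (N0 _))// lt0r_neq0// implybT.
  set Q := _ `^ _; rewrite /=.
  by field; rewrite lt0r_neq0.
move=> y _; rewrite mulr_gt0 ?powR_gt0 ?N0// ltr_wpDl//; nneg; plra.
Qed.

Lemma sin_pi4 : sin (pi / 4) = cos (pi / 4) :> R.
Proof.
rewrite -(sinDpihalf (pi / 4)) (_ : pi / 4 + pi / 2 = - (pi / 4) + pi); last by lra.
by rewrite sinDpi sinN opprK.
Qed.

Definition special (X Y : R -> R) : Prop :=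
  [/\ sol p X Y, X 0 = pi / 4 & forall t, t <= 0 -> 0 < X t /\ wedge X Y t].

Section Properties.
Context {X Y : R -> R} (hX : special X Y).

Lemma sp_sol : sol p X Y. Proof. by case: hX. Qed.

Lemma sp_quad t : t <= 0 -> [/\ 0 < sin (X t), 0 < cos (X t) & 0 < X t <= pi / 4].
Proof.
case: hX => _ _ /[apply] -[x0 [_ x4 _ _]]; have pp := pi_pos; split; last by rewrite x0.
  by apply: sin_gt0_pi; rewrite x0/=; lra.
by apply: cos_gt0_pihalf; apply/andP; split; lra.
Qed.

Lemma sp_wedge t : t <= 0 -> sin (X t) * cos (X t) <= Y t <= sin (X t).
Proof. by case: hX => _ _ /[apply] -[_ [_ _ -> ->]]. Qed.

Lemma sp_Ypos t : t <= 0 -> 0 < Y t.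
Proof.
move=> t0; have [s0 c0 _] := sp_quad t t0; have /andP[h _] := sp_wedge t t0.
by apply: lt_le_trans h; exact: mulr_gt0.
Qed.

Lemma sp_nt : nontrivial X Y.
Proof.
apply: (nontrivial1 hp1 hp2 0 sp_sol) => -[Y0 _].
by have := sp_Ypos 0 (lexx 0); rewrite Y0 ltxx.
Qed.

(** For t <= 0 the wedge gives Y <= sin X, and p - 1 < 1; later [V] can only decrease. *)
Lemma sp_V t : V p (X t) (Y t) < 0.
Proof.
have neg u : u <= 0 -> V p (X u) (Y u) < 0.
  move=> u0; have [s0 c0 _] := sp_quad u u0; have /andP[_ h] := sp_wedge u u0.
  rewrite V_lt0 ?(N_gt0 sp_nt)//.
  have : Y u ^+ 2 <= sin (X u) ^+ 2 by rewrite ler_sqr ?nnegrE// ltW// sp_Ypos.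
  have : (p - 1) * sin (X u) ^+ 2 < 1 * sin (X u) ^+ 2.
    by rewrite ltr_pM2r ?exprn_gt0//; plra.
  move=> h1 h2; apply: le_lt_trans (_ : (p - 1) * sin (X u) ^+ 2 < _); last by lra.
  by rewrite ler_wpM2l//; plra.
have [t0|t0] := leP t 0; first exact: neg.
by apply: le_lt_trans (neg 0 (lexx 0)); exact: (V_nonincr hp1 hp2 sp_sol sp_nt _ _ (ltW t0)).
Qed.

Lemma sp_strip t : 0 < X t < pi.
Proof.
apply: (strip_any hp1 hp2 sp_sol sp_nt 0); rewrite ?sp_V//.
by have [_ _] := sp_quad 0 (lexx 0); have := pi_pos; move=> ? /andP[? ?]; apply/andP; split; lra.
Qed.

(** The lower edge Y >= sin X cos X makes tan X exp(-t) nondecreasing, and tan X = 1 at t = 0. *)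
Lemma sp_small t : t <= 0 -> sin (X t) <= expR t.
Proof.
move=> t0; have [s0 c0 _] := sp_quad t t0.
have dX := fun u => (sp_sol u).1.
have c00 u : t <= u <= 0 -> 0 < cos (X u) by case/andP=> _ u0; have [] := sp_quad u u0.
have : sin (X t) / cos (X t) * expR (- t) <= sin (X 0) / cos (X 0) * expR (- 0).
  apply: (nondecr_dv t0 (f := fun t => sin (X t) / cos (X t) * expR (- t))
    (df := fun t => (Y t - sin (X t) * cos (X t)) / cos (X t) ^+ 2 * expR (- t))) => u utl.
    have ? := dX u; have ? := lt0r_neq0 (c00 u utl); dstep => //.
    have e1 : 1 = cos (X u) ^+ 2 + sin (X u) ^+ 2 by rewrite cos2Dsin2.
    rewrite (_ : Y u - sin (X u) * cos (X u) =
      Y u * (cos (X u) ^+ 2 + sin (X u) ^+ 2) - sin (X u) * cos (X u)); last by rewrite -e1 mulr1.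
    by field.
  case/andP: utl => tu /ltW u0; have /andP[h _] := sp_wedge u u0.
  by rewrite mulr_ge0 ?expR_ge0// divr_ge0 ?sqr_ge0// subr_ge0.
have [s00 c000 /andP[x00 x04]] := sp_quad 0 (lexx 0).
have X04 : X 0 = pi / 4 by case: hX.
have sc4 : sin (X 0) = cos (X 0) by rewrite X04 sin_pi4.
rewrite sc4 divff ?gt_eqF// oppr0 expR0 mul1r => h.
have h2 : sin (X t) <= sin (X t) / cos (X t).
  by rewrite ler_pdivlMr// ler_piMr ?(ltW s0)//; apply: le_trans (ler_norm _) (norm_cos_le1 _).
rewrite -[leRHS]mul1r -(ler_pM2r (expR_gt0 (- t))) -[leRHS]mulrA -expRD subrr expR0 mul1r.
by apply: le_trans h; rewrite ler_pM2r ?expR_gt0.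
Qed.

Lemma id_le_2sin (u : R) : 0 <= u -> u <= pi / 4 -> u <= 2 * sin u.
Proof.
move=> u0 u4; have pp := pi_pos; rewrite -subr_ge0.
have : 2 * sin 0 - 0 <= 2 * sin u - u :> R.
  apply: (nondecr_dv u0 (f := fun u => 2 * sin u - u) (df := fun u => 2 * cos u - 1)) => [w _|w /andP[w0 wu]].
    by dstep; ring.
  have cw : cos (pi / 4) <= cos w.
    by rewrite leNgt ltr_cos ?in_itv/= ?(ltW w0)//=; lra.
  have s4 := sin_pi4.
  have c4 : 0 < cos (pi / 4) :> R by apply: cos_gt0_pihalf; apply/andP; split; lra.
  have := cos2Dsin2 (pi / 4 : R); rewrite s4 => c2.
  have : cos (pi / 4) ^+ 2 <= cos (pi / 4) :> R.
    by rewrite expr2 ler_piMr ?(ltW c4)//; apply: le_trans (ler_norm _) (norm_cos_le1 _).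
  by lra.
by rewrite sin0 mulr0 subrr.
Qed.

Lemma sp_X_le t : t <= 0 -> X t <= 2 * expR t.
Proof.
move=> t0; have [_ _ /andP[x0 x4]] := sp_quad t t0.
apply: le_trans (id_le_2sin _ (ltW x0) x4) _; by rewrite ler_pM2l// sp_small.
Qed.

(** The upper edge makes sin X exp(-t) nonincreasing, and [sp_small] bounds it by 1, so it has a
    positive limit A at -oo. The two edges squeeze Y exp(-t) to the same limit because cos X -> 1. A
    will be the slope of the profile at 0. *)
Lemma sp_rate : exists2 A, 0 < A & tends (fun t => Y (- t) * expR t) A.
Proof.
have dX := fun u => (sp_sol u).1.
pose S t := sin (X t) * expR (- t).
have Smono s t : s <= t -> t <= 0 -> S t <= S s.
  move=> st t0; apply: (nonincr_dv st (f := S)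
     (df := fun t => (cos (X t) * Y t - sin (X t)) * expR (- t))) => u.
    by move=> _; have ? := dX u; rewrite /S; dstep; ring.
  case/andP => _ ut; have u0 := le_trans (ltW ut) t0.
  have /andP[_ h] := sp_wedge u u0; have [s0 c0 _] := sp_quad u u0.
  rewrite pmulr_lle0 ?expR_gt0// subr_le0; apply: le_trans h.
  by rewrite ler_piMl ?(ltW (sp_Ypos u u0))//; apply: le_trans (ler_norm _) (norm_cos_le1 _).
have [l [tl ll]] : exists l, tends (fun t => - S (- t)) l /\ forall t, 0 <= t -> l <= - S (- t).
  apply: (tends_nonincr (m := -1)) => [s t s0 st|t t0].
    by rewrite lerN2; apply: Smono; rewrite ?lerN2 ?oppr_le0.
  rewrite lerN2 /S opprK -[leRHS](expR0) -(addNr t) expRD ler_pM2r ?expR_gt0//.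
  by apply: sp_small; rewrite oppr_le0.
have S0 : 0 < S 0 by rewrite /S oppr0 expR0 mulr1; have [] := sp_quad 0 (lexx 0).
have A0 : S 0 <= - l by rewrite lerNr; have := ll 0 (lexx 0); rewrite oppr0.
exists (- l); first exact: lt_le_trans A0.
move=> e e0.
have e2 : 0 < e / 2 by rewrite divr_gt0.
have [T1 hT1] := tl _ e2.
have l0 : 0 < - l by exact: lt_le_trans A0.
pose d := e / (2 * (- l)).
have d0 : 0 < d by rewrite divr_gt0// mulr_gt0.
exists (Num.max 0 (Num.max T1 (- ln d))) => t; rewrite !ge_max => /and3P[t0 /hT1 h1 td].
have mt0 : - t <= 0 by rewrite oppr_le0.
have /andP[w1 w2] := sp_wedge _ mt0; have [s0 c0 _] := sp_quad _ mt0.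
have E0 := expR_gt0 t.
have hS := ll t t0; rewrite /S opprK in h1 hS.
have u1 : Y (- t) * expR t <= sin (X (- t)) * expR t by rewrite ler_pM2r.
have u2 : sin (X (- t)) * expR t * cos (X (- t)) <= Y (- t) * expR t by rewrite mulrAC ler_pM2r.
have sd : sin (X (- t)) <= d.
  apply: le_trans (sp_small _ mt0) _; rewrite -[leRHS]lnK ?posrE// ler_expR; lra.
have cs : 1 - sin (X (- t)) <= cos (X (- t)).
  have := cos2Dsin2 (X (- t)); have c1 : cos (X (- t)) <= 1 by apply: le_trans (ler_norm _) (norm_cos_le1 _).
  have q1 : cos (X (- t)) ^+ 2 <= cos (X (- t)) by rewrite expr2 ler_piMr// ltW.
  have s1 : sin (X (- t)) <= 1 by apply: le_trans (ler_norm _) (sin_max _).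
  have q2 : sin (X (- t)) ^+ 2 <= sin (X (- t)) by rewrite expr2 ler_piMr// ltW.
  lra.
have u3 : sin (X (- t)) * expR t * (1 - d) <= sin (X (- t)) * expR t * cos (X (- t)).
  by rewrite ler_wpM2l ?mulr_ge0 ?(ltW s0) ?(ltW E0)//; lra.
have u4 : sin (X (- t)) * expR t * d <= - l * d by rewrite ler_wpM2r ?(ltW d0)//; lra.
have u5 : - l * d = e / 2 by rewrite /d; field; rewrite -oppr_eq0 gt_eqF.
move: h1; rewrite !ltr_norml => /andP[h1 h2]; apply/andP; split; lra.
Qed.

(** tau is the first critical time. Before it X increases from 0 to X tau > pi/2, so the inverse
    branch is defined and differentiable around every value in (0, pi/2], the range met by folded
    competitors. *)
Lemma sp_inverse : exists (tau : R) (Ti : R -> R),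
  [/\ forall t, t < tau -> 0 < Y t, pi / 2 < X tau,
      forall u, 0 < u -> u < X tau -> Ti u < tau /\ X (Ti u) = u,
      forall t, t < tau -> Ti (X t) = t &
      forall t, t < tau -> dv Ti (X t) (Y t)^-1].
Proof.
have hs := sp_sol.
have [s [sS unb ypos hsn _]] := oscillation_times hp1 hp2 hs sp_nt 0 0 (sp_V 0) (sp_strip 0) sp_Ypos.
pose tau := s 0%N; exists tau.
have Xtau : pi / 2 < X tau by have [_ _] := hsn 0%N; rewrite /par/= mul1r subr_gt0.
have incr a b : a < b -> b <= tau -> X a < X b.
  move=> ab bt; apply: (incr_dv ab (f := X) (df := Y)) => [w _|w /andP[_ wb]]; first exact: (hs w).1.
  by apply: ypos; apply: lt_le_trans bt.
have inj a b : a < tau -> b < tau -> X a = X b -> a = b.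
  move=> at0 bt e; case: (ltgtP a b) => // h.
    by have := incr a b h (ltW bt); rewrite e ltxx.
  by have := incr b a h (ltW at0); rewrite e ltxx.
have surj u : 0 < u -> u < X tau -> exists2 t, t < tau & X t = u.
  move=> u0 ut.
  (* A time before 0 and tau with X a <= 2 exp(a) <= u / 2 < u. *)
  pose a := Num.min (Num.min 0 tau - 1) (ln (u / 4)).
  have m1 : Num.min 0 tau <= 0 by rewrite ge_min lexx.
  have m2 : Num.min 0 tau <= tau by rewrite ge_min lexx orbT.
  have m3 : a <= Num.min 0 tau - 1 by rewrite ge_min lexx.
  have a0 : a <= 0 by lra.
  have atau : a < tau by lra.
  have Xa : X a < u.
    apply: le_lt_trans (sp_X_le a a0) _.
    have : expR a <= u / 4.
      by rewrite -[leRHS]lnK ?posrE ?divr_gt0// ler_expR ge_min lexx orbT.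
    lra.
  have [c [_ cb xc hc]] := first_hit (ltW atau) (cont_x hs) Xa (ltW ut).
  exists c => //; rewrite lt_neqAle cb andbT; apply: contraTneq ut => <-.
  by rewrite xc ltxx.
have /choice[Ti hTi] : forall u, exists t, 0 < u -> u < X tau -> t < tau /\ X t = u.
  move=> u; have [u0|u0] := boolP (0 < u); last by exists 0.
  have [ut|ut] := boolP (u < X tau); last by exists 0.
  by have [t ? ?] := surj u u0 ut; exists t.
have Xb t : t < tau -> 0 < X t /\ X t < X tau.
  by move=> tt; split; [have /andP[] := sp_strip t|exact: incr].
have TiX t : t < tau -> Ti (X t) = t.
  move=> tt; have [h1 h2] := Xb t tt; have [h3 h4] := hTi _ h1 h2; exact: inj.
exists Ti; split=> // t tt.
apply: is_derive_inverse.
- by near=> w; apply: TiX; near: w; exact: lt_nbhsl.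
- by near=> w; exact: (cont_x hs).
- exact: (hs t).1.
- by rewrite gt_eqF// ypos.
Unshelve. all: by end_near. Qed.

End Properties.
End SpecialSolution.

Section Filters.
Context {R : realType}.

Lemma tendsP (f : R -> R) (l : R) : tends f l <-> f t @[t --> +oo] --> l.
Proof.
split=> [h|/cvgrPdist_lt h].
  apply/cvgrPdist_lt => e e0; have [T hT] := h e e0.
  near=> t; rewrite distrC; apply: hT; near: t; apply: nbhs_pinfty_ge; exact: num_real.
move=> e e0; have [M [Mr hM]] := h e e0.
exists (M + 1) => t Mt; rewrite distrC; apply: hM; apply: lt_le_trans Mt; rewrite ltrDl//.
Unshelve. all: by end_near. Qed.

Lemma tends_ln {x f : R -> R} {l : R} : (forall r, 0 < r -> f r = x (ln r)) ->
  tends x l -> f r @[r --> +oo] --> l.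
Proof.
move=> fE h; apply/tendsP => e e0; have [T hT] := h e e0.
exists (expR T) => r Tr; have r0 : 0 < r by apply: lt_le_trans Tr; exact: expR_gt0.
by rewrite fE//; apply: hT; rewrite -ler_expR lnK.
Qed.

Lemma at_right0P (P : R -> Prop) : (\forall r \near 0^'+, P r) <->
  exists T, forall t, T <= t -> P (expR (- t)).
Proof.
split=> [[d /= d0 hd]|[T hT]].
  exists (- ln d + 1) => t Tt; apply: hd; last exact: expR_gt0.
  rewrite /= sub0r normrN gtr0_norm ?expR_gt0// -[ltRHS]lnK ?posrE// ltr_expR; lra.
near=> r.
have r0 : 0 < r by [].
rewrite -[r]lnK ?posrE// -[ln r]opprK; apply: hT.
rewrite lerNr -ler_expR lnK ?posrE//; near: r; apply: nbhs_right_le; exact: expR_gt0.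
Unshelve. all: by end_near. Qed.

Lemma tends_at0 {f : R -> R} {l : R} :
  f r @[r --> 0^'+] --> l <-> tends (fun t => f (expR (- t))) l.
Proof.
split=> [/cvgrPdist_lt h e /h/at_right0P[T hT]|h].
  by exists T => t /hT; rewrite distrC.
apply/cvgrPdist_lt => e /h[T hT]; apply/at_right0P; exists T => t /hT.
by rewrite distrC.
Qed.

Lemma tends_ext {f g : R -> R} {l : R} : (forall t, f t = g t) -> tends f l -> tends g l.
Proof. by move=> e; rewrite (_ : f = g)//; apply/funext. Qed.

Lemma dv_opp {f : R -> R} {t l : R} : dv f (- t) l -> dv (fun s => f (- s)) t (- l).
Proof.
move=> h; have d1 : dv (fun s : R => - s) t (-1) by dstep; ring.
by apply: dv_eq (dv_comp h d1) _; rewrite mulrN1.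
Qed.

End Filters.

(** * The profile at the origin *)

Section Origin.
Context {R : realType} {p : R} (hp1 : 1 < p) (hp2 : p < 2).
Local Ltac plra := move: (hp1) (hp2) => ? ?; lra.
Let pi_pos : 0 < pi :> R := pi_gt0 R.
Context {X Y : R -> R} (hX : special (p := p) X Y).

Definition profile (r : R) : R := if 0 < r then X (ln r) else 0.

Lemma profileE r : 0 < r -> profile r = X (ln r).
Proof. by rewrite /profile => ->. Qed.

Lemma profile0 : profile 0 = 0.
Proof. by rewrite /profile ltxx. Qed.

(** X comes from 0 at -oo and so inherits the rate of its derivative. In reversed time the excess
    phi is eventually nondecreasing, yet bounded by a multiple of exp(-u), hence nonpositive; s = 1
    and s = -1 treat the two signs of the deviation. *)
Lemma profile_ratio {A : R} : tends (fun t => Y (- t) * expR t) A ->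
  tends (fun t => X (- t) * expR t) A.
Proof.
move=> hA e e0; have e2 : 0 < e / 2 by rewrite divr_gt0.
have [T hT] := hA _ e2.
have sgn (s : R) : `|s| = 1 -> forall t, Num.max 0 T <= t -> s * (X (- t) - A * expR (- t)) <= e / 2 * expR (- t).
  move=> s1 t Tt.
  have st0 : 0 <= t by move: Tt; rewrite ge_max => /andP[].
  rewrite -subr_le0; pose phi u := s * (X (- u) - A * expR (- u)) - e / 2 * expR (- u).
  rewrite -/(phi t) leNgt; apply/negP => pt.
  have mono u : t <= u -> phi t <= phi u.
    move=> tu; apply: (nondecr_dv tu (f := phi)
      (df := fun u => e / 2 * expR (- u) - s * (Y (- u) - A * expR (- u)))) => w.
      by move=> _; have ? := dv_opp (sp_sol hX (- w)).1; rewrite /phi; dstep; ring.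
    case/andP => tw _; have := hT w (le_trans _ (ltW tw)).
    rewrite (le_trans _ Tt) ?le_max ?lexx ?orbT// => /(_ isT) h.
    rewrite subr_ge0; apply: le_trans (ler_norm _) _; rewrite normrM s1 mul1r.
    have -> : Y (- w) - A * expR (- w) = (Y (- w) * expR w - A) * expR (- w).
      by rewrite mulrBl -mulrA -expRD subrr expR0 mulr1.
    by rewrite normrM (gtr0_norm (expR_gt0 _)) ler_pM2r ?expR_gt0// ltW.
  have bound u : t <= u -> phi u <= (2 + `|A|) * expR (- u).
    move=> tu; have u0 : - u <= 0 by rewrite oppr_le0 (le_trans st0).
    have E0 := expR_gt0 (- u).
    have : s * (X (- u) - A * expR (- u)) <= 2 * expR (- u) + `|A| * expR (- u).
      apply: le_trans (ler_norm _) _; rewrite normrM s1 mul1r.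
      apply: le_trans (ler_normB _ _) _; apply: lerD.
        have /andP[x0 _] := sp_strip hp1 hp2 hX (- u).
        by rewrite gtr0_norm//; exact: (sp_X_le hX).
      by rewrite normrM (gtr0_norm E0).
    have : 0 <= e / 2 * expR (- u) by nneg; rewrite ltW.
    by rewrite /phi mulrDl; lra.
  pose c := phi t / (2 + `|A|) / 2.
  have A2 : 0 < 2 + `|A| by rewrite ltr_wpDr.
  have c0 : 0 < c by rewrite !divr_gt0.
  pose u := Num.max t (- ln c).
  have tu : t <= u by rewrite le_max lexx.
  have := le_trans (mono u tu) (bound u tu).
  have : expR (- u) <= c by rewrite -[leRHS]lnK ?posrE// ler_expR lerNl le_max lexx orbT.
  move=> h1 h2; have : phi t <= (2 + `|A|) * c by apply: le_trans h2 _; rewrite ler_pM2l.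
  have -> : (2 + `|A|) * c = phi t / 2 by rewrite /c; field; rewrite gt_eqF.
  lra.
exists (Num.max 0 T) => t Tt.
have E1 : expR (- t) * expR t = 1 by rewrite -expRD addNr expR0.
have mul1 (s : R) : `|s| = 1 -> s * (X (- t) * expR t - A) <= e / 2.
  move=> s1; have := sgn s s1 t Tt; rewrite -(ler_pM2r (expR_gt0 t)) -[leRHS]mulrA E1 mulr1.
  by rewrite -mulrA mulrBl -[A * _ * _]mulrA E1 mulr1.
have := mul1 1 (normr1 _); have := mul1 (-1) (normrN1 _).
by rewrite mul1r mulN1r ltr_norml => *; apply/andP; split; lra.
Qed.

(** The derivative Y (ln r) / r is continued by A at 0: the rate of Y gives its continuity there,
    the rate of X the difference quotient. *)
Lemma profile_slope : exists g : R -> R,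
  [/\ {within `[0, +oo[%classic, continuous g},
      forall x : R, 0 <= x ->
        (profile y - profile x) / (y - x) @[y --> within `[0, +oo[%classic x^'] --> g x &
      forall r, 0 < r -> g r = Y (ln r) / r].
Proof.
have [A A0 hA] := sp_rate hX; have hs := sp_sol hX.
have hB := profile_ratio hA.
pose g r := if 0 < r then Y (ln r) / r else A.
have gp r : 0 < r -> {for r, continuous g}.
  move=> r0; apply: (cont_near (f := fun r => Y (ln r) / r)).
    by apply: near_pos => // s s0; rewrite /g s0.
  exact: dv_cont (dv_global1 hs r r0).
have small (F : R -> R) : tends (fun t => F (expR (- t))) A ->
    forall e, 0 < e -> exists2 d, 0 < d & forall r, 0 < r -> r < d -> `|F r - A| < e.
  move=> hF e e0; have [T hT] := hF e e0; exists (expR (- T)); first exact: expR_gt0.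
  move=> r r0 rd; have := hT (- ln r); rewrite opprK lnK ?posrE//; apply.
  by rewrite lerNr -ler_expR lnK ?posrE// ltW.
exists g; split; last by move=> r r0; rewrite /g r0.
  apply/subspace_continuousP => r; rewrite /= in_itv/= andbT le_eqVlt => /orP[/eqP<-|r0]; last first.
    by apply: cvg_trans (gp r r0); apply: cvg_app; exact: cvg_within.
  apply/cvgrPdist_lt => e e0.
  have [|d d0 hd] := small (fun r => Y (ln r) / r) _ e e0.
    by apply: tends_ext hA => t; rewrite expRK expRN invrK.
  rewrite /within; apply: (pball_near d) => // w; rewrite subr0 /= in_itv/= andbT => wd w0.
  move: wd w0; change (`|w| < d -> 0 <= w -> `|g 0 - g w| < e) => wd w0.
  rewrite (_ : g 0 = A); last by rewrite /g ltxx.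
  rewrite /g;
  case: ifPn => [w0'|_]; last by rewrite subrr normr0.
  by rewrite distrC; apply: hd => //; rewrite -(gtr0_norm w0').
move=> r; rewrite le_eqVlt => /orP[/eqP<-|r0].
  apply/cvgrPdist_lt => e e0.
  have [|d d0 hd] := small (fun r => X (ln r) / r) _ e e0.
    by apply: tends_ext hB => t; rewrite expRK expRN invrK.
  rewrite /g ltxx; apply: (pball_near d) => // w; rewrite subr0 /= in_itv/= andbT => wd wn0 w0.
  have {}w0 : 0 < w by rewrite lt_neqAle eq_sym wn0.
  rewrite profile0 !subr0 profileE// distrC; apply: hd => //.
  by rewrite -(gtr0_norm w0).
have dP := dv_global hs profileE r r0.
have /is_derive1_caratheodory[q [hq cq qr]] := dP.
rewrite /g r0 -qr.
apply/cvgrPdist_lt => e e0; have [d d0 hd] := near_abs cq e0.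
apply: (pball_near d) => // w wd wr _.
by rewrite hq mulfK ?subr_eq0// distrC; exact: hd.
Qed.

Lemma C1_nonneg_profile : C1_nonneg profile.
Proof. by have [g [? ? _]] := profile_slope; exists g. Qed.

End Origin.

(** * Classification of solutions *)

Section Uniqueness.
Context {R : realType} {p : R} (hp1 : 1 < p) (hp2 : p < 2).
Local Ltac plra := move: (hp1) (hp2) => ? ?; lra.
Let pi_pos : 0 < pi :> R := pi_gt0 R.

Lemma VN (x y : R) : V p (- x) (- y) = V p x y.
Proof. by rewrite /V sinN !sqrrN. Qed.

Lemma V_int (n : int) (x y : R) : V p (x + n%:~R * pi) y = V p x y.
Proof. by rewrite /V sin_int. Qed.

Lemma ntN {x y : R -> R} : nontrivial x y -> nontrivial (fun t => - x t) (fun t => - y t).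
Proof.
move=> nt t [/eqP]; rewrite oppr_eq0 => /eqP y0; rewrite sinN cosN mulNr => /eqP.
by rewrite oppr_eq0 => /eqP sc; apply: (nt t).
Qed.

Lemma nt_int {x y : R -> R} (n : int) : nontrivial x y -> nontrivial (fun t => x t + n%:~R * pi) y.
Proof.
move=> nt t [y0 h]; apply: (nt t); split=> //; rewrite -h.
by apply/esym; apply: (int_period (fun u => sin u * cos u)) => u; rewrite sinDpi cosDpi mulrNN.
Qed.

Section Compare.
Context {X Y x y : R -> R} (hX : special (p := p) X Y) (hs : sol p x y) (nt : nontrivial x y).
Hypothesis neg : forall t, V p (x t) (y t) < 0.
Hypothesis xs : forall t, 0 < x t < pi.
Hypothesis x0 : tends (fun t => x (- t)) 0.

(** If y t <= 0 at an early t, then y < 0 at all earlier times, since a positive value would lead to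
    a turning point, where x > pi/2. So x would be nonincreasing up to t, against x t > 0 and x -> 0
    at -oo. *)
Lemma y_pos_before : exists T, forall t, t <= T -> 0 < y t /\ x t < pi / 4.
Proof.
have p4 : 0 < pi / 4 :> R by rewrite divr_gt0.
have [S hS] := x0 _ p4.
have small t : t <= - S -> x t < pi / 4.
  move=> tS; have := hS (- t); rewrite opprK lerNr => /(_ tS); rewrite subr0 => /(le_lt_trans _); apply.
  exact: ler_norm.
exists (- S) => t tS; split; last exact: small.
rewrite ltNge; apply/negP => yt.
have before u : u < t -> y u < 0.
  move=> ut; rewrite ltNge; apply/negP => yu.
  have uS : u <= - S by apply: le_trans (ltW ut) tS.
  have [a [au ta ya]] : exists a, [/\ u <= a, a < t & 0 < y a].
    move: yu; rewrite le_eqVlt => /orP[/eqP/esym yu|yu]; last by exists u; split.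
    have [l dl l0] := y_simple hs nt u yu.
    have [d d0 hd] := simple_zero dl yu l0.
    have du := (hs u).2; rewrite yu Phi0 in du.
    have lp : 0 < l.
      rewrite -(dv_derive1 dl) (dv_derive1 du); have /andP[xu xp] := xs u.
      have xu4 := small u uS; apply: mulr_gt0; first by apply: sin_gt0_pi; rewrite xu.
      by apply: cos_gt0_pihalf; apply/andP; split; lra.
    pose h := Num.min d (t - u) / 2.
    have m0 : 0 < Num.min d (t - u) by rewrite lt_min d0 subr_gt0.
    have m1 : Num.min d (t - u) <= d by rewrite ge_min lexx.
    have m2 : Num.min d (t - u) <= t - u by rewrite ge_min lexx orbT.
    have h0 : 0 < h by rewrite divr_gt0.
    exists (u + h); split; [lra|rewrite /h; lra|].
    have [|g [-> gl]] := hd (u + h); first by rewrite addrAC subrr add0r gtr0_norm// /h; lra.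
    by rewrite addrAC subrr add0r mulr_gt0//; rewrite pmulr_lgt0 in gl.
  have cy s : {for s, continuous (fun s => - y s)} by apply: cvgN; exact: cont_y hs s.
  have [||c [ac ct yc hc]] := first_hit (f := fun s => - y s) (v := 0) (ltW ta) cy.
  - by rewrite oppr_lt0.
  - by rewrite oppr_ge0.
  have yc0 : y c = 0 by apply/eqP; rewrite -oppr_eq0 yc.
  have [||h _] := turning (t' := c) hs nt ac _ yc0 _ (xs c).
  - by move=> w aw wc; have := hc w (ltW aw) wc; rewrite oppr_lt0.
  - by move=> w cw wc; have := lt_trans cw wc; rewrite ltxx.
  have := small c (le_trans ct tS); lra.
have /andP[xt _] := xs t.
have [S' hS'] := x0 _ xt.
pose u := Num.min (t - 1) (- S').
have ut : u < t by rewrite gt_min ltrBlDr ltrDl ltr01.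
have : x t <= x u.
  apply: (nonincr_dv (ltW ut) (f := x) (df := y)) => w; first by move=> _; exact: (hs w).1.
  by case/andP => _ /before/ltW.
have := hS' (- u); rewrite opprK lerNr ge_min lexx orbT => /(_ isT).
by rewrite subr0 => /(le_lt_trans (ler_norm _)); lra.
Qed.

(** [th t] is the time at which the special solution takes the value x t, and D compares [V] at
    equal x. In this region both [V] and y (y^2 + sin^2 x)^(p/2 - 1), which governs D', increase
    with y; so D D' <= 0, and D -> 0 at -oo gives D = 0. Then the slopes agree at T and the system
    has only one solution. *)
Lemma special_unique : exists c, forall t, x t = X (t + c).
Proof.
have hsX := sp_sol hX; have ntX := sp_nt hp1 hp2 hX.
have [tau [Ti [Yp Xtau hTi TiX dTi]]] := sp_inverse hp1 hp2 hX.
have [T hT] := y_pos_before.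
have rng t : t <= T -> 0 < x t /\ x t < X tau.
  by move=> tT; have /andP[? _] := xs t; have [_ ?] := hT t tT; split=> //; lra.
pose th t := Ti (x t).
have thE t : t <= T -> th t < tau /\ X (th t) = x t.
  by move=> tT; have [h1 h2] := rng t tT; have [] := hTi _ h1 h2.
have dth t : t <= T -> dv th t ((Y (th t))^-1 * y t).
  move=> tT; have [h1 h2] := thE t tT; have := dTi _ h1; rewrite h2 => d1.
  exact: dv_comp d1 (hs t).1.
pose D t := V p (X (th t)) (Y (th t)) - V p (x t) (y t).
pose g s y := y * (y ^+ 2 + sin s ^+ 2) `^ (p / 2 - 1).
pose dD t := (2 - p) * p * y t * (g (x t) (y t) - g (x t) (Y (th t))).
have dvD' t : t <= T -> dv D t (dD t).
  move=> tT; have [h1 h2] := thE t tT; have Y0 := Yp _ h1.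
  have d1 := dv_comp (dv_V hp1 hsX ntX (th t)) (dth t tT).
  apply: dv_eq (dvB d1 (dv_V hp1 hs nt t)) _.
  rewrite h2 /dD /g; set Q1 := _ `^ _; set Q2 := _ `^ _.
  by field; rewrite gt_eqF.
have s0 t : 0 < sin (x t) ^+ 2 by rewrite exprn_gt0// sin_gt0_pi.
have W_bound t : 0 <= - V p (x t) (y t) <= `|sin (x t)|.
  have v0 : 0 < - V p (x t) (y t) by rewrite oppr_gt0.
  by rewrite (ltW v0)/=; apply: (sin_lower hp1 hp2 nt t _ (lexx _) v0).
have WX_bound t : 0 <= - V p (X t) (Y t) <= `|sin (X t)|.
  have v0 : 0 < - V p (X t) (Y t) by rewrite oppr_gt0; exact: sp_V hX t.
  by rewrite (ltW v0)/=; apply: (sin_lower hp1 hp2 ntX t _ (lexx _) v0).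
(* Along both trajectories 0 <= -V <= |sin x| <= x. *)
have Dsmall t : t <= T -> `|D t| <= x t.
  move=> tT; have [_ h2] := thE t tT; have /andP[a1 a2] := W_bound t.
  have := WX_bound (th t); rewrite h2 => /andP[b1 b2].
  have /andP[xt _] := xs t.
  have : `|sin (x t)| <= x t by rewrite gtr0_norm ?sin_gt0_pi//; apply: sin_le_id; exact: ltW.
  by move=> hx; rewrite /D h2 ler_norml; apply/andP; split; lra.
have sgn t : t <= T -> D t * dD t <= 0.
  move=> tT; have [h1 h2] := thE t tT; have Y0 := Yp _ h1; have [y0 _] := hT t tT.
  have VX := sp_V hp1 hp2 hX (th t); have Vx := neg t.
  rewrite V_lt0 ?(N_gt0 ntX)// h2 in VX; rewrite V_lt0 ?(N_gt0 nt)// in Vx.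
  have cpos : 0 < (2 - p) * p * y t by rewrite !mulr_gt0//; plra.
  rewrite /D /dD h2 mulrCA pmulr_rle0//.
  case: (ltgtP (y t) (Y (th t))) => h.
  - apply: mulr_ge0_le0; rewrite ?subr_ge0 ?subr_le0; apply: ltW.
      exact: (W_decr hp1 hp2 _ _ _ (ltW y0) h VX).
    exact: (Gy_incr hp1 hp2 _ _ _ (s0 t) (ltW y0) h).
  - apply: mulr_le0_ge0; rewrite ?subr_ge0 ?subr_le0; apply: ltW.
      exact: (W_decr hp1 hp2 _ _ _ (ltW Y0) h Vx).
    exact: (Gy_incr hp1 hp2 _ _ _ (s0 t) (ltW Y0) h).
  - by rewrite h !subrr mulr0.
have DT : D T = 0.
  apply/eqP; rewrite -normr_eq0 eq_le normr_ge0 andbT leNgt; apply/negP => DT.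
  have [S hS] := x0 _ DT.
  pose u := Num.min T (- S).
  have uT : u <= T by rewrite ge_min lexx.
  have : D T ^+ 2 <= D u ^+ 2.
    apply: (nonincr_dv uT (f := fun t => D t ^+ 2) (df := fun t => 2 * (D t * dD t))) => w.
      by case/andP => _ /dvD' ?; dstep; rewrite /=; ring.
    by case/andP => _ /ltW/sgn h; rewrite pmulr_rle0.
  rewrite -[_ ^+ 2](real_normK (num_real (D T))) -[X in _ <= X](real_normK (num_real (D u))).
  rewrite ler_sqr ?nnegrE// => h.
  have := hS (- u); rewrite opprK lerNr ge_min lexx orbT => /(_ isT).
  rewrite subr0 => /(le_lt_trans (ler_norm _)).
  by have := Dsmall u uT; lra.
have [h1 h2] := thE T (lexx T); have Y0 := Yp _ h1; have [y0 _] := hT T (lexx T).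
have VX := sp_V hp1 hp2 hX (th T); have Vx := neg T.
rewrite V_lt0 ?(N_gt0 ntX)// h2 in VX; rewrite V_lt0 ?(N_gt0 nt)// in Vx.
have yY : y T = Y (th T).
  move: DT; rewrite /D h2 => /eqP; rewrite subr_eq0 => /eqP e.
  case: (ltgtP (y T) (Y (th T))) => // h.
    by have := W_decr hp1 hp2 _ _ _ (ltW y0) h VX; rewrite e ltxx.
  by have := W_decr hp1 hp2 _ _ _ (ltW Y0) h Vx; rewrite e ltxx.
exists (th T - T) => t.
have := sol_unique hp1 hp2 T hs (sol_shift (th T - T) hsX).
by rewrite addrC subrK h2 => /(_ erefl yY t)[].
Qed.

End Compare.

Lemma sol_const_nt {x y : R -> R} : sol p x y -> ~ (exists c, forall t, x t = c) -> nontrivial x y.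
Proof.
move=> hs nc t [yt sc]; apply: nc; exists (x t) => s.
by have [] := sol_eq hp1 hp2 t hs yt sc s.
Qed.

(** Before t1, [V] is at least its value there, which bounds |y|^p below by w and so |y| by min(1,
    w). Hence y keeps its sign and x goes to -oo at least linearly. *)
Lemma V_pos_backwards {x y : R -> R} (t1 : R) : sol p x y -> nontrivial x y ->
  0 < V p (x t1) (y t1) -> 0 < y t1 ->
  exists2 d, 0 < d & forall t, t <= t1 -> d <= y t /\ x t <= x t1 - d * (t1 - t).
Proof.
move=> hs nt V1 y1; have k0 : 0 < p - 1 by plra.
pose w := V p (x t1) (y t1) / (p - 1); have w0 : 0 < w by rewrite divr_gt0.
have yn t : t <= t1 -> Num.min 1 w <= `|y t|.
  move=> tt; have Vt : V p (x t1) (y t1) <= V p (x t) (y t) by exact: (V_nonincr hp1 hp2 hs nt).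
  have Vp : 0 < V p (x t) (y t) by apply: lt_le_trans Vt.
  have := Vp; rewrite V_gt0 ?(N_gt0 nt)// => sy.
  have y2 : 0 < y t ^+ 2.
    by have := le_lt_trans (sqr_ge0 _) sy; rewrite pmulr_rgt0.
  have N0 := N_gt0 nt t.
  have : w <= (y t ^+ 2) `^ (p / 2).
    rewrite /w ler_pdivrMr//; apply: le_trans Vt _; rewrite /V.
    rewrite -(mulr_powRB1 (ltW y2)) ?divr_gt0//; last by plra.
    rewrite [leRHS](_ : _ = (p - 1) * y t ^+ 2 * (y t ^+ 2) `^ (p / 2 - 1)); last by ring.
    apply: ler_pM; rewrite ?powR_ge0 ?subr_ge0 ?(ltW sy)//.
      by rewrite gerBl sqr_ge0.
    rewrite -[p / 2 - 1]opprK !(powRN _ (- (p / 2 - 1))) lef_pV2 ?posrE ?powR_gt0//.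
    by apply: ge0_ler_powR; rewrite ?nnegrE ?(ltW N0) ?(ltW y2)//; [plra|rewrite lerDl sqr_ge0].
  move=> h; rewrite leNgt lt_min; apply/negP => /andP[ya yw].
  have : (y t ^+ 2) `^ (p / 2) <= (y t ^+ 2) `^ 2^-1.
    apply: ger_powR; last by plra.
    by rewrite y2 -real_normK ?num_real// expr2 -[leRHS]mulr1; apply: ler_pM => //; exact: ltW.
  by rewrite powR12_sqrt ?(ltW y2)// sqrtr_sqr; lra.
have m0 : 0 < Num.min 1 w by rewrite lt_min ltr01.
have yp t : t <= t1 -> 0 < y t.
  move=> tt; rewrite (const_sign tt (f := y))// => u; first by move=> _; exact: cont_y hs u.
  by case/andP => _ /yn h; rewrite -normr_gt0; apply: lt_le_trans h.
have yd t : t <= t1 -> Num.min 1 w <= y t.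
  by move=> tt; have := yn t tt; rewrite gtr0_norm ?yp.
exists (Num.min 1 w) => // t tt; split; first exact: yd.
have : x t - Num.min 1 w * t <= x t1 - Num.min 1 w * t1.
  apply: (nondecr_dv tt (f := fun t => x t - Num.min 1 w * t) (df := fun t => y t - Num.min 1 w)) => u.
    by move=> _; have [? _] := hs u; dstep; ring.
  by case/andP => _ /ltW/yd; rewrite subr_ge0.
lra.
Qed.

(** A time with V > 0 would make x unbounded at -oo, by [V_pos_backwards] for the solution or its
    opposite. So V <= 0 at all times, and the strict decrease improves this to V < 0. *)
Lemma finite_V_neg {x y : R -> R} {c : R} : sol p x y -> nontrivial x y ->
  tends (fun t => x (- t)) c -> forall t, V p (x t) (y t) < 0.
Proof.
have aux (u v : R -> R) l t1 : sol p u v -> nontrivial u v -> tends (fun t => u (- t)) l ->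
    0 < V p (u t1) (v t1) -> ~ 0 < v t1.
  move=> hs nt hl V1 v1; have [d d0 hd] := V_pos_backwards t1 hs nt V1 v1.
  have [T hT] := hl 1 ltr01.
  pose M := `|u t1 - l| + 1.
  have M0 : 0 < M by rewrite ltr_wpDl.
  pose s := Num.min (- T) (t1 - M / d).
  have s1 : s <= t1 - M / d by rewrite ge_min lexx orbT.
  have s2 : s <= t1 by apply: le_trans s1 _; rewrite gerBl divr_ge0// ltW.
  have [_ h] := hd s s2.
  have := hT (- s); rewrite opprK lerNr ge_min lexx => /(_ isT); rewrite ltr_norml => /andP[h3 _].
  have : M <= d * (t1 - s) by rewrite -ler_pdivrMl// mulrC; lra.
  have := ler_norm (u t1 - l).
  rewrite /M; lra.
move=> hs nt hl t.
have Vle s : V p (x s) (y s) <= 0.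
  rewrite leNgt; apply/negP => Vs.
  have y0 : y s != 0.
    by apply: contraTneq Vs => /(V_crit hp1 hp2 nt)/ltW; rewrite leNgt.
  case: (ltgtP (y s) 0) => ys; [|exact: (aux x y c s)|by rewrite ys eqxx in y0].
  apply: (aux _ _ (- c) s (solN hs) (ntN nt)); rewrite ?VN ?oppr_gt0//.
  move=> e e0; have [T hT] := hl e e0; exists T => u /hT.
  by rewrite -normrN opprB opprK addrC.
by apply: lt_le_trans (Vle (t - 1)); apply: (V_decr hp1 hp2 hs nt); rewrite ltrBlDr ltrDl.
Qed.

(** Barbalat's lemma backward in time shows that c is an equilibrium value. Were it an odd multiple
    of pi/2, [V] would tend to -1 at -oo and be strictly below -1 afterwards, against -V <= |sin
    x|. *)
Lemma finite_limit_int {x y : R -> R} {c : R} : sol p x y -> nontrivial x y ->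
  tends (fun t => x (- t)) c -> exists n : int, c = n%:~R * pi.
Proof.
move=> hs nt hl; have neg := finite_V_neg hs nt hl.
have p0 : 0 < p - 1 by plra.
pose B : R := (p - 1)^-1; pose M := 1 + lipC p * B.
have B0 : 0 < B by rewrite invr_gt0.
have lc0 : 0 < lipC p by apply: lt_le_trans (lipC_ge1 hp1 hp2).
have M0 : 0 < M by rewrite ltr_wpDr// mulr_ge0// ltW.
have yb t : `|y t| <= B by exact: (y_bound' hp1 hp2 nt t (neg t)).
have zb t : `|Phi p (x t) (y t)| <= M.
  by apply: le_trans (Phi_bound hp1 hp2 _ _) _; rewrite lerD2l ler_wpM2l// ltW.
have dx t : dv (fun t => x (- t)) t (- y (- t)) by apply: dv_opp; exact: (hs _).1.
have dy t : dv (fun t => - y (- t)) t (Phi p (x (- t)) (y (- t))).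
  by have h := dv_opp (hs (- t)).2; apply: dv_eq (dvN h) _; rewrite opprK.
have nb t : 0 <= t -> `|- y (- t)| <= B by move=> _; rewrite normrN.
have nz t : 0 <= t -> `|Phi p (x (- t)) (y (- t))| <= M by [].
have lx := lip_dv (fun t (_ : 0 <= t) => dx t) nb.
have ly := lip_dv (fun t (_ : 0 <= t) => dy t) nz.
have ty : tends (fun t => - y (- t)) 0.
  by apply: (barbalat_dv (T := 0) (L := M) (ltW M0) (fun t _ => dx t) ly hl).
have tz : tends (fun t => Phi p (x (- t)) (y (- t))) 0.
  apply: (barbalat_dv (T := 0) (L := lipC p * (B + M)) _ (fun t _ => dy t) _ ty).
    by nneg.
  move=> s t s0 t0; apply: le_trans (Phi_lip hp1 hp2 _ _ _ _) _.
  rewrite -mulrA ler_wpM2l ?(ltW lc0)// mulrDl lerD ?lx//.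
  by have := ly s t s0 t0; rewrite opprK addrC distrC -normrN opprB; rewrite -normrN opprB.
have {}ty : tends (fun t => y (- t)) 0.
  by apply: tends_abs => e /ty[T hT]; exists T => t /hT; rewrite !subr0 normr_id normrN.
have sc : sin c * cos c = 0.
  have t1 : tends (fun t => Phi p (x (- t)) (y (- t))) (sin c * cos c).
    move=> e e0; have d0 : 0 < e / (2 * lipC p) by rewrite divr_gt0// mulr_gt0.
    have [T1 h1] := hl _ d0; have [T2 h2] := ty _ d0.
    exists (Num.max T1 T2) => t; rewrite ge_max => /andP[/h1 xt /h2 yt].
    rewrite -(Phi0 (p := p) c); apply: le_lt_trans (Phi_lip hp1 hp2 _ _ _ _) _.
    rewrite (_ : e = lipC p * (e / (2 * lipC p) + e / (2 * lipC p))); last by field; rewrite gt_eqF.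
    by rewrite ltr_pM2l// ltrD.
  exact: tends_unique t1 tz.
have [/sin_eq0//|s0] := eqVneq (sin c) 0.
have c0 : cos c = 0 by apply/eqP; move/eqP: sc; rewrite mulf_eq0 (negbTE s0).
have s2 : sin c ^+ 2 = 1 by have := cos2Dsin2 c; rewrite c0 expr0n add0r.
exfalso.
have /tendsP cx := hl; have /tendsP cy := ty.
have csin : sin (x (- t)) ^+ 2 @[t --> +oo] --> (1 : R).
  rewrite -s2 expr2; under eq_fun do rewrite expr2.
  by apply: cvgM; apply: (cvg_comp _ _ cx); exact: continuous_sin.
have cy2 : y (- t) ^+ 2 @[t --> +oo] --> (0 : R).
  rewrite [X in _ --> X](_ : _ = 0 * 0 :> R); last by rewrite mulr0.
  by under eq_fun do rewrite expr2; apply: cvgM.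
have cV : V p (x (- t)) (y (- t)) @[t --> +oo] --> ((p - 1) * 0 - 1) * ((0 + 1) `^ (p / 2 - 1)).
  apply: cvgM; first by apply: cvgB => //; apply: cvgM => //; exact: cvg_cst.
  have h1 : 0 < 0 + 1 :> R by rewrite add0r.
  have cN : y (- t) ^+ 2 + sin (x (- t)) ^+ 2 @[t --> +oo] --> (0 + 1 : R) by exact: cvgD.
  have cp : {for 0 + 1, continuous (fun u : R => u `^ (p / 2 - 1))}.
    exact: (dv_cont (is_derive1_powR (p / 2 - 1) h1)).
  exact: (cvg_comp _ _ cN cp).
rewrite mulr0 !add0r powR1 mulr1 in cV; move/tendsP: cV => tV.
have Vm1 : V p (x (- 1)) (y (- 1)) <= -1.
  apply: (tends_ge (T := 1)) tV _ => t t1; apply: (V_nonincr hp1 hp2 hs nt).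
  by rewrite lerN2.
have V0 : V p (x 0) (y 0) < -1.
  by apply: lt_le_trans Vm1; apply: (V_decr hp1 hp2 hs nt); rewrite oppr_lt0.
have : - V p (x 0) (y 0) <= `|sin (x 0)|.
  by apply: (sin_lower hp1 hp2 nt) => //; rewrite oppr_gt0.
by have := sin_max (x 0); lra.
Qed.

Lemma finite_classification {X Y x y : R -> R} {c : R} : special (p := p) X Y ->
  sol p x y -> nontrivial x y -> tends (fun t => x (- t)) c ->
  exists (a : R) (n : int), (forall t, x t = n%:~R * pi + X (t + a)) \/
                            (forall t, x t = n%:~R * pi - X (t + a)).
Proof.
move=> hX hs nt hl; have [n cn] := finite_limit_int hs nt hl; subst c.
pose u t := x t + (- n)%:~R * pi.
have hu : sol p u y := sol_int (- n) hs.
have ntu : nontrivial u y := nt_int (- n) nt.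
have uE t : x t = n%:~R * pi + u t by rewrite /u mulrNz; ring.
have u0 : tends (fun t => u (- t)) 0.
  by move=> e /hl[T hT]; exists T => t /hT; rewrite uE subr0 addrAC subrr add0r.
have neg := finite_V_neg hu ntu u0.
have [T hT] := u0 _ pi_pos; have := hT T (lexx T); rewrite subr0 ltr_norml => /andP[uT1 uT2].
have uT0 : u (- T) != 0.
  by apply: contraNneq (sin_neq0 hp1 ntu _ (neg (- T))) => ->; rewrite sin0.
have pos (v w : R -> R) : sol p v w -> nontrivial v w -> tends (fun t => v (- t)) 0 ->
    (forall t, V p (v t) (w t) < 0) -> 0 < v (- T) < pi -> exists a, forall t, v t = X (t + a).
  move=> hv ntv v0 Vn vT.
  apply: (special_unique hX hv ntv Vn _ v0) => t.
  exact: (strip_any hp1 hp2 hv ntv (- T) t).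
case: (ltgtP (u (- T)) 0) => h; last by rewrite h eqxx in uT0.
  have [|||a ha] := pos _ _ (solN hu) (ntN ntu).
  - by move=> e /u0[S hS]; exists S => t /hS; rewrite !subr0 normrN.
  - by move=> t; rewrite VN.
  - by rewrite oppr_gt0 h/=; lra.
  by exists a, n; right => t; rewrite -ha opprK.
have [|a ha] := pos _ _ hu ntu u0 neg; first by rewrite h.
by exists a, n; left => t; rewrite -ha.
Qed.

End Uniqueness.

(** * Global solutions, finite or infinite at the origin *)

Section GlobalSolutions.
Context {R : realType} {p : R} (hp1 : 1 < p) (hp2 : p < 2).
Local Ltac plra := move: (hp1) (hp2) => ? ?; lra.
Let pi_pos : 0 < pi :> R := pi_gt0 R.

Lemma finite_solutions {X Y f : R -> R} : special (p := p) X Y ->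
  global_solution p f -> finite_at0 f -> nonconstant_pos f ->
  exists (a : R) (k : int), 0 < a /\
    ((forall r : R, 0 < r -> f r = k%:~R * pi + profile (X := X) (a * r)) \/
     (forall r : R, 0 < r -> f r = k%:~R * pi - profile (X := X) (a * r))).
Proof.
move=> hX hf [c /tends_at0 hc] nc.
have hs := sol_of_global hp1 hp2 hf.
have nt : nontrivial (fun t => f (expR t)) (fun t => expR t * derive1 f (expR t)).
  apply: (sol_const_nt hp1 hp2 hs) => -[d hd]; apply: nc; exists d => r r0.
  by rewrite -[r]lnK ?posrE.
have [a [n h]] := finite_classification hp1 hp2 hX hs nt hc.
have prof r : 0 < r -> profile (X := X) (expR a * r) = X (ln r + a).
  by move=> r0; rewrite profileE ?mulr_gt0 ?expR_gt0// lnM ?posrE ?expR_gt0// expRK addrC.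
exists (expR a), n; split; first exact: expR_gt0.
case: h => h; [left|right] => r r0.
  by rewrite prof// -h lnK ?posrE.
by rewrite prof// -h lnK ?posrE.
Qed.

Lemma oscillates_translate {f : R -> R} {c c0 : R} {s : nat -> R} :
  (forall r, 0 < r -> derivable f r 1) ->
  oscillates (fun r => f r - c0) c (max_above (fun r => f r - c0) c) (min_below (fun r => f r - c0) c) s ->
  oscillates f (c + c0) (max_above f (c + c0)) (min_below f (c + c0)) s.
Proof.
move=> df [h1 h2 h3 h4 [h5 h6]].
have e u : f u - (c + c0) = f u - c0 - c by ring.
split=> //.
- move=> n; have [s0 _] := h1 n; rewrite -(h3 n); apply/esym/dv_derive1.
  by have := derivable_dv (df _ s0) => ?; dstep; ring.
- move=> n; have [[a1 a2] [b1 b2]] := h4 n; split; split.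
  + by apply: filterS a1 => u; rewrite lerD2r.
  + by case/andP: a2 => *; apply/andP; split; lra.
  + by apply: filterS b1 => u; rewrite lerD2r.
  + by case/andP: b2 => *; apply/andP; split; lra.
- by split=> [|n]; [case: h5 => n0 n00 hn0; exists n0 => // n nn; rewrite !e hn0|rewrite !e].
Qed.

(** If x is bounded it converges; y is bounded through [V], so Barbalat's lemma gives y -> 0, and V
    > 0 means sin^2 x < (p - 1) y^2, whence sin x -> 0. *)
Lemma monotone_limit {x y : R -> R} : sol p x y -> nontrivial x y ->
  (forall t, 0 < V p (x t) (y t)) -> (forall t, 0 < y t) ->
  (forall A, exists t, A < x t) \/ exists k : int, tends x (k%:~R * pi).
Proof.
move=> hs nt Vp yp.
have xm s t : s <= t -> x s <= x t.
  move=> st; apply: (nondecr_dv st (f := x) (df := y)) => w _; [exact: (hs w).1|exact: ltW].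
have [ub|nub] := pselect (forall A, exists t, A < x t); first by left.
right; have /existsNP[A hA] := nub.
have xA t : x t <= A by rewrite leNgt; apply/negP => h; apply: hA; exists t.
have [l [hl _]] : exists l, tends (fun t => - x t) l /\ forall t, 0 <= t -> l <= - x t.
  by apply: (tends_nonincr (m := - A)) => [s t _ st|t _]; rewrite lerN2// xm.
have {}hl : tends x (- l).
  by move=> e /hl[T hT]; exists T => t /hT; rewrite -normrN !opprD !opprK.
have k0 : 0 < p - 1 by plra.
(* For y >= 1, (p - 1) y <= (p - 1) (y^2 + sin^2 x)^(p/2) <= V + p, and V is at most its value at
   0. *)
pose B := Num.max 1 ((V p (x 0) (y 0) + p) / (p - 1)).
have yB t : 0 <= t -> `|y t| <= B.
  move=> t0; rewrite gtr0_norm// le_max; have [y1|y1] := leP (y t) 1; rewrite //=.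
  have Vt := V_nonincr hp1 hp2 hs nt _ _ t0.
  rewrite ler_pdivlMr//.
  suff : y t * (p - 1) <= V p (x t) (y t) + p by lra.
  have N0 := N_gt0 nt t.
  have N1 : 1 <= y t ^+ 2 + sin (x t) ^+ 2.
    apply: ler_wpDr; first exact: sqr_ge0.
    by rewrite expr2 -[leLHS]mulr1; apply: ler_pM => //; exact: ltW.
  have NE : V p (x t) (y t) = (p - 1) * ((y t ^+ 2 + sin (x t) ^+ 2) *
      (y t ^+ 2 + sin (x t) ^+ 2) `^ (p / 2 - 1)) -
      p * (sin (x t) ^+ 2 * (y t ^+ 2 + sin (x t) ^+ 2) `^ (p / 2 - 1)).
    by rewrite /V; ring.
  rewrite NE mulr_powRB1 ?(ltW N0)//; last by plra.
  have h1 : y t <= (y t ^+ 2 + sin (x t) ^+ 2) `^ (p / 2).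
    apply: le_trans (_ : (y t ^+ 2 + sin (x t) ^+ 2) `^ 2^-1 <= _); last first.
      by apply: ler_powR => //; plra.
    rewrite powR12_sqrt ?(ltW N0)//.
    by rewrite -[leLHS]ger0_norm ?(ltW (yp t))// -sqrtr_sqr ler_wsqrtr// lerDl sqr_ge0.
  have h2 : sin (x t) ^+ 2 * (y t ^+ 2 + sin (x t) ^+ 2) `^ (p / 2 - 1) <= 1.
    rewrite -[leRHS]mulr1; apply: ler_pM; rewrite ?sqr_ge0 ?powR_ge0//.
    rewrite -[leRHS](powRr0 (y t ^+ 2 + sin (x t) ^+ 2)); apply: ler_powR => //; plra.
  have h3 : (p - 1) * y t <= (p - 1) * (y t ^+ 2 + sin (x t) ^+ 2) `^ (p / 2).
    by rewrite ler_pM2l.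
  have h4 : p * (sin (x t) ^+ 2 * (y t ^+ 2 + sin (x t) ^+ 2) `^ (p / 2 - 1)) <= p * 1.
    by rewrite ler_pM2l//; plra.
  lra.
have lc0 : 0 < lipC p by apply: lt_le_trans (lipC_ge1 hp1 hp2).
have B0 : 0 <= B by rewrite le_max ler01.
have zb t : 0 <= t -> `|Phi p (x t) (y t)| <= 1 + lipC p * B.
  move=> /yB h; apply: le_trans (Phi_bound hp1 hp2 _ _) _.
  by rewrite lerD2l ler_wpM2l// ltW.
have ly := lip_dv (fun t (_ : 0 <= t) => (hs t).2) zb.
have ty : tends y 0.
  apply: (barbalat_dv (T := 0) (L := 1 + lipC p * B) _ (fun t _ => (hs t).1) ly hl).
  by nneg.
have ts : tends (fun t => sin (x t)) 0.
  apply: tends_abs => e e0; have [T hT] := ty e e0; exists T => t /hT; rewrite !subr0 normr_id.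
  apply: le_lt_trans; have := Vp t; rewrite V_gt0 ?(N_gt0 nt)// => h.
  rewrite -ler_sqr ?nnegrE// !real_normK ?num_real//; apply: le_trans (ltW h) _.
  by rewrite ler_piMl ?sqr_ge0//; plra.
have ts' : tends (fun t => sin (x t)) (sin (- l)).
  move=> e e0; have [T hT] := hl e e0; exists T => t /hT; apply: le_lt_trans; exact: sin_lip.
have [k ek] := sin_eq0 _ (tends_unique ts' ts).
by exists k; rewrite -ek.
Qed.

(** Were V <= 0 at arbitrarily early times, V would be negative always and sin x never 0; but x,
    coming from -oo, meets the largest multiple of pi below x 0. Once V > 0, y has no zero, and y <
    0 would keep x from tending to -oo. *)
Lemma from_ninfty {f : R -> R} : solutions_from_ninfty p f ->
  exists x y, [/\ sol p x y, nontrivial x y, forall r, 0 < r -> f r = x (ln r),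
    forall A, exists T, forall t, t <= T -> x t <= A
    & exists a, forall t, t <= a -> 0 < V p (x t) (y t) /\ 0 < y t].
Proof.
move=> [hf hlim]; have hs := sol_of_global hp1 hp2 hf.
set x := (fun t => f (expR t)) in hs; set y := (fun t => expR t * _) in hs.
have xm A : exists T, forall t, t <= T -> x t <= A.
  move/cvgrNyPle: hlim => /(_ A)/at_right0P[T hT]; exists (- T) => t tT.
  by rewrite /x -[t]opprK; apply: hT; rewrite lerNr.
have nt : nontrivial x y.
  apply: (sol_const_nt hp1 hp2 hs) => -[c hc].
  by have [T /(_ T (lexx T))] := xm (c - 1); rewrite hc; lra.
exists x, y; split=> //; first by move=> r r0; rewrite /x lnK ?posrE.
have [a ha] : exists a, forall t, t <= a -> 0 < V p (x t) (y t).
  apply: contrapT => /forallNP h.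
  have Vle t : V p (x t) (y t) <= 0.
    have /existsNP[s /not_implyP[st /negP]] := h t; rewrite -leNgt.
    by apply: le_trans; exact: (V_nonincr hp1 hp2 hs nt).
  have Vlt t : V p (x t) (y t) < 0.
    by apply: lt_le_trans (Vle (t - 1)); apply: (V_decr hp1 hp2 hs nt); rewrite ltrBlDr ltrDl.
  have [n [u [/andP[u0 up] xu]]] := pi_decomp (x 0).
  have [T hT] := xm (n%:~R * pi).
  pose s := Num.min T 0; have s0 : s <= 0 by rewrite ge_min lexx orbT.
  have [||c _ xc] := ivt (n%:~R * pi) s0 (f := x).
  - by move=> w _; exact: (cont_x hs).
  - have h1 : x s <= n%:~R * pi by apply: hT; rewrite ge_min lexx.
    by rewrite h1 xu lerDr u0.
  have : sin (x c) ^+ 2 == 0 by rewrite xc -[_ * pi]add0r sin_int sin0 expr0n.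
  by rewrite sqrf_eq0 (negbTE (sin_neq0 hp1 nt c (Vlt c))).
exists a => t ta; split; first exact: ha.
have yn w : w <= a -> y w != 0.
  by move=> /ha; apply: contraTneq => /(V_crit hp1 hp2 nt)/ltW; rewrite leNgt.
have sg w : w <= a -> (0 < y w) = (0 < y a).
  move=> wa; apply: (const_sign wa) => v; first by move=> _; exact: (cont_y hs).
  by case/andP => _; exact: yn.
rewrite sg//; rewrite ltNge; apply/negP => ya.
have [T hT] := xm (x a - 1).
pose s := Num.min T a; have sa : s <= a by rewrite ge_min lexx orbT.
have : x a <= x s.
  apply: (nonincr_dv sa (f := x) (df := y)) => w; first by move=> _; exact: (hs w).1.
  by case/andP => _ /ltW wa; rewrite leNgt sg// -leNgt.
have : x s <= x a - 1 by apply: hT; rewrite ge_min lexx.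
lra.
Qed.

Lemma ninfty_classification {f : R -> R} : solutions_from_ninfty p f ->
  (increasing_on `]0, +oo[%classic f /\
   (f r @[r --> +oo] --> +oo \/ exists k : int, f r @[r --> +oo] --> k%:~R * pi)) \/
  (exists (k : int) (s : nat -> R),
     [/\ increasing_on `]0, s 0%N]%classic f,
         oscillates f (odd_half_pi R k) (max_above f (odd_half_pi R k))
           (min_below f (odd_half_pi R k)) s &
         all_critical f s]).
Proof.
move=> hf; have [x [y [hs nt fE xm [a ha]]]] := from_ninfty hf.
have [Vp|/existsNP[t1 /negP]] := pselect (forall t, 0 < V p (x t) (y t)).
  left; have yp t : 0 < y t.
    have [ta|at0] := leP t a; first exact: (ha t ta).2.
    rewrite -(const_sign (ltW at0) (f := y)); first exact: (ha a (lexx a)).2.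
      by move=> w _; exact: (cont_y hs).
    by move=> w _; apply: contraTneq (Vp w) => /(V_crit hp1 hp2 nt)/ltW; rewrite leNgt.
  have incr s t : s < t -> x s < x t.
    by move=> st; apply: (incr_dv st (f := x) (df := y)) => w _; [exact: (hs w).1|exact: yp].
  split.
    move=> r r'; rewrite /= !in_itv/= !andbT => r0 r'0 rr'.
    by rewrite !fE//; apply: incr; rewrite ltr_ln ?posrE.
  case: (monotone_limit hs nt Vp yp) => [ub|[k hk]]; last first.
    by right; exists k; exact: tends_ln fE hk.
  left; apply/cvgryPge => A; have [t At] := ub A.
  near=> r; have r1 : expR t <= r by near: r; apply: nbhs_pinfty_ge; exact: num_real.
  have r0 : 0 < r by apply: lt_le_trans r1; exact: expR_gt0.
  rewrite fE//; apply: le_trans (ltW At) _.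
  have : t <= ln r by rewrite -ler_expR lnK ?posrE.
  by rewrite le_eqVlt => /orP[/eqP->//|/incr/ltW].
rewrite -leNgt => V1; right.
(* Any later time serves: V <= 0 at t1 has become V < 0. *)
pose T := t1 + 1.
have VT : V p (x T) (y T) < 0.
  by apply: lt_le_trans V1; apply: (V_decr hp1 hp2 hs nt); rewrite ltrDl.
have [k [u [/andP[u0 up] xu]]] := pi_decomp (x T).
have sT := sin_neq0 hp1 nt T VT.
have un0 : 0 < u.
  rewrite lt_neqAle u0 andbT; apply: contraNneq sT => uz.
  by have := sin_int k u; rewrite -xu -uz sin0 expr0n => /eqP; rewrite sqrf_eq0.
have hs' := sol_int (- k) hs; have nt' := nt_int (- k) nt.
have eT : x T + (- k)%:~R * pi = u by rewrite xu mulrNz mulNr addrK.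
have fE' r : 0 < r -> f r - k%:~R * pi = x (ln r) + (- k)%:~R * pi.
  by move=> r0; rewrite fE// mulrNz mulNr.
have [|||s [inc osc crit]] := oscillates_of_sol hp1 hp2 hs' nt' fE' T a.
- by rewrite V_int.
- by rewrite eT un0.
- by move=> t /ha[].
have df r : 0 < r -> dv f r (y (ln r) / r) by exact: (dv_global hs fE).
exists k, s; split.
- by move=> r r' hr hr' rr'; have := inc r r' hr hr' rr'; rewrite ltrD2r.
- rewrite (_ : odd_half_pi R k = pi / 2 + k%:~R * pi); last first.
    by rewrite /odd_half_pi intrD intrM; field.
  by apply: oscillates_translate => // r /df/dv_derivable.
- move=> r r0 fr; apply: crit => //; rewrite -fr; apply: dv_derive1.
  by have := derivable_dv (dv_derivable (df r r0)) => ?; dstep; ring.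
Unshelve. all: by end_near. Qed.

(** The solution through (0, 1), where V = p - 1 > 0, to which [V_pos_backwards] applies. *)
Lemma ninfty_exists : exists x y, [/\ sol p x y,
  forall A, exists T, forall t, t <= T -> x t <= A & forall s t, s < t -> t <= 0 -> x s < x t].
Proof.
have [x [y [hs x0 y0]]] := sol_exists hp1 hp2 0 1.
have nt : nontrivial x y.
  by apply: (nontrivial1 hp1 hp2 0 hs); rewrite y0 => -[/eqP]; rewrite oner_eq0.
have V0 : 0 < V p (x 0) (y 0).
  by rewrite V_gt0 ?(N_gt0 nt)// x0 y0 sin0 expr0n expr1n mulr1 mulr0n subr_gt0.
have [|d d0 hd] := V_pos_backwards hp1 hp2 0 hs nt V0; first by rewrite y0.
exists x, y; split=> //.
  move=> A; exists (Num.min 0 (A / d)) => t; rewrite le_min => /andP[t0 tA].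
  have [_] := hd t t0; rewrite x0 sub0r add0r mulrN opprK => /le_trans; apply.
  by rewrite mulrC -ler_pdivlMr.
move=> s t st t0; apply: (incr_dv st (f := x) (df := y)) => w; first by move=> _; exact: (hs w).1.
case/andP => _ wt; have [h _] := hd w (le_trans (ltW wt) t0); exact: lt_le_trans h.
Qed.

Lemma infinitely_many_family {S : set (R -> R)} (G : nat -> R -> R) :
  (forall n, S (G n)) -> (forall n m, (n < m)%N -> exists2 r, 0 < r & G n r != G m r) ->
  infinitely_many_pos S.
Proof.
move=> hS hG fin; apply: infinite_nat.
pose F n := G n \_ `]0, +oo[%classic.
have -> : [set: nat] = F @^-1` [set f \_ `]0, +oo[%classic | f in S].
  by apply/esym/seteqP; split=> // n _; exists (G n).
apply: finite_preimage fin => n m _ _ e.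
have neq a b : (a < b)%N -> F a = F b -> False.
  move=> /hG[r r0 /eqP h] /(congr1 (fun g => g r)); rewrite /F !patchE mem_set//=.
  by rewrite in_itv/= r0.
by case: (ltngtP n m) => // h; [case: (neq n m h)|case: (neq m n h)].
Qed.

Lemma ninfty_infinite : infinitely_many_pos (solutions_from_ninfty p) /\
                        infinitely_many_pos (solutions_from_pinfty p).
Proof.
have [x [y [hs xm incr]]] := ninfty_exists.
pose G (n : nat) (r : R) := x (ln r + ln n.+1%:R).
have diff n m : (n < m)%N -> exists2 r, 0 < r & G n r != G m r.
  (* At this radius G m takes the value x 0 and G n an earlier one, in the range t <= 0 where x is
     strictly increasing. *)
  move=> nm; exists (m.+1%:R^-1); first by rewrite invr_gt0.
  rewrite lt_eqF// /G lnV ?posrE// addNr; apply: incr => //.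
  by rewrite addrC subr_lt0 ltr_ln ?posrE// ltr_nat.
have glob n : global_solution p (G n).
  by apply: (global_of_sol hp1 hp2 (sol_shift (ln n.+1%:R) hs)).
have globN n : global_solution p (fun r => - G n r).
  by apply: (global_of_sol hp1 hp2 (solN (sol_shift (ln n.+1%:R) hs))).
have lim n A : \forall r \near 0^'+, G n r <= A.
  have [T hT] := xm A; apply/at_right0P; exists (ln n.+1%:R - T) => t tT.
  by rewrite /G expRK; apply: hT; lra.
split.
  apply: (infinitely_many_family G) => // n; split=> //.
  by apply/cvgrNyPle => A; exact: lim.
apply: (infinitely_many_family (fun n r => - G n r)) => [n|n m /diff[r r0 h]].
  split=> //; apply/cvgryPge => A; apply: filterS (lim n (- A)) => r.
  by rewrite lerNr.
by exists r => //; rewrite eqr_opp.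
Qed.

Lemma pinfty_classification {f : R -> R} : solutions_from_pinfty p f ->
  (decreasing_on `]0, +oo[%classic f /\
   (f r @[r --> +oo] --> -oo \/ exists k : int, f r @[r --> +oo] --> k%:~R * pi)) \/
  (exists (k : int) (s : nat -> R),
     [/\ decreasing_on `]0, s 0%N]%classic f,
         oscillates f (odd_half_pi R k) (min_below f (odd_half_pi R k))
           (max_above f (odd_half_pi R k)) s &
         all_critical f s]).
Proof.
move=> [hf hlim]; pose g r := - f r.
have hs := sol_of_global hp1 hp2 hf.
have fE r : 0 < r -> f r = f (expR (ln r)) by move=> r0; rewrite lnK ?posrE.
have df r : 0 < r -> derivable f r 1 by move=> /(dv_global hs fE)/dv_derivable.
have dg r : 0 < r -> derive1 g r = - derive1 f r.
  by move=> r0; apply: dv_derive1; apply: dvN; exact/derivable_dv/df.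
have hg : solutions_from_ninfty p g.
  split; first by apply: (global_of_sol hp1 hp2 (solN hs)) => r r0; rewrite /g {1}fE.
  apply/cvgrNyPle => A; move/cvgryPge: hlim => /(_ (- A)); apply: filterS => r.
  by rewrite /g lerNl.
case: (ninfty_classification hg) => [[inc lim]|[k [s [inc [h1 h2 h3 h4 [h5 h6]] crit]]]].
  left; split; first by move=> r r' hr hr' rr'; have := inc r r' hr hr' rr'; rewrite ltrN2.
  case: lim => [lim|[k hk]].
    left; apply/cvgrNyPle => A; move/cvgryPge: lim => /(_ (- A)); apply: filterS => r.
    by rewrite /g lerN2.
  right; exists (- k); rewrite mulrNz mulNr.
  rewrite (_ : f = (fun r => - g r)); first exact: cvgN hk.
  by apply/funext => r; rewrite /g opprK.
(* The change of sign maps the strip between k pi and (k + 1) pi to the one of index -k - 1 and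
   exchanges maxima and minima. *)
right; exists (- k - 1), s.
have kE : odd_half_pi R (- k - 1) = - odd_half_pi R k.
  by rewrite /odd_half_pi !(intrD, intrM, mulrNz); field.
rewrite kE.
have nE u : `|f u - - odd_half_pi R k| = `|g u - odd_half_pi R k|.
  by rewrite -normrN /g; congr `|_|; ring.
split.
- by move=> r r' hr hr' rr'; have := inc r r' hr hr' rr'; rewrite ltrN2.
- split=> //.
  + by move=> n; have [s0 _] := h1 n; apply/eqP; rewrite -oppr_eq0 -dg// h3.
  + move=> n; have [[a1 a2] [b1 b2]] := h4 n; split; split.
    * by apply: filterS a1 => u; rewrite /g lerN2.
    * by move: a2; rewrite /g => /andP[? ?]; apply/andP; split; lra.
    * by apply: filterS b1 => u; rewrite /g lerN2.
    * by move: b2; rewrite /g => /andP[? ?]; apply/andP; split; lra.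
  + by split=> [|n]; [case: h5 => n0 n00 hn0; exists n0 => // n nn; rewrite !nE hn0|rewrite !nE].
- by move=> r r0 fr; apply: crit => //; rewrite dg// fr oppr0.
Unshelve. all: by end_near. Qed.

End GlobalSolutions.

(** * Calibration of the energy *)

Section LocalComparison.
Context {R : realType}.

(** A supremum argument replaces differentiation: for fixed e, the set of x with F a <= F x contains
    its supremum c, from which it could be extended if c < b. Only intervals with x0 as an end point
    enter the hypothesis. At the end e tends to 0. *)
Lemma cousin {K E : R -> R} {a b : R} : a <= b ->
  (forall x0 e, a <= x0 -> x0 <= b -> 0 < e -> exists2 d, 0 < d &
    forall y x, a <= y -> y <= x -> x <= b -> y = x0 \/ x = x0 -> x - y < d ->
      K x - K y <= (1 + e) * (E x - E y) + e * (x - y)) ->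
  K b - K a <= E b - E a.
Proof.
move=> ab h.
have key e : 0 < e -> K b - K a <= (1 + e) * (E b - E a) + e * (b - a).
  move=> e0; pose F x := (1 + e) * E x + e * x - K x.
  suff : F a <= F b by rewrite /F; lra.
  pose S := [set x | [/\ a <= x, x <= b & F a <= F x]].
  have hS : has_sup S by split; [exists a|exists b => x []].
  pose c := sup S.
  have ub x : S x -> x <= c by move=> Sx; apply: ub_le_sup => //; case: hS.
  have ac : a <= c by apply: ub.
  have cb : c <= b by apply: sup_le_ub; [exists a|move=> x []].
  have [d d0 hd] := h c e ac cb e0.
  have Fc : F a <= F c.
    have [s [as0 sb Fs] cs] := sup_adherent d0 hS.
    have sc : s <= c by apply: ub.
    have := hd s c as0 sc cb (or_intror erefl); rewrite -/c in cs.
    move=> /(_ ltac:(lra)); move: Fs; rewrite /F; lra.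
  have [cb'|] := ltP c b; last by move=> bc; rewrite (_ : b = c)//; apply/eqP; rewrite eq_le bc.
  exfalso; pose x := Num.min b (c + d / 2).
  have cx : c < x by rewrite lt_min cb' ltrDl divr_gt0.
  have xb : x <= b by rewrite ge_min lexx.
  have xd : x <= c + d / 2 by rewrite ge_min lexx orbT.
  have := hd c x ac (ltW cx) xb (or_introl erefl) ltac:(lra) => hx.
  have : x <= c.
    apply: ub; split=> //; first exact: le_trans (ltW cx).
    by move: Fc hx; rewrite /F; lra.
  by rewrite leNgt cx.
rewrite leNgt; apply/negP => lt.
pose M := E b - E a + (b - a).
pose g := (K b - K a) - (E b - E a).
have g0 : 0 < g by rewrite /g subr_gt0.
pose e := g / (2 * (`|M| + 1)).
have M1 : 0 < `|M| + 1 by rewrite ltr_wpDl.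
have e0 : 0 < e by rewrite divr_gt0// mulr_gt0.
have := key e e0.
have : e * M <= g / 2.
  apply: (le_trans (y := e * (`|M| + 1))).
    by rewrite ler_pM2l//; apply: le_trans (ler_norm _) _; rewrite lerDl.
  by rewrite /e le_eqVlt; apply/orP; left; apply/eqP; field; rewrite gt_eqF.
rewrite /M /g in g0 *; lra.
Qed.

(* A0 and B0 are the partial derivatives of the calibrating function. *)
Definition calibrated (w E K : R -> R) (x0 A0 B0 : R) : Prop :=
  (forall e, 0 < e -> exists2 d, 0 < d & forall y x, x0 - d < y -> y < x -> x < x0 + d ->
     A0 * (x - y) + B0 * (w x - w y) <= (1 + e) * (E x - E y)) /\
  (forall e, 0 < e -> exists2 d, 0 < d & forall x, `|x - x0| < d ->
     `|K x - K x0 - A0 * (x - x0) - B0 * (w x - w x0)| <= e * (`|x - x0| + `|w x - w x0|)).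

Lemma calibrated_side {w E K : R -> R} {x0 A0 B0 : R} : calibrated w E K x0 A0 B0 ->
  forall e, 0 < e -> exists2 d, 0 < d & forall y x, y < x -> y = x0 \/ x = x0 -> x - y < d ->
    K x - K y <= A0 * (x - y) + B0 * (w x - w y) + e * ((x - y) + `|w x - w y|).
Proof.
move=> [_ h] e e0; have [d d0 hd] := h e e0; exists d => // y x yx yx0 xd.
case: yx0 => ?; subst x0.
  have := hd x; rewrite gtr0_norm ?subr_gt0// => /(_ xd).
  by rewrite ler_norml => /andP[_]; clear; lra.
have := hd y; rewrite distrC gtr0_norm ?subr_gt0// => /(_ xd).
by rewrite [`|w y - w x|]distrC ler_norml => /andP[+ _]; clear; lra.
Qed.

Lemma near_side {y x x0 d : R} : y < x -> y = x0 \/ x = x0 -> x - y < d -> x0 - d < y /\ x < x0 + d.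
Proof. by move=> yx [] <-; split; lra. Qed.

(** The errors of the linearization are proportional to x - y and to |w x - w y|; coercivity bounds
    the latter by the increment of E plus x - y, so that everything fits in the error allowed by
    [cousin]. *)
Lemma calibrated_le {w E K : R -> R} {a b : R} : 0 < a -> a <= b ->
  (forall x0, a <= x0 -> x0 <= b -> exists A0 B0, calibrated w E K x0 A0 B0) ->
  (forall y x, a <= y -> y < x -> x <= b -> a * `|w x - w y| <= (E x - E y) + (x - y)) ->
  (forall y x, a <= y -> y <= x -> x <= b -> E y <= E x) ->
  K b - K a <= E b - E a.
Proof.
move=> a0 ab hc co Em; apply: (cousin ab) => x0 e ax0 x0b e0.
have [A0 [B0 cal]] := hc x0 ax0 x0b.
pose e' := Num.min (e / 2) (e * a / (2 * (a + 1))).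
have a1 : 0 < a + 1 by lra.
have e'0 : 0 < e' by rewrite lt_min !divr_gt0// !mulr_gt0.
have e'1 : e' <= e / 2 by rewrite ge_min lexx.
have e'2 : e' * (a + 1) <= e * a / 2.
  have : e' <= e * a / (2 * (a + 1)) by rewrite ge_min lexx orbT.
  rewrite -(ler_pM2r a1) => /le_trans; apply.
  by rewrite le_eqVlt; apply/orP; left; apply/eqP; field; rewrite gt_eqF.
have [d1 d10 hd1] := cal.1 e' e'0; have [d2 d20 hd2] := calibrated_side cal _ e'0.
exists (Num.min d1 d2) => [|y x ay yx xb yx0]; first by rewrite lt_min d10.
rewrite lt_min => /andP[xd1 xd2].
move: yx; rewrite le_eqVlt => /orP[/eqP<-|yx]; first by rewrite !subrr !mulr0 addr0.
have dE : 0 <= E x - E y by rewrite subr_ge0 Em// ltW.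
have [xy1 xy2] := near_side yx yx0 xd1.
have main := hd1 y x xy1 yx xy2; have Kd := hd2 y x yx yx0 xd2.
have cw := co y x ay yx xb.
have n0 := normr_ge0 (w x - w y); have D0 : 0 < x - y by rewrite subr_gt0.
clear - main Kd cw n0 D0 dE e'0 e'1 e'2 a0 e0.
move: (E x - E y) (K x - K y) (w x - w y) (x - y) main Kd cw n0 D0 dE => dE dK dw D main Kd cw n0 D0 dE0.
have h3 : e' * `|dw| <= (e / 2) * (dE + D).
  rewrite -(ler_pM2l a0); apply: (le_trans (y := e' * (dE + D))).
    by rewrite mulrCA ler_pM2l.
  rewrite mulrA ler_wpM2r ?addr_ge0// ?(ltW D0)//.
  have : 0 <= e' * a by rewrite mulr_ge0// ltW.
  by clear - e'2; lra.
have h4 : e' * dE <= e / 2 * dE by rewrite ler_wpM2r.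
have h5 : e' * D <= e / 2 * D by rewrite ler_wpM2r// ltW.
lra.
Qed.

End LocalComparison.

(** * Convexity in the slope and affine minorants of the density *)

Section Tangents.
Context {R : realType} {p : R} (hp1 : 1 < p) (hp2 : p < 2).
Local Ltac plra := move: (hp1) (hp2) => ? ?; lra.

Definition dens (r h v : R) : R := r * (v ^+ 2 + sin h ^+ 2 / r ^+ 2) `^ (p / 2).

Section Fixed.
Context {m a : R} (m0 : 0 < m) (a0 : 0 < a).

(** The density as a function of the slope v, with r frozen at m and sin h / r at a. *)
Definition Lag (v : R) : R := m * (v ^+ 2 + a ^+ 2) `^ (p / 2).
Definition dLag (v : R) : R := m * (p * v * (v ^+ 2 + a ^+ 2) `^ (p / 2 - 1)).

Let N0 v : 0 < v ^+ 2 + a ^+ 2.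
Proof. by rewrite ltr_wpDl ?sqr_ge0// exprn_gt0. Qed.

Lemma dv_Lag v : dv Lag v (dLag v).
Proof.
by have ? := N0 v; rewrite /Lag /dLag; dstep; field.
Qed.

Lemma dLag_incr v1 v2 : v1 < v2 -> dLag v1 < dLag v2.
Proof.
move=> v12; apply: (incr_dv v12 (f := dLag) (df := fun v =>
  m * (p * ((v ^+ 2 + a ^+ 2) `^ (p / 2 - 1 - 1) * ((p - 1) * v ^+ 2 + a ^+ 2))))).
  move=> v _; have ? := N0 v; rewrite /dLag; dstep.
  have -> : (v ^+ 2 + a ^+ 2) `^ (p / 2 - 1 - 1) = (v ^+ 2 + a ^+ 2) `^ (p / 2 - 1) / (v ^+ 2 + a ^+ 2).
    by rewrite (@powRB _ _ (p / 2 - 1)) ?powRr1 ?(ltW (N0 _))// lt0r_neq0// implybT.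
  set Q := _ `^ _; rewrite /=.
  by field; rewrite lt0r_neq0.
move=> v _; rewrite mulr_gt0// mulr_gt0//; first by plra.
by rewrite mulr_gt0 ?powR_gt0 ?N0// ltr_wpDl ?exprn_gt0//; nneg; plra.
Qed.

Lemma tangent_lt v s : v != s -> Lag s + dLag s * (v - s) < Lag v.
Proof.
move=> vs; have dL u : v <= u <= s -> dv Lag u (dLag u) by move=> _; exact: dv_Lag.
case: (ltgtP v s) vs => // h _.
  have [c /andP[vc cs] e] := mvt h (fun u _ => dv_Lag u).
  have := dLag_incr _ _ cs; rewrite -(ltr_pM2r (_ : 0 < s - v)) ?subr_gt0//; lra.
have [c /andP[sc cv] e] := mvt h (fun u _ => dv_Lag u).
have := dLag_incr _ _ sc; rewrite -(ltr_pM2r (_ : 0 < v - s)) ?subr_gt0//; lra.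
Qed.

Lemma tangent_le v s : Lag s + dLag s * (v - s) <= Lag v.
Proof.
by have [->|/tangent_lt/ltW//] := eqVneq v s; rewrite subrr mulr0 addr0.
Qed.
End Fixed.

Lemma dens_coercive (r h v : R) : 0 < r -> r * (`|v| - 1) <= dens r h v.
Proof.
move=> r0; rewrite /dens ler_pM2l//.
have sr : 0 <= sin h ^+ 2 / r ^+ 2 by rewrite divr_ge0 ?sqr_ge0.
have [v1|v1] := leP `|v| 1; first by apply: le_trans (powR_ge0 _ _); lra.
have v2 : 1 <= v ^+ 2.
  by rewrite -real_normK ?num_real// expr2 -[leLHS]mulr1; apply: ler_pM => //; exact: ltW.
apply: (le_trans (y := (v ^+ 2) `^ (p / 2))); last first.
  by apply: ge0_ler_powR; rewrite ?nnegrE ?addr_ge0 ?sqr_ge0//; [plra|rewrite lerDl].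
apply: (le_trans (y := (v ^+ 2) `^ 2^-1)); last by apply: ler_powR => //; plra.
by rewrite powR12_sqrt ?sqr_ge0// sqrtr_sqr; lra.
Qed.

(* The property of w (folded or not) that survives integration of the energy density. *)
Definition affine_minorant (w E : R -> R) : Prop :=
  forall a b A B, 0 < a -> a < b -> b < 1 ->
    (forall r v, a <= r -> r <= b -> A + B * v <= dens r (w r) v) ->
    A * (b - a) + B * (w b - w a) <= E b - E a.

Section Minorant.
Context {w E : R -> R} (hP : affine_minorant w E).

Lemma minorant_mono y x : 0 < y -> y <= x -> x < 1 -> E y <= E x.
Proof.
move=> y0; rewrite le_eqVlt => /orP[/eqP->//|yx] x1.
have := hP y x 0 0 y0 yx x1; rewrite !mul0r addr0 subr_ge0; apply => r v yr _.
rewrite mul0r addr0 /dens mulr_ge0 ?powR_ge0//; apply: le_trans yr; exact: ltW.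
Qed.

(** The affine functions -1 + a v and -1 - a v lie below the density by [dens_coercive], as a <= r
    <= 1. *)
Lemma minorant_coercive a y x : 0 < a -> a <= y -> y < x -> x < 1 ->
  a * `|w x - w y| <= (E x - E y) + (x - y).
Proof.
move=> a0 ay yx x1; have y0 : 0 < y by apply: lt_le_trans ay.
have aux (s : R) : `|s| = 1 -> a * (s * (w x - w y)) <= (E x - E y) + (x - y).
  move=> s1; have := hP y x (-1) (a * s) y0 yx x1.
  suff h : forall r v, y <= r -> r <= x -> -1 + a * s * v <= dens r (w r) v by move=> /(_ h); lra.
  move=> r v yr rx; have r0 : 0 < r by apply: lt_le_trans yr.
  apply: le_trans (dens_coercive r (w r) v r0).
  have : a * (s * v) <= r * `|v|.
    apply: le_trans (_ : a * `|v| <= _); last by rewrite ler_wpM2r// (le_trans ay).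
    by rewrite ler_pM2l//; apply: le_trans (ler_norm _) _; rewrite normrM s1 mul1r.
  have : r <= 1 by apply: le_trans rx (ltW x1).
  by lra.
have [h|h] := ger0P (w x - w y).
  by have := aux 1 (normr1 _); rewrite mul1r.
by have := aux (-1) (normrN1 _); rewrite mulN1r.
Qed.

(* Freezing r and w at x0 turns the density into a convex function of v alone, up to a factor
   that tends to 1. *)
Lemma minorant_local x0 s e : 0 < x0 -> x0 < 1 -> {for x0, continuous w} -> 0 < sin (w x0) -> 0 < e ->
  exists2 d, 0 < d & forall y x, x0 - d < y -> y < x -> x < x0 + d ->
    (Lag (m := x0) (a := sin (w x0) / x0) s - dLag (m := x0) (a := sin (w x0) / x0) s * s) * (x - y)
     + dLag (m := x0) (a := sin (w x0) / x0) s * (w x - w y) <= (1 + e) * (E x - E y).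
Proof.
move=> x00 x01 cw s0 e0.
set a := sin (w x0) / x0; have a0 : 0 < a by rewrite divr_gt0.
(* Freezing costs two factors rho, one for r >= rho x0 and one for the power; and rho^2 (1 + e) >= 1
   because (1 + e')^2 <= 1 + 3 e' <= 1 + e when e' <= 1. *)
pose e' := Num.min 1 e / 3.
have e'1 : Num.min 1 e <= 1 by rewrite ge_min lexx.
have e'2 : Num.min 1 e <= e by rewrite ge_min lexx orbT.
have e'0 : 0 < e' by rewrite divr_gt0// lt_min ltr01.
pose rho := (1 + e')^-1.
have r1 : 0 < 1 + e' by lra.
have rho0 : 0 < rho by rewrite invr_gt0.
have rhoL : rho < 1 by rewrite invf_lt1//; lra.
have rho2 : 1 <= rho * rho * (1 + e).
  rewrite [leLHS](_ : _ = rho * rho * (1 + e') ^+ 2); last by rewrite /rho; field; rewrite gt_eqF.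
  rewrite ler_pM2l ?mulr_gt0//.
  have e'3 : 3 * e' <= e by rewrite /e' mulrCA divff// mulr1.
  have e'4 : e' <= 1 by rewrite /e'; lra.
  have gen z : 0 < z -> z <= 1 -> 3 * z <= e -> (1 + z) ^+ 2 <= 1 + e.
    move=> z0 z1 z3; have zz : z * z <= z * 1 by rewrite ler_pM2l.
    by rewrite expr2; lra.
  exact: gen.
pose f r := sin (w r) ^+ 2 / r ^+ 2.
have cf : {for x0, continuous f}.
  apply: cvgM.
    apply: (continuous_comp (f := fun r => sin (w r)) (g := fun z : R => z ^+ 2)).
      by apply: (continuous_comp (f := w)) => //; exact: continuous_sin.
    exact: exprn_continuous.
  by apply: cvgV; [rewrite expf_neq0// gt_eqF|exact: exprn_continuous].
have fx0 : f x0 = a ^+ 2 by rewrite /f /a expr_div_n.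
have [|d1 d10 h1] := near_pball (near_gt (rho * a ^+ 2) cf _).
  by rewrite fx0 gtr_pMl// exprn_gt0.
pose d := Num.min d1 (Num.min (x0 * (1 - rho)) (1 - x0)).
have d0 : 0 < d by rewrite !lt_min d10 mulr_gt0 ?subr_gt0.
have dd1 : d <= d1 by rewrite ge_min lexx.
have dd2 : d <= x0 * (1 - rho) by rewrite !ge_min lexx orbT.
have dd3 : d <= 1 - x0 by rewrite !ge_min lexx !orbT.
exists d => // y x xy yx xd.
have rx0 : 0 < rho * x0 by rewrite mulr_gt0.
have y0 : 0 < y by lra.
have x1 : x < 1 by lra.
have low r v : y <= r -> r <= x -> rho * rho * Lag (m := x0) (a := a) v <= dens r (w r) v.
  move=> yr rx; have r0 : 0 < r by apply: lt_le_trans yr.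
  have fr : rho * a ^+ 2 < f r by apply: h1; rewrite ltr_norml; apply/andP; split; lra.
  have Na : 0 < v ^+ 2 + a ^+ 2 by rewrite ltr_wpDl ?sqr_ge0// exprn_gt0.
  rewrite /dens -/(f r) /Lag.
  rewrite (_ : _ * _ = (rho * x0) * (rho * (v ^+ 2 + a ^+ 2) `^ (p / 2))); last by ring.
  apply: ler_pM; rewrite ?mulr_ge0 ?powR_ge0 ?(ltW rho0) ?(ltW x00)//; first by lra.
  apply: (le_trans (y := (rho * (v ^+ 2 + a ^+ 2)) `^ (p / 2))).
    rewrite powRM ?(ltW rho0) ?(ltW Na)// ler_wpM2r ?powR_ge0//.
    rewrite -[leLHS]powRr1 ?(ltW rho0)//; apply: ger_powR; last by plra.
    by rewrite rho0 ltW.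
  apply: ge0_ler_powR; rewrite ?nnegrE; first by plra.
  - by rewrite mulr_ge0 ?(ltW rho0) ?(ltW Na).
  - by rewrite addr_ge0 ?sqr_ge0// (le_trans _ (ltW fr))// mulr_ge0 ?sqr_ge0 ?(ltW rho0).
  - rewrite mulrDr; apply: lerD; last exact: ltW fr.
    by apply: ler_piMl; [exact: sqr_ge0|exact: ltW].
set L := Lag (m := x0) (a := a) s; set D := dLag (m := x0) (a := a) s.
have := hP y x (rho * rho * (L - D * s)) (rho * rho * D) y0 yx x1.
have tl r v : y <= r -> r <= x -> rho * rho * (L - D * s) + rho * rho * D * v <= dens r (w r) v.
  move=> yr rx; apply: le_trans (low r v yr rx).
  rewrite [leLHS](_ : _ = rho * rho * (L + D * (v - s))); last by ring.
  by rewrite ler_pM2l ?mulr_gt0//; exact: tangent_le.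
move=> /(_ tl) h.
set T := (L - D * s) * (x - y) + D * (w x - w y).
have hT : rho * rho * T <= E x - E y by rewrite /T; lra.
have E0 : 0 <= E x - E y by rewrite subr_ge0 minorant_mono// ltW.
(* The factor 1 + e compensates rho^2 only for T > 0; for T <= 0 the monotonicity of E suffices. *)
have [T0|T0] := leP T 0; first by apply: le_trans T0 _; rewrite mulr_ge0// addr_ge0// ltW.
apply: (le_trans (y := rho * rho * (1 + e) * T)); first by rewrite ler_peMl// ltW.
rewrite mulrAC [leRHS]mulrC ler_wpM2r//; lra.
Qed.

End Minorant.
End Tangents.

Arguments dens {R} p r h v.
Arguments affine_minorant {R} p w E.
Arguments Lag {R} p m a v.
Arguments dLag {R} p m a v.

(** The algebra of [slope_side]: two tangents of a convex function, taken at s0 and at s1, are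
    evaluated at a slope S beyond s1. They differ by dl + m q, with q the distance from s1 to S,
    which outweighs the errors when e is small relative to dl and m. *)
Lemma slope_contradiction {R : realFieldType} (A0 B0 A1 B1 S s1 e m dl q : R) : 0 < e -> e <= 1 ->
  0 < dl -> 0 < m -> 0 <= q ->
  e * (`|A0| + `|B0| + 2) * (1 + `|s1|) <= dl / 2 -> e * (`|A0| + `|B0| + 2) <= m / 2 ->
  A1 + B1 * S - (A0 + B0 * S) = dl + m * q -> `|S| <= `|s1| + q ->
  (1 + e) * (A0 + B0 * S + e * (1 + `|S|)) < A1 + B1 * S.
Proof.
move=> e0 e1 dl0 m0 q0; set C := `|A0| + _ + _ => e2 e3 DS SS.
have S0 := normr_ge0 S; have b0 := normr_ge0 B0.
have C0 : 0 <= e * C by rewrite mulr_ge0 ?(ltW e0)// !addr_ge0.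
have b1 : A0 + B0 * S <= (`|A0| + `|B0|) * (1 + `|S|).
  have t1 := ler_norm A0; have t2 : B0 * S <= `|B0| * `|S| by rewrite -normrM; exact: ler_norm.
  have t3 : 0 <= `|A0| * `|S| by rewrite mulr_ge0.
  by clear - t1 t2 t3 b0; lra.
have b2 : (1 + e) * (1 + `|S|) <= 2 * (1 + `|S|).
  by rewrite ler_wpM2r ?addr_ge0//; clear - e1; lra.
have b3 : e * (A0 + B0 * S + (1 + e) * (1 + `|S|)) <= e * (C * (1 + `|S|)).
  by rewrite ler_pM2l// /C; clear - b1 b2; lra.
have b4 : e * C * (1 + `|S|) <= e * C * (1 + `|s1|) + e * C * q.
  by rewrite -mulrDr ler_wpM2l// -addrA lerD2l.
have b5 : e * C * q <= m / 2 * q by rewrite ler_wpM2r.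
have b6 : 0 <= m * q by rewrite mulr_ge0// ltW.
by clear - b3 b4 b5 b6 e2 DS dl0; lra.
Qed.

(** * The calibrating function and its equality case *)

Section Calibration.
Context {R : realType} {p : R} (hp1 : 1 < p) (hp2 : p < 2).
Local Ltac plra := move: (hp1) (hp2) => ? ?; lra.
Let pi_pos : 0 < pi :> R := pi_gt0 R.
Context {X Y : R -> R} (hX : special (p := p) X Y) {tau : R} {Ti : R -> R}.
Hypothesis Ypos : forall t, t < tau -> 0 < Y t.
Hypothesis Xtau : pi / 2 < X tau.
Hypothesis XTi : forall u, 0 < u -> u < X tau -> Ti u < tau /\ X (Ti u) = u.
Hypothesis TiX : forall t, t < tau -> Ti (X t) = t.
Hypothesis dTi : forall t, t < tau -> dv Ti (X t) (Y t)^-1.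

(** The value 0 continues the function to h = 0, which the branch reaches only at t = -oo. *)
Definition sig (h : R) : R := if 0 < h then - V p (X (Ti h)) (Y (Ti h)) / (2 - p) else 0.
(** The field of extremals: on its increasing part, a dilation of the special solution satisfies r
    h' = speed h. *)
Definition speed (h : R) : R := Y (Ti h).

Let p2 : 0 < 2 - p. Proof. by rewrite subr_gt0. Qed.

Lemma speed_gt0 h : 0 < h -> h < X tau -> 0 < speed h.
Proof. by move=> h0 ht; have [? _] := XTi h h0 ht; exact: Ypos. Qed.

Lemma dv_Ti h : 0 < h -> h < X tau -> dv Ti h (speed h)^-1.
Proof. by move=> h0 ht; have [h1 h2] := XTi h h0 ht; have := dTi _ h1; rewrite h2. Qed.

Lemma sigE h : 0 < h -> h < X tau -> sig h = - V p h (speed h) / (2 - p).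
Proof. by move=> h0 ht; rewrite /sig h0; have [_ ->] := XTi h h0 ht. Qed.

Lemma dv_sig h : 0 < h -> h < X tau ->
  dv sig h (p * speed h * (speed h ^+ 2 + sin h ^+ 2) `^ (p / 2 - 1)).
Proof.
move=> h0 ht; have [h1 h2] := XTi h h0 ht.
apply: (dv_near (f := fun h => - V p (X (Ti h)) (Y (Ti h)) / (2 - p))).
  by apply: near_pos => // w w0; rewrite /sig w0.
have d1 := dv_comp (dv_V hp1 (sp_sol hX) (sp_nt hp1 hp2 hX) (Ti h)) (dv_Ti h h0 ht).
have Y0 := speed_gt0 h h0 ht; rewrite /speed in Y0 d1 *.
dstep; rewrite h2; set Q := _ `^ _.
by field; rewrite !gt_eqF.
Qed.

Lemma sig_bound h : 0 < h -> h < X tau ->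
  0 < sig h /\ (2 - p) * sig h <= (sin h ^+ 2) `^ (p / 2).
Proof.
move=> h0 ht; have [h1 h2] := XTi h h0 ht; have VX := sp_V hp1 hp2 hX (Ti h).
rewrite /sig h0; split; first by rewrite divr_gt0 ?oppr_gt0.
rewrite mulrC divfK ?gt_eqF// -[X in (sin X ^+ 2) `^ _]h2.
have s0 := sin_neq0 hp1 (sp_nt hp1 hp2 hX) _ VX.
have s2 : 0 < sin (X (Ti h)) ^+ 2 by rewrite exprn_even_gt0.
have N0 := N_gt0 (sp_nt hp1 hp2 hX) (Ti h).
rewrite -(mulr_powRB1 (ltW s2)) ?divr_gt0//; last by plra.
rewrite /V -mulNr opprB; apply: ler_pM; rewrite ?powR_ge0//.
- by move: VX; rewrite V_lt0// subr_ge0 => /ltW.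
- by rewrite gerBl mulr_ge0 ?sqr_ge0//; plra.
rewrite -[p / 2 - 1]opprK !(powRN _ (- (p / 2 - 1))) lef_pV2 ?posrE ?powR_gt0//.
by apply: ge0_ler_powR; rewrite ?nnegrE ?(ltW N0) ?(ltW s2)//; [plra|rewrite lerDr sqr_ge0].
Qed.

Lemma sig_ge0 h : h <= pi / 2 -> 0 <= sig h.
Proof.
move=> hp; have [h0|h0] := ltP 0 h; last by rewrite /sig ltNge h0.
by have [/ltW] := sig_bound h h0 (le_lt_trans hp Xtau).
Qed.

Lemma sig_le h : h <= pi / 2 -> sig h <= (2 - p)^-1.
Proof.
move=> hp; have [h0|h0] := ltP 0 h; last by rewrite /sig ltNge h0 invr_ge0 ltW.
have [_ h1] := sig_bound h h0 (le_lt_trans hp Xtau).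
rewrite -[leRHS]mulr1 ler_pdivlMl//; apply: le_trans h1 _.
have e1 : (1 : R) `^ (p / 2) = 1 by rewrite powR1.
rewrite -[leRHS]e1; apply: ge0_ler_powR; rewrite ?nnegrE ?sqr_ge0//; plra.
Qed.

(** By [sig_bound], sig h is at most h^p / (2 - p), and p > 1. This is what gives the calibrating
    function zero partial derivatives where a competitor vanishes. *)
Lemma sig_small e : 0 < e -> exists2 d, 0 < d & forall h, 0 <= h -> h < d -> h <= pi / 2 -> sig h <= e * h.
Proof.
move=> e0; have p10 : 0 < p - 1 by plra.
pose c := e * (2 - p); have c0 : 0 < c by rewrite mulr_gt0.
exists (c `^ (p - 1)^-1); first exact: powR_gt0.
move=> h; rewrite le_eqVlt => /orP[/eqP<-|h0] hd hp; first by rewrite /sig ltxx mulr0.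
have [_ h1] := sig_bound h h0 (le_lt_trans hp Xtau).
have s0 : 0 < sin h by apply: sin_gt0_pi; rewrite h0/=; have := pi_pos; lra.
rewrite -(ler_pM2l p2); apply: le_trans h1 _.
apply: (le_trans (y := (h ^+ 2) `^ (p / 2))).
  apply: ge0_ler_powR; rewrite ?nnegrE ?sqr_ge0//; first by plra.
  by rewrite ler_sqr ?nnegrE ?(ltW s0) ?(ltW h0)//; apply: sin_le_id; exact: ltW.
rewrite -powR_mulrn ?(ltW h0)// -powRrM (_ : 2 * (p / 2) = p); last by field.
rewrite -(mulr_powRB1 (ltW h0)) ?(lt_trans ltr01)// [leRHS]mulrA [leRHS]mulrC ler_pM2l//.
rewrite (_ : (2 - p) * e = c); last by rewrite /c mulrC.
have -> : c = (c `^ (p - 1)^-1) `^ (p - 1).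
  by rewrite -powRrM mulVf ?gt_eqF// powRr1// ltW.
by apply: ge0_ler_powR; rewrite ?nnegrE ?powR_ge0 ?(ltW h0) ?(ltW hd)// ltW.
Qed.

Lemma frozen_identities x0 h0 (s := speed h0 / x0) (a := sin h0 / x0) : 0 < x0 -> 0 < h0 -> h0 < X tau ->
  dLag p x0 a s = x0 `^ (2 - p) * (p * speed h0 * (speed h0 ^+ 2 + sin h0 ^+ 2) `^ (p / 2 - 1)) /\
  Lag p x0 a s - dLag p x0 a s * s = sig h0 * ((2 - p) * x0 `^ (2 - p - 1)).
Proof.
move=> x00 h00 ht; set y := speed h0 in s *; have y0 : 0 < y by exact: speed_gt0.
have N0 : 0 < y ^+ 2 + sin h0 ^+ 2 by rewrite ltr_wpDr ?sqr_ge0// exprn_gt0.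
have NE : s ^+ 2 + a ^+ 2 = (y ^+ 2 + sin h0 ^+ 2) * x0 ^- 2.
  by rewrite /s /a; field; rewrite gt_eqF.
have NN : 0 < s ^+ 2 + a ^+ 2 by rewrite NE mulr_gt0// invr_gt0 exprn_gt0.
have Qs : (s ^+ 2 + a ^+ 2) `^ (p / 2 - 1) = (y ^+ 2 + sin h0 ^+ 2) `^ (p / 2 - 1) * x0 `^ (2 - p).
  rewrite NE powRM ?(ltW N0)//; last by rewrite invr_ge0 exprn_ge0// ltW.
  by rewrite -powR_invn ?(ltW x00)// -powRrM; congr (_ * _ `^ _); field.
have Ps : (s ^+ 2 + a ^+ 2) `^ (p / 2) = (s ^+ 2 + a ^+ 2) * (s ^+ 2 + a ^+ 2) `^ (p / 2 - 1).
  by rewrite mulr_powRB1 ?(ltW NN)// divr_gt0//; plra.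
have Pw : x0 `^ (2 - p - 1) = x0 `^ (2 - p) / x0.
  by rewrite (@powRB _ _ (2 - p)) ?powRr1 ?(ltW x00)// lt0r_neq0// implybT.
rewrite /Lag /dLag Ps Qs Pw sigE// -/y /V.
set Q := (y ^+ 2 + sin h0 ^+ 2) `^ _; set W := x0 `^ _.
split; first by rewrite /s; field; rewrite gt_eqF.
by rewrite /s /a; field; rewrite !gt_eqF.
Qed.

Section Competitor.
Context {w E : R -> R} (hP : affine_minorant p w E).
Hypothesis cw : forall r, 0 < r -> r < 1 -> {for r, continuous w}.
Hypothesis w0 : forall r, 0 < r -> r < 1 -> 0 <= w r.
Hypothesis wpi : forall r, 0 < r -> r < 1 -> w r <= pi / 2.

Definition cal (r : R) : R := r `^ (2 - p) * sig (w r).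

Lemma sin_w r : 0 < r -> r < 1 -> 0 < w r -> 0 < sin (w r).
Proof.
move=> r0 r1 wr; apply: sin_gt0_pi; rewrite wr/=.
by apply: le_lt_trans (wpi _ r0 r1) _; have := pi_pos; lra.
Qed.

(** The first clause is convexity at the special slope. The second is the expansion of the
    calibrating function in its two variables; w is merely continuous, so the error is measured by
    |x - x0| + |w x - w x0|. *)
Lemma calibrated_pos x0 (s := speed (w x0) / x0) (a := sin (w x0) / x0) : 0 < x0 -> x0 < 1 -> 0 < w x0 ->
  calibrated w E cal x0 (Lag p x0 a s - dLag p x0 a s * s) (dLag p x0 a s).
Proof.
move=> x00 x01 wx0; have wt : w x0 < X tau := le_lt_trans (wpi _ x00 x01) Xtau.
split=> [e e0|e e0].
  exact: (minorant_local hp1 hp2 hP x0 s e x00 x01 (cw _ x00 x01) (sin_w _ x00 x01 wx0) e0).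
have [iB iA] := frozen_identities x0 (w x0) x00 wx0 wt.
have /is_derive1_caratheodory[Q [hQ cQ Q0]] := dv_sig _ wx0 wt.
have dpow : dv (fun r => r `^ (2 - p)) x0 ((2 - p) * x0 `^ (2 - p - 1)) by exact: is_derive1_powR.
have /is_derive1_caratheodory[P [hQ' cP P0]] := dpow.
have c1 : {for x0, continuous (fun x => x `^ (2 - p) * Q (w x))}.
  apply: cvgM; first exact: dv_cont dpow.
  by apply: (continuous_comp (f := w)); [exact: cw|].
have c2 : {for x0, continuous (fun x => sig (w x0) * P x)}.
  by apply: cvgM => //; exact: cvg_cst.
have [d1 d10 h1] := near_abs c1 e0; have [d2 d20 h2] := near_abs c2 e0.
exists (Num.min d1 d2) => [|x]; first by rewrite lt_min d10.
rewrite lt_min => /andP[/h1 {}h1 /h2 {}h2].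
rewrite Q0 -iB -/s -/a in h1; rewrite P0 -iA -/s -/a in h2.
set A0 := Lag p x0 a s - _ in h2 *; set B0 := dLag p x0 a s in h1 *.
have hs : sig (w x) = sig (w x0) + Q (w x) * (w x - w x0) by rewrite -hQ; ring.
have -> : cal x - cal x0 - A0 * (x - x0) - B0 * (w x - w x0) =
    sig (w x0) * (x `^ (2 - p) - x0 `^ (2 - p)) - A0 * (x - x0) + (x `^ (2 - p) * Q (w x) - B0) * (w x - w x0).
  by rewrite /cal hs; ring.
rewrite hQ' [sig (w x0) * _]mulrA -mulrBl.
apply: le_trans (ler_normD _ _) _; rewrite !normrM mulrDr.
by apply: lerD; rewrite ler_wpM2r// ltW.
Qed.

(** Where w vanishes both coefficients are 0: the first clause is the monotonicity of E and the
    second is [sig_small]. *)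
Lemma calibrated_any x0 : 0 < x0 -> x0 < 1 -> exists A0 B0, calibrated w E cal x0 A0 B0.
Proof.
move=> x00 x01; have [wx0|wx0] := ltP 0 (w x0); first by eexists; eexists; exact: calibrated_pos.
have {}wx0 : w x0 = 0 by apply/eqP; rewrite eq_le wx0 w0.
have m0 : 0 < Num.min x0 (1 - x0) by rewrite lt_min x00 subr_gt0.
have m1 : Num.min x0 (1 - x0) <= x0 by rewrite ge_min lexx.
have m2 : Num.min x0 (1 - x0) <= 1 - x0 by rewrite ge_min lexx orbT.
exists 0, 0; split=> e e0.
  exists (Num.min x0 (1 - x0)) => // y x xy yx xd; rewrite !mul0r addr0 mulr_ge0//; first by lra.
  rewrite subr_ge0; apply: (minorant_mono hP); [lra|exact: ltW|lra].
have [d d0 hd] := sig_small _ e0; have [d1 d10 h1] := near_abs (cw _ x00 x01) d0.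
exists (Num.min d1 (Num.min x0 (1 - x0))) => [|x]; first by rewrite lt_min d10.
rewrite lt_min => /andP[/h1 xd1 xd2].
have [x0' x1'] : 0 < x /\ x < 1 by move: xd2; rewrite ltr_norml => /andP[? ?]; split; lra.
have wx := w0 _ x0' x1'; have wp := wpi _ x0' x1'.
move: xd1; rewrite wx0 subr0 => xd1.
have sd := hd _ wx (le_lt_trans (ler_norm _) xd1) wp.
rewrite !mul0r !subr0 /cal wx0 {2}/sig ltxx mulr0 subr0.
have sg := sig_ge0 _ wp.
rewrite ger0_norm; last by rewrite mulr_ge0 ?powR_ge0.
apply: (le_trans (y := 1 * sig (w x))).
  rewrite ler_wpM2r// -[leRHS](powRr0 x); apply: ger_powR; last exact: ltW.
  by rewrite x0' ltW.
by rewrite mul1r (ger0_norm wx) mulrDr; apply: le_trans sd _; rewrite lerDr mulr_ge0// ltW.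
Qed.

Lemma cal_lower a b : 0 < a -> a <= b -> b < 1 -> cal b - cal a <= E b - E a.
Proof.
move=> a0 ab b1; apply: (calibrated_le (w := w) a0 ab).
- move=> x0 ax0 x0b; apply: calibrated_any; [exact: lt_le_trans ax0|exact: le_lt_trans b1].
- by move=> y x ay yx xb; apply: (minorant_coercive hp1 hp2 hP) => //; exact: le_lt_trans b1.
- move=> y x ay yx xb; apply: (minorant_mono hP) => //; [exact: lt_le_trans ay|exact: le_lt_trans b1].
Qed.

Section Equality.
Hypothesis eqE : forall y x, 0 < y -> y < x -> x < 1 -> cal x - cal y = E x - E y.

(** If a difference quotient passed the special slope s0 by eta, on the side given by sg, the
    tangent at s1 = s0 + sg eta would bound the increment of E from below by more than the increment
    of the calibrating function, against [eqE]. Differentiability of w is thus a consequence of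
    equality. *)
Lemma slope_side x0 eta (sg : R) : 0 < x0 -> x0 < 1 -> 0 < w x0 -> 0 < eta -> sg * sg = 1 ->
  exists2 d, 0 < d & forall y x, 0 < y -> y < x -> x < 1 -> y = x0 \/ x = x0 -> x - y < d ->
    sg * ((w x - w y) / (x - y)) < sg * (speed (w x0) / x0) + eta.
Proof.
move=> x00 x01 wx0 eta0 sg1.
set s0 := speed (w x0) / x0; set a := sin (w x0) / x0.
have a0 : 0 < a by rewrite divr_gt0// sin_w.
have sgn : `|sg| = 1.
  by apply/eqP; rewrite -(@eqrXn2 _ 2)// expr1n expr2 -normrM sg1 normr1.
set A0 := Lag p x0 a s0 - dLag p x0 a s0 * s0; set B0 := dLag p x0 a s0.
have cal2 : calibrated w E cal x0 A0 B0 by exact: calibrated_pos.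
pose s1 := s0 + sg * eta.
set A1 := Lag p x0 a s1 - dLag p x0 a s1 * s1; set B1 := dLag p x0 a s1.
have sg0 : sg != 0 by apply: contraTneq isT => h; move: sg1; rewrite h mul0r => /esym/eqP; rewrite oner_eq0.
have s10 : s1 != s0.
  by rewrite /s1 -subr_eq0 addrAC subrr add0r mulf_neq0// gt_eqF.
pose dl := A1 + B1 * s1 - (A0 + B0 * s1).
have dl0 : 0 < dl.
  have := tangent_lt hp1 hp2 x00 a0 s1 s0 s10; rewrite /dl /A1 /A0 -/B0 -/B1; lra.
pose m := sg * (B1 - B0).
have m0 : 0 < m.
  have incr := dLag_incr hp1 hp2 x00 a0.
  have [sp|sp] := ltP 0 sg.
    by rewrite /m mulr_gt0// subr_gt0; apply: incr; rewrite /s1 ltrDl mulr_gt0.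
  have {}sp : sg < 0 by rewrite lt_neqAle sg0.
  by rewrite /m nmulr_rgt0// subr_lt0; apply: incr; rewrite /s1 gtrDl nmulr_rlt0.
pose C := `|A0| + `|B0| + 2.
have C0 : 0 < C by rewrite /C; have := normr_ge0 A0; have := normr_ge0 B0; lra.
pose e := Num.min 1 (Num.min (dl / (2 * C * (1 + `|s1|))) (m / (2 * C))).
have s11 : 0 < 1 + `|s1| by rewrite ltr_pwDl.
have C2 : 0 < 2 * C by rewrite mulr_gt0.
have e0 : 0 < e by rewrite !lt_min ltr01 (divr_gt0 dl0 (mulr_gt0 C2 s11)) (divr_gt0 m0 C2).
have e1 : e <= 1 by rewrite ge_min lexx.
have e2 : e * C * (1 + `|s1|) <= dl / 2.
  have : e <= dl / (2 * C * (1 + `|s1|)) by rewrite !ge_min lexx orbT.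
  rewrite ler_pdivlMr ?(mulr_gt0 C2 s11)//; lra.
have e3 : e * C <= m / 2.
  have : e <= m / (2 * C) by rewrite !ge_min lexx !orbT.
  rewrite ler_pdivlMr//; lra.
have [d1 d10 h1] := minorant_local hp1 hp2 hP x0 s1 e x00 x01 (cw _ x00 x01) (sin_w _ x00 x01 wx0) e0.
have [d2 d20 h2] := calibrated_side cal2 _ e0.
exists (Num.min d1 d2) => [|y x y0 yx x1 yx0]; first by rewrite lt_min d10.
rewrite lt_min => /andP[xd1 xd2].
have D0 : 0 < x - y by rewrite subr_gt0.
set S := (w x - w y) / (x - y).
have wS : w x - w y = S * (x - y) by rewrite /S divfK// gt_eqF.
rewrite ltNge; apply/negP => hS.
have q0 : 0 <= sg * (S - s1).
  rewrite (_ : sg * (S - s1) = sg * S - sg * s0 - sg * sg * eta); last by rewrite /s1; ring.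
  by rewrite sg1; lra.
have [xy1 xy2] := near_side yx yx0 xd1.
have := h1 y x xy1 yx xy2; rewrite -eqE// leNgt => /negP; apply.
apply: le_lt_trans (_ : (1 + e) * (A0 * (x - y) + B0 * (w x - w y) + e * ((x - y) + `|w x - w y|)) < _).
  by rewrite ler_pM2l ?addr_gt0//; exact: h2.
rewrite wS normrM (gtr0_norm D0).
rewrite [ltLHS](_ : _ = (1 + e) * (A0 + B0 * S + e * (1 + `|S|)) * (x - y)); last by ring.
rewrite [ltRHS](_ : _ = (A1 + B1 * S) * (x - y)); last by rewrite /A1 /B1 /a; ring.
rewrite ltr_pM2r//; apply: (slope_contradiction A0 B0 A1 B1 S s1 e m dl _ e0 e1 dl0 m0 q0 e2 e3).
  rewrite /dl /m (_ : sg * (B1 - B0) * (sg * (S - s1)) = (sg * sg) * ((B1 - B0) * (S - s1))); last by ring.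
  by rewrite sg1; ring.
suff SS : `|S| <= `|s1| + sg * (S - s1) by exact: SS.
rewrite -{1}(subrK s1 S) addrC; apply: le_trans (ler_normD _ _) _; rewrite lerD2l.
by rewrite -[leRHS](ger0_norm q0) normrM sgn mul1r.
Qed.

Lemma slope_limit x0 eta : 0 < x0 -> x0 < 1 -> 0 < w x0 -> 0 < eta ->
  exists2 d, 0 < d & forall y x, 0 < y -> y < x -> x < 1 -> y = x0 \/ x = x0 -> x - y < d ->
    `|(w x - w y) / (x - y) - speed (w x0) / x0| < eta.
Proof.
move=> x00 x01 wx0 eta0.
have [d1 d10 h1] := slope_side x0 eta 1 x00 x01 wx0 eta0 (mulr1 1).
have [d2 d20 h2] := slope_side x0 eta (-1) x00 x01 wx0 eta0 (etrans (mulrNN 1 1) (mulr1 1)).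
exists (Num.min d1 d2) => [|y x y0 yx x1 yx0]; first by rewrite lt_min d10.
rewrite lt_min => /andP[xd1 xd2].
have := h1 y x y0 yx x1 yx0 xd1; have := h2 y x y0 yx x1 yx0 xd2.
by rewrite !mul1r !mulN1r ltr_norml => *; apply/andP; split; lra.
Qed.

(** Where w = pi/2 the right difference quotients would have a positive limit, against w <= pi/2. *)
Lemma w_lt_pihalf x0 : 0 < x0 -> x0 < 1 -> w x0 < pi / 2.
Proof.
move=> x00 x01; rewrite lt_neqAle wpi// andbT; apply/eqP => e.
have wx0 : 0 < w x0 by rewrite e divr_gt0.
have s0 : 0 < speed (w x0) / x0 by rewrite divr_gt0// speed_gt0// e.
have [d d0 hd] := slope_limit x0 _ x00 x01 wx0 s0.
pose x := x0 + Num.min (d / 2) ((1 - x0) / 2).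
have m0 : 0 < Num.min (d / 2) ((1 - x0) / 2) by rewrite lt_min !divr_gt0// subr_gt0.
have m1 : Num.min (d / 2) ((1 - x0) / 2) <= d / 2 by rewrite ge_min lexx.
have m2 : Num.min (d / 2) ((1 - x0) / 2) <= (1 - x0) / 2 by rewrite ge_min lexx orbT.
have x0x : x0 < x by rewrite /x ltrDl.
have x1 : x < 1 by rewrite /x; lra.
have := hd x0 x x00 x0x x1 (or_introl erefl); rewrite ltr_norml => /(_ ltac:(rewrite /x; lra)) /andP[h _].
have : (w x - w x0) / (x - x0) <= 0.
  rewrite pmulr_lle0 ?invr_gt0 ?subr_gt0// subr_le0 e; apply: wpi => //; exact: lt_trans x0x.
lra.
Qed.

Lemma dv_w x0 : 0 < x0 -> x0 < 1 -> 0 < w x0 -> dv w x0 (speed (w x0) / x0).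
Proof.
move=> x00 x01 wx0; apply/is_derive1_caratheodory.
pose g z := if z == x0 then speed (w x0) / x0 else (w z - w x0) / (z - x0).
exists g; split=> [z| |]; last by rewrite /g eqxx.
  rewrite /g; case: eqVneq => [->|zx]; first by rewrite !subrr mulr0.
  by rewrite divfK// subr_eq0.
apply/cvgrPdist_lt => eta eta0.
have [d d0 hd] := slope_limit x0 eta x00 x01 wx0 eta0.
pose d' := Num.min d (Num.min x0 (1 - x0)).
have d'0 : 0 < d' by rewrite !lt_min d0 x00 subr_gt0.
have d'1 : d' <= d by rewrite ge_min lexx.
have d'2 : d' <= x0 by rewrite !ge_min lexx orbT.
have d'3 : d' <= 1 - x0 by rewrite !ge_min lexx !orbT.
apply: (pball_near d') => // z zd.
rewrite distrC {2}/g eqxx /g; case: eqVneq => [_|zx]; first by rewrite subrr normr0.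
move: zd; rewrite ltr_norml => /andP[z1 z2].
case: (ltgtP z x0) zx => // h _.
  have -> : (w z - w x0) / (z - x0) = (w x0 - w z) / (x0 - z).
    by rewrite -[w z - _]opprB -[z - _]opprB invrN mulrNN.
  by apply: hd => //; [lra|right|lra].
by apply: hd => //; [lra|left|lra].
Qed.

(** Where w > 0, [dv_w] is the equation r w' = speed w, so Ti (w r) - ln r is locally constant.
    Positivity propagates from r1: at a first zero, w would be the limit of X (ln r + C), which is
    positive. *)
Lemma rigidity r1 : 0 < r1 -> r1 < 1 -> 0 < w r1 ->
  exists C, forall r, 0 < r -> r < 1 -> w r = X (ln r + C).
Proof.
move=> r10 r11 wr1.
have wt r : 0 < r -> r < 1 -> w r < X tau.
  by move=> r0 r1'; apply: le_lt_trans Xtau; exact: wpi.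
pose phi r := Ti (w r) - ln r; pose C := phi r1.
have dphi r : 0 < r -> r < 1 -> 0 < w r -> dv phi r 0.
  move=> r0 r1' wr; have d1 := dv_comp (dv_Ti _ wr (wt _ r0 r1')) (dv_w _ r0 r1' wr).
  have d2 : dv (@ln R) r r^-1 := is_derive1_ln r0.
  apply: dv_eq (dvB d1 d2) _; have := speed_gt0 _ wr (wt _ r0 r1') => s0.
  by field; rewrite !gt_eqF.
have onphi r : 0 < r -> r < 1 -> 0 < w r -> phi r = C -> w r = X (ln r + C).
  move=> r0 r1' wr <-; rewrite /phi addrC subrK.
  by have [_ ->] := XTi _ wr (wt _ r0 r1').
suff key z : 0 < z -> z < 1 -> 0 < w z /\ phi z = C.
  by exists C => r r0 r1'; have [? ?] := key r r0 r1'; exact: onphi.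
(* The affine path treats z < r1 and z > r1 together. *)
move=> z0 z1; pose path t := r1 + t * (z - r1).
have path_in t : 0 <= t -> t <= 1 -> 0 < path t /\ path t < 1.
  move=> t0 t1; rewrite (_ : path t = (1 - t) * r1 + t * z); last by rewrite /path; ring.
  have [u0 u1] : (1 - t) * r1 <= (1 - t) * 1 /\ t * z <= t * 1.
    by split; apply: ler_wpM2l; rewrite ?subr_ge0// ltW.
  have v0 : 0 <= (1 - t) * r1 by rewrite mulr_ge0 ?subr_ge0// ltW.
  have v1 : 0 <= t * z by rewrite mulr_ge0// ltW.
  have [t'|t'] := eqVneq t 0; first by rewrite t' subr0 mul1r mul0r addr0.
  have t0' : 0 < t by rewrite lt_neqAle eq_sym t'.
  have w1 : 0 < t * z by rewrite mulr_gt0.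
  have w2 : t * z < t * 1 by rewrite ltr_pM2l.
  by split; lra.
have dpath t : dv path t (z - r1) by rewrite /path; dstep; ring.
have cpath t : {for t, continuous path} by exact: dv_cont (dpath t).
have cwp t : 0 <= t -> t <= 1 -> {for t, continuous (fun t => w (path t))}.
  move=> t0 t1; have [u0 u1] := path_in t t0 t1.
  by apply: (continuous_comp (f := path)); [exact: cpath|exact: cw].
have phic c : 0 <= c -> c <= 1 -> (forall t, 0 <= t -> t <= c -> 0 < w (path t)) -> phi (path c) = C.
  move=> c0 c1 pos; rewrite /C (_ : r1 = path 0); last by rewrite /path mul0r addr0.
  apply/esym; apply: (const_dv c0 (f := fun t => phi (path t)) (df := fun=> 0)) => // t /andP[t0 tc].
  have [u0 u1] := path_in t t0 (le_trans tc c1).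
  by apply: dv_eq (dv_comp (dphi _ u0 u1 (pos t t0 tc)) (dpath t)) _; rewrite mul0r.
have pz : path 1 = z by rewrite /path mul1r addrC subrK.
have allpos t : 0 <= t -> t <= 1 -> 0 < w (path t).
  move=> t0 t1; rewrite ltNge; apply/negP => wneg.
  have [||||c [c0 ct wc hc]] := first_hit_in (f := fun t => - w (path t)) (a := 0) (b := t) (v := 0).
  - exact: t0.
  - by move=> u u0 ut; apply: cvgN; apply: cwp => //; exact: le_trans ut t1.
  - by rewrite /path mul0r addr0 oppr_lt0.
  - by rewrite oppr_ge0.
  have c1 := le_trans ct t1.
  have pos u : 0 <= u -> u < c -> 0 < w (path u) by move=> u0 uc; have := hc u u0 uc; rewrite oppr_lt0.
  have on u : 0 <= u -> u < c -> w (path u) = X (ln (path u) + C).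
    move=> u0 uc; have [v0 v1] := path_in u u0 (le_trans (ltW uc) c1).
    apply: onphi => //; first exact: pos.
    apply: phic => //; first exact: le_trans (ltW uc) c1.
    by move=> s s0 su; apply: pos => //; exact: le_lt_trans su uc.
  have [p0 p1] := path_in c (ltW c0) c1.
  have wc0 : w (path c) = 0 by apply/eqP; rewrite -oppr_eq0 wc.
  have XC : 0 < X (ln (path c) + C) by have /andP[] := sp_strip hp1 hp2 hX (ln (path c) + C).
  pose h u := w (path u) - X (ln (path u) + C).
  have ch : {for c, continuous h}.
    apply: cvgB; first exact: (cwp c (ltW c0) c1).
    have d1 := dv_ln p0 (dpath c); have d2 := (sp_sol hX (ln (path c) + C)).1.
    have d3 : dv (fun u => ln (path u) + C) c ((path c)^-1 * (z - r1) + 0) by dtac.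
    exact: (dv_cont (dv_comp (f := X) (g := fun u => ln (path u) + C) d2 d3)).
  have [d d0 hd] := near_abs ch XC.
  pose u := c - Num.min (d / 2) c.
  have m0 : 0 < Num.min (d / 2) c by rewrite lt_min divr_gt0.
  have m1 : Num.min (d / 2) c <= d / 2 by rewrite ge_min lexx.
  have m2 : Num.min (d / 2) c <= c by rewrite ge_min lexx orbT.
  have := hd u; rewrite (_ : h u = 0); last by rewrite /h on ?subrr// /u; lra.
  rewrite sub0r /h wc0 sub0r opprK (gtr0_norm XC) ltxx => h0; suff : false by []; apply: h0.
  by rewrite ltr0_norm /u; lra.
by rewrite -pz; split; [exact: allpos|apply: phic => // t t0 t1; exact: allpos].
Qed.
End Equality.
End Competitor.
End Calibration.

(** * Folding onto [0, pi/2] *)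

Section Fold.
Context {R : realType} {p : R}.
Let pi_pos : 0 < pi :> R := pi_gt0 R.

(* The distance to the nearest multiple of pi. *)
Definition fold (u : R) : R := asin `|sin u|.

Let abs_sin_in (u : R) : -1 <= `|sin u| <= 1.
Proof.
apply/andP; split; last by rewrite ler_norml sin_geN1 sin_le1.
exact: le_trans (lerN10 R) (normr_ge0 _).
Qed.

Lemma sin_fold u : sin (fold u) = `|sin u|.
Proof. by rewrite /fold asinK// in_itv/=; exact: abs_sin_in. Qed.

Lemma sin2_fold u : sin (fold u) ^+ 2 = sin u ^+ 2.
Proof. by rewrite sin_fold real_normK ?num_real. Qed.

Lemma fold_le u : fold u <= pi / 2.
Proof. exact: asin_lepi2. Qed.

Lemma fold_ge0 u : 0 <= fold u.
Proof.
rewrite leNgt; apply/negP => h; have := asin_geNpi2 (abs_sin_in u); rewrite -/(fold u) => h2.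
have : 0 < sin (- fold u) by apply: sin_gt0_pi; have := pi_pos; rewrite oppr_gt0 h/=; lra.
by rewrite sinN oppr_gt0 sin_fold ltNge normr_ge0.
Qed.

Lemma foldN u : fold (- u) = fold u.
Proof. by rewrite /fold sinN normrN. Qed.

Lemma foldD_int (n : int) u : fold (u + n%:~R * pi) = fold u.
Proof. by apply: (int_period fold) => z; rewrite /fold sinDpi normrN. Qed.

Lemma fold_id u : 0 <= u -> u <= pi / 2 -> fold u = u.
Proof.
move=> u0 up; rewrite /fold ger0_norm ?sinK ?in_itv//=.
- by apply/andP; split=> //; have := pi_pos; lra.
- by apply: sin_ge0_pi; rewrite u0/=; have := pi_pos; lra.
Qed.

Lemma fold_refl u : pi / 2 <= u -> u <= pi -> fold u = pi - u.
Proof.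
move=> u1 u2; rewrite -(foldN u) -(foldD_int 1) mul1r addrC fold_id//; lra.
Qed.

Lemma fold_abs u : `|u| <= pi / 2 -> fold u = `|u|.
Proof. by move=> h; case: (ger0P u) h => ? h; [|rewrite -foldN]; rewrite fold_id//; lra. Qed.

(** With [fold_le_int] this makes [fold] a minimum of the functions |u - n pi|, hence
    1-Lipschitz. *)
Lemma fold_near_int u : exists n : int, fold u = `|u - n%:~R * pi|.
Proof.
have [n [v [/andP[v0 vpi] ->]]] := pi_decomp u; have := pi_pos => pp.
have [h|h] := leP v (pi / 2).
  by exists n; rewrite addrK foldD_int fold_id// ger0_norm.
exists (n + 1); rewrite foldD_int fold_refl ?(ltW h) ?(ltW vpi)// intrD mulr1z.
rewrite (_ : v + _ - _ = - (pi - v)); last by ring.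
by rewrite normrN ger0_norm// subr_ge0 ltW.
Qed.

Lemma fold_le_int (n : int) u : fold u <= `|u - n%:~R * pi|.
Proof.
have [h|h] := leP `|u - n%:~R * pi| (pi / 2); last by apply: le_trans (fold_le u) (ltW h).
by rewrite -fold_abs// -mulNr -intrN foldD_int.
Qed.

Lemma fold_lip u v : `|fold u - fold v| <= `|u - v|.
Proof.
have half x y : fold x - fold y <= `|x - y|.
  have [n e] := fold_near_int y; rewrite e lerBlDr; apply: le_trans (fold_le_int n x) _.
  rewrite (_ : x - n%:~R * pi = (x - y) + (y - n%:~R * pi)); last by ring.
  exact: ler_normD.
by rewrite ler_norml lerNl opprB half distrC half.
Qed.

Lemma continuous_fold (u : R) : {for u, continuous fold}.
Proof.
apply/cvgrPdist_lt => e e0; apply: (pball_near e) => // y ye.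
by rewrite distrC; apply: le_lt_trans (fold_lip _ _) ye.
Qed.

(** The density depends on sin^2 and v^2 only, so the minorant holds with B and with -B, and folding
    does not enlarge increments. No derivative of the folded function is taken. *)
Lemma fold_minorant {w E : R -> R} :
  affine_minorant p w E -> affine_minorant p (fold \o w) E.
Proof.
move=> hP a b A B a0 ab b1 h.
have hs (s : R) : `|s| = 1 -> A * (b - a) + B * s * (w b - w a) <= E b - E a.
  move=> s1; apply: hP => // r v ar rb.
  have s2 : s ^+ 2 = 1 by rewrite -[s ^+ 2]real_normK ?num_real// s1 expr1n.
  have := h r (s * v) ar rb; rewrite /dens /= sin2_fold exprMn s2 mul1r; lra.
have p1 := hs 1 (normr1 _); have m1 := hs (-1) (normrN1 _).
have k1 : B * (fold (w b) - fold (w a)) <= `|B * (w b - w a)|.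
  by apply: le_trans (ler_norm _) _; rewrite !normrM ler_wpM2l// fold_lip.
by case: (ger0P (B * (w b - w a))) k1 => _ k1 /=; lra.
Qed.

End Fold.

(** * Weak derivatives *)

Section SegmentIntegrals.
Context {R : realType}.
Local Notation mu := (@lebesgue_measure R).
Local Notation I01 := (`]0%R, 1%R[%classic : set R).

Lemma integrable_seg (f : R -> R) a b : {within `[a, b], continuous f} ->
  mu.-integrable `[a, b] (EFin \o f).
Proof. by move=> cf; apply: continuous_compact_integrable => //; exact: segment_compact. Qed.

Lemma Rintegral_seg (F f : R -> R) a b : a < b -> (forall r, a <= r <= b -> dv F r (f r)) ->
  {within `[a, b], continuous f} -> \int[mu]_(x in `[a, b]) f x = F b - F a.
Proof.
move=> ab dF cf; have cF r : a <= r <= b -> {for r, continuous F} by move/dF/dv_cont.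
have dL : derivable_oo_LRcontinuous F a b.
  split.
  - move=> r; rewrite in_itv/= => /andP[ar rb]; apply: (@dv_derivable _ _ _ (f r)); apply: dF.
    by rewrite !ltW.
  - by apply: cvg_at_right_filter; apply: cF; rewrite lexx ltW.
  - by apply: cvg_at_left_filter; apply: cF; rewrite lexx ltW.
rewrite /Rintegral (@continuous_FTC2 R f F a b)// => r; rewrite in_itv/= => /andP[ar rb].
by apply: dv_derive1; apply: dF; rewrite !ltW.
Qed.

Lemma sub_I01 {a b : R} : 0 < a -> b < 1 -> `[a, b] `<=` I01.
Proof.
by move=> a0 b1 r /=; rewrite !in_itv/= => /andP[? ?]; rewrite (lt_le_trans a0)//= (le_lt_trans _ b1).
Qed.

Lemma integrable_supp (f : R -> R) a b : 0 < a -> b < 1 ->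
  (forall x, 0 < x -> x < 1 -> ~ (a <= x <= b) -> f x = 0) -> mu.-integrable `[a, b] (EFin \o f) ->
  mu.-integrable I01 (EFin \o f) /\ \int[mu]_(x in I01) f x = \int[mu]_(x in `[a, b]) f x.
Proof.
move=> a0 b1 f0 fi.
have sub := sub_I01 a0 b1.
have e : {in I01, EFin \o f =1 (EFin \o f) \_ `[a, b]}.
  move=> x; rewrite inE/= in_itv/= => /andP[x0 x1]; rewrite patchE.
  case: ifPn => // /negP h; rewrite /= f0//; move=> hx; apply: h.
  by rewrite inE/= in_itv.
split.
  have e' : {in I01, (EFin \o f) \_ `[a, b] =1 EFin \o f} by move=> x hx; rewrite -e.
  refine (@eq_integrable _ _ R mu I01 _ _ _ e' _); first exact: measurable_itv.
  by apply/integrable_restrict => //; rewrite setIidr.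
congr fine; have := integral_mkcondr mu I01 `[a, b] (EFin \o f); rewrite setIidr// => ->.
by apply: eq_integral => x hx; exact: e.
Qed.

Lemma integrable_sub (f : R -> R) a b : 0 < a -> b < 1 -> locally_integrable I01 f ->
  mu.-integrable `[a, b] (EFin \o f).
Proof.
move=> a0 b1 [mf _ fi]; apply/integrableP; split.
  apply/measurable_EFinP; exact: measurable_funS (sub_I01 a0 b1) mf.
by apply: fi; [exact: sub_I01|exact: segment_compact].
Qed.

(** A continuous bump on [0, 1], whose primitive [ramp] is a C^1 step from 0 to [ramp 1]. Its mass
    is not normalised, whence the factors [ramp 1] below. *)
Definition hat (x : R) : R := Num.max 0 (x * (1 - x)).
Definition ramp : R -> R := prim hat.

Lemma continuous_hat : continuous hat.
Proof.
move=> x; have c1 : {for x, continuous (fun x : R => x * (1 - x))}.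
  by apply: (dv_cont (l := 1 - 2 * x)); dstep; ring.
exact: (@continuous_max R R (fun=> 0) (fun x => x * (1 - x)) x (cvg_cst _) c1).
Qed.

Lemma dv_ramp x : dv ramp x (hat x).
Proof. by have [_] := primP continuous_hat. Qed.

Lemma hat_ge0 x : 0 <= hat x.
Proof. by rewrite le_max lexx. Qed.

Lemma hat_gt0 x : 0 < x -> x < 1 -> 0 < hat x.
Proof. by move=> x0 x1; rewrite lt_max mulr_gt0 ?orbT// subr_gt0. Qed.

Lemma hat_out x : ~ (0 <= x <= 1) -> hat x = 0.
Proof.
move=> h; rewrite /hat; apply/max_idPl; case: (leP 0 x) h => x0 h.
  have x1 : 1 < x by rewrite ltNge; apply/negP.
  by rewrite mulr_ge0_le0// subr_le0 ltW.
by rewrite mulr_le0_ge0 ?(ltW x0)//; lra.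
Qed.

Lemma ramp_le0 x : x <= 0 -> ramp x = 0.
Proof.
move=> x0; have [<- _] := primP continuous_hat.
apply: (const_dv x0 (f := ramp) (df := hat)) => [y _|y /andP[_ y0]]; first exact: dv_ramp.
by apply: hat_out => /andP[]; rewrite leNgt y0.
Qed.

Lemma ramp_ge1 x : 1 <= x -> ramp x = ramp 1.
Proof.
move=> x1; apply/esym/(const_dv x1 (f := ramp) (df := hat)) => [y _|y /andP[y1 _]].
  exact: dv_ramp.
by apply: hat_out => /andP[_]; rewrite leNgt y1.
Qed.

Lemma ramp1_gt0 : 0 < ramp 1.
Proof.
rewrite -(ramp_le0 0 (lexx 0)); apply: (incr_dv ltr01 (f := ramp) (df := hat)) => [y _|y /andP[? ?]].
  exact: dv_ramp.
exact: hat_gt0.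
Qed.

Lemma ramp_bound x : 0 <= ramp x <= ramp 1.
Proof.
have mono y z : y <= z -> ramp y <= ramp z.
  by move=> yz; apply: (nondecr_dv yz (f := ramp) (df := hat)) => w _; [exact: dv_ramp|exact: hat_ge0].
have s1 := ramp1_gt0.
have [x0|x0] := leP x 0; first by rewrite ramp_le0// lexx ltW.
have [x1|x1] := leP x 1; last by rewrite (ramp_ge1 _ (ltW x1)) lexx ltW.
by rewrite mono// -(ramp_le0 0 (lexx 0)) mono// ltW.
Qed.

(** n hat (n (x - c)) has mass [ramp 1] and vanishes off [c, c + 1/n]: it averages u just to the
    right of c. *)
Lemma hat_approx (u : R -> R) (c n e : R) : 0 < c -> 0 < n -> c + n^-1 < 1 ->
  {within `[c, c + n^-1], continuous u} ->
  (forall x, c <= x -> x <= c + n^-1 -> `|u x - u c| <= e) ->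
  mu.-integrable I01 (EFin \o (fun x => u x * (n * hat (n * (x - c))))) /\
  `|\int[mu]_(x in I01) (u x * (n * hat (n * (x - c)))) - ramp 1 * u c| <= ramp 1 * e.
Proof.
move=> c0 n0 c1 cu hu; set J := `[c, c + n^-1]%classic; pose f x : R := u x * (n * hat (n * (x - c))).
have cn : c < c + n^-1 by rewrite ltrDl invr_gt0.
have cb (q : R) : continuous (fun x => q * (n * hat (n * (x - c)))).
  move=> x; apply: cvgM; first exact: cvg_cst.
  apply: cvgM; first exact: cvg_cst.
  apply: (continuous_comp (f := fun x : R => n * (x - c))); last exact: continuous_hat.
  by apply: (dv_cont (l := n)); dstep; ring.
have cwb (q : R) : {within J, continuous (fun x => q * (n * hat (n * (x - c))))}.
  by apply: continuous_subspaceT; exact: cb.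
have cf : {within J, continuous f}.
  move=> x; apply: cvgM; first exact: cu.
  have := cwb 1; rewrite (_ : (fun x => 1 * _) = fun x => n * hat (n * (x - c))); last by apply/funext => z; rewrite mul1r.
  exact.
have out x : 0 < x -> x < 1 -> ~ (c <= x <= c + n^-1) -> f x = 0.
  move=> _ _ h; rewrite /f hat_out ?mulr0// => /andP[h1 h2]; apply: h.
  move: h1; rewrite pmulr_rge0// subr_ge0 => ->/=.
  by move: h2; rewrite -ler_pdivlMl// mulr1 lerBlDl.
have [fi fE] := integrable_supp f c (c + n^-1) c0 c1 out (integrable_seg _ _ _ cf).
split; first exact: fi.
rewrite fE.
have tot q : \int[mu]_(x in J) (q * (n * hat (n * (x - c)))) = ramp 1 * q.
  rewrite (Rintegral_seg (fun x => q * ramp (n * (x - c))) _ _ _ cn)//.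
    rewrite subrr mulr0 (ramp_le0 0)// mulr0 subr0 addrC addKr divff ?gt_eqF// mulrC//.
  move=> r _; have d := dv_ramp (n * (r - c)).
  have d2 : dv (fun x => n * (x - c)) r n by dstep; ring.
  have d3 := dv_comp (f := ramp) (g := fun x => n * (x - c)) d d2.
  by apply: dv_eq (dvM (dv_cst q r) d3) _; ring.
have hb x : 0 <= n * hat (n * (x - c)) by rewrite mulr_ge0 ?hat_ge0// ltW.
have hu' x : c <= x -> x <= c + n^-1 -> u c - e <= u x /\ u x <= u c + e.
  by move=> h1 h2; have := hu x h1 h2; rewrite ler_norml => /andP[? ?]; split; lra.
have mJ : measurable (J : set (measurableTypeR R)) by exact: measurable_itv.
have ib q := integrable_seg _ c (c + n^-1) (cwb q); have jf := integrable_seg _ _ _ cf.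
have lo : \int[mu]_(x in J) ((u c - e) * (n * hat (n * (x - c)))) <= \int[mu]_(x in J) f x.
  apply: (le_Rintegral mJ); [exact: ib|exact: jf|].
  move=> x; rewrite /J/= in_itv/= => /andP[h1 h2]; apply: ler_wpM2r => //.
  by have [] := hu' x h1 h2.
have hi : \int[mu]_(x in J) f x <= \int[mu]_(x in J) ((u c + e) * (n * hat (n * (x - c)))).
  apply: (le_Rintegral mJ); [exact: jf|exact: ib|].
  move=> x; rewrite /J/= in_itv/= => /andP[h1 h2]; apply: ler_wpM2r => //.
  by have [] := hu' x h1 h2.
move: lo hi; rewrite !tot ler_norml => *; apply/andP; split; lra.
Qed.

End SegmentIntegrals.

(** * Increments as integrals of the weak derivative *)

Section WeakIncrement.
Context {R : realType}.
Local Notation mu := (@lebesgue_measure R).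
Local Notation I01 := (`]0%R, 1%R[%classic : set R).

Lemma nat_large (M : R) : exists N : nat, forall n, (N <= n)%N -> M < n%:R.
Proof.
exists (Num.bound `|M|) => n Nn; apply: le_lt_trans (ler_norm M) _.
by apply: lt_le_trans (archi_boundP (normr_ge0 M)) _; rewrite ler_nat.
Qed.

Lemma cvg_seqP (f : nat -> R) (l : R) : (forall e, 0 < e -> exists N : nat, forall n, (N <= n)%N -> `|f n - l| < e) ->
  f n @[n --> \oo] --> l.
Proof.
move=> h; apply/cvgrPdist_lt => e /h[N hN]; exists N => // n /hN.
by rewrite distrC.
Qed.

Lemma within_cont {u : R -> R} {x : R} : {within `[0, 1], continuous u} -> 0 < x -> x < 1 ->
  {for x, continuous u}.
Proof.
move=> /(continuous_within_itvP _ (@ltr01 R))[h _ _] x0 x1.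
by apply: h; rewrite in_itv/= x0.
Qed.

Context {u v : R -> R} (uv : weak_derivative_01 u v) (cu : {within `[0, 1], continuous u}).
Context {a b : R} (a0 : 0 < a) (ab : a < b) (b1 : b < 1).

(** The test functions [phi n] approximate [ramp 1] times the indicator of ]a, b]. The offset s0
    makes b + 1 / s n <= c < 1 for every n, so they all vanish off the compact set [a, c]. *)
Let s0 := 2 / (1 - b).
Let s (n : nat) : R := n%:R + s0.
Let c := (1 + b) / 2.
Let phi n x : R := ramp (s n * (x - a)) - ramp (s n * (x - b)).
Let dphi n x : R := s n * hat (s n * (x - a)) - s n * hat (s n * (x - b)).

Let s00 : 0 < s0. Proof. by rewrite divr_gt0// subr_gt0. Qed.
Let s_gt0 n : 0 < s n. Proof. by rewrite ltr_wpDl. Qed.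
Let bc : b < c. Proof. by have := b1; rewrite /c; lra. Qed.
Let c1 : c < 1. Proof. by have := b1; rewrite /c; lra. Qed.
Let sb n : b + (s n)^-1 <= c.
Proof.
have : (s n)^-1 <= s0^-1 by rewrite lef_pV2 ?posrE// lerDr.
rewrite /s0 invf_div /c; lra.
Qed.

Let dv_sc n (q x : R) : dv (fun x : R => s n * (x - q)) x (s n).
Proof. by dstep; ring. Qed.

Let dv_phi n x : dv (phi n) x (dphi n x).
Proof.
have h q := dv_comp (f := ramp) (g := fun x : R => s n * (x - q)) (dv_ramp (s n * (x - q))) (dv_sc n q x).
by apply: dv_eq (dvB (h a) (h b)) _; rewrite /dphi; ring.
Qed.

Let phi_cont n : continuous (phi n).
Proof. by move=> x; exact: dv_cont (dv_phi n x). Qed.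

Let phi_out n x : ~ (a <= x <= c) -> phi n x = 0.
Proof.
have sn := s_gt0 n => h.
have [xa|ax] := leP x a.
  have xb := le_trans xa (ltW ab).
  by rewrite /phi !ramp_le0 ?subrr// pmulr_rle0// subr_le0.
have cx : c < x by rewrite ltNge; apply/negP => xc; apply: h; rewrite (ltW ax).
have xb : (s n)^-1 <= x - b by have := sb n; lra.
have xa : (s n)^-1 <= x - a by have := ab; lra.
by rewrite /phi !ramp_ge1 ?subrr// -ler_pdivrMl// mulr1.
Qed.

Let phi_test n : C1c_01 (phi n).
Proof.
have e : (phi n)^`()%classic = dphi n by apply/funext => x; exact: dv_derive1 (dv_phi n x).
split.
- by move=> x; exact: dv_derivable (dv_phi n x).
- rewrite e => x; have h q : {for x, continuous (fun x : R => s n * hat (s n * (x - q)))}.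
    apply: cvgM; first exact: cvg_cst.
    apply: (continuous_comp (f := fun x : R => s n * (x - q))); last exact: continuous_hat.
    exact: dv_cont (dv_sc n q x).
  by apply: cvgB; exact: h.
- exists `[a, c]%classic; split.
  + exact: segment_compact.
  + exact: sub_I01.
  + by move=> x h; apply: phi_out => hx; apply: h; rewrite /= in_itv.
Qed.

Let phi_bound n x : `|phi n x| <= ramp 1.
Proof.
have /andP[? ?] := ramp_bound (s n * (x - a)); have /andP[? ?] := ramp_bound (s n * (x - b)).
by rewrite ler_norml /phi; apply/andP; split; lra.
Qed.

Let left_limit : \int[mu]_(x in I01) (u x * dphi n x) @[n --> \oo] --> ramp 1 * (u a - u b).
Proof.
apply: cvg_seqP => e e0; have s1 := ramp1_gt0 (R := R).
have e'0 : 0 < e / (3 * ramp 1) by rewrite divr_gt0// mulr_gt0.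
have [d1 d10 h1] := near_abs (within_cont cu a0 (lt_trans ab b1)) e'0.
have [d2 d20 h2] := near_abs (within_cont cu (lt_trans a0 ab) b1) e'0.
have [N hN] := nat_large (Num.min d1 d2)^-1; exists N => n /hN Nn.
have m0 : 0 < Num.min d1 d2 by rewrite lt_min d10.
have sn : (s n)^-1 < Num.min d1 d2.
  rewrite -[ltRHS]invrK ltf_pV2 ?posrE ?invr_gt0//; apply: lt_le_trans Nn _.
  by rewrite lerDl ltW.
have [sn1 sn2] : (s n)^-1 < d1 /\ (s n)^-1 < d2 by move: sn; rewrite lt_min => /andP.
have cs q : 0 < q -> q + (s n)^-1 < 1 -> {within `[q, q + (s n)^-1], continuous u}.
  move=> q0 q1; apply: cont_within => x /andP[qx xq].
  by apply: (within_cont cu); [exact: lt_le_trans qx|exact: le_lt_trans q1].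
have sb' : b + (s n)^-1 < 1 by apply: le_lt_trans (sb n) c1.
have sa : a + (s n)^-1 < 1 by apply: lt_trans sb'; rewrite ltrD2r.
have near_q q d x : (s n)^-1 < d -> q <= x -> x <= q + (s n)^-1 -> `|x - q| < d.
  by move=> sd h h'; rewrite ger0_norm ?subr_ge0// ltrBlDl; apply: le_lt_trans h' _; rewrite ltrD2l.
have [i1 k1] := hat_approx u a (s n) (e / (3 * ramp 1)) a0 (s_gt0 n) sa (cs _ a0 sa)
  (fun x h h' => ltW (h1 x (near_q _ _ _ sn1 h h'))).
have b0 := lt_trans a0 ab.
have [i2 k2] := hat_approx u b (s n) (e / (3 * ramp 1)) b0 (s_gt0 n) sb' (cs _ b0 sb')
  (fun x h h' => ltW (h2 x (near_q _ _ _ sn2 h h'))).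
have -> : \int[mu]_(x in I01) (u x * dphi n x) = \int[mu]_(x in I01) (u x * (s n * hat (s n * (x - a))))
    - \int[mu]_(x in I01) (u x * (s n * hat (s n * (x - b)))).
  rewrite -RintegralB//; apply: eq_Rintegral => x _; rewrite /dphi; ring.
have e3 : ramp 1 * (e / (3 * ramp 1)) = e / 3 by field; rewrite gt_eqF.
have gen (I1 I2 A B : R) : `|I1 - ramp 1 * A| <= e / 3 -> `|I2 - ramp 1 * B| <= e / 3 ->
    `|I1 - I2 - ramp 1 * (A - B)| < e.
  by rewrite !ler_norml ltr_norml => /andP[? ?] /andP[? ?]; apply/andP; split; lra.
by apply: gen; rewrite -e3.
Qed.

Let right_limit : \int[mu]_(x in I01) (v x * phi n x) @[n --> \oo] -->
  ramp 1 * \int[mu]_(x in `[a, b]) v x.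
Proof.
have [_ lv _] := uv; have [mv _ _] := lv.
have iv := integrable_sub v a c a0 c1 lv.
have mJ : measurable (`[a, c]%classic : set (measurableTypeR R)) by exact: measurable_itv.
have s1 := ramp1_gt0 (R := R).
have mvJ : measurable_fun (`[a, c]%classic : set (measurableTypeR R)) v.
  exact: measurable_funS (sub_I01 a0 c1) mv.
have mphi n : measurable_fun (`[a, c]%classic : set (measurableTypeR R)) (phi n).
  by apply: measurable_funTS; exact: continuous_measurable_fun.
(* Half open because ramp 0 = 0: phi n vanishes at a and tends to [ramp 1] at b. *)
pose ind x : R := ramp 1 * \1_(`]a, b]%classic : set R) x.
have mind : measurable_fun (`[a, c]%classic : set (measurableTypeR R)) ind.
  by apply: measurable_funTS; apply: measurable_funM => //; exact: measurable_indic.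
pose f n x : \bar R := (v x * phi n x)%:E.
pose g x : \bar R := (ramp 1 * `|v x|)%:E.
have ptw x : a <= x -> phi n x @[n --> \oo] --> ind x.
  move=> ax; apply: cvg_seqP => e e0; rewrite /ind indicE.
  have stepq q : q < x -> exists N : nat, forall n, (N <= n)%N -> ramp (s n * (x - q)) = ramp 1.
    move=> qx; have [N hN] := nat_large (x - q)^-1; exists N => n /hN Nn; apply: ramp_ge1.
    rewrite -ler_pdivrMr ?subr_gt0// mul1r; apply: le_trans (ltW Nn) _.
    by rewrite lerDl ltW.
  move: ax; rewrite le_eqVlt => /orP[/eqP xa|ax].
    exists 0%N => n _; rewrite memNset ?mulr0 ?subr0; last by rewrite /= in_itv/= xa ltxx.
    by rewrite /phi -xa subrr mulr0 !ramp_le0 ?subrr ?normr0// pmulr_rle0// subr_le0 ltW.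
  have [N1 h1] := stepq a ax.
  have [xb|bx] := leP x b.
    exists N1 => n /h1 e1; rewrite mem_set ?mulr1; last by rewrite /= in_itv/= ax.
    by rewrite /phi e1 [ramp (s n * (x - b))]ramp_le0 ?subr0 ?subrr ?normr0// pmulr_rle0// subr_le0.
  have [N2 h2] := stepq b bx; exists (maxn N1 N2) => n; rewrite geq_max => /andP[/h1 e1 /h2 e2].
  rewrite memNset ?mulr0 ?subr0; last by rewrite /= in_itv/= => /andP[_]; rewrite leNgt bx.
  by rewrite /phi e1 e2 subrr normr0.
have gi : mu.-integrable `[a, c]%classic g.
  by refine (@eq_integrable _ _ R mu `[a, c]%classic mJ _ _ _ (integrableZl mJ (ramp 1) (integrable_abse iv))).
have [||||| fint _ flim] := @dominated_convergence _ (measurableTypeR R) R mu `[a, c]%classic mJ f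
    (fun x => (v x * ind x)%:E) g.
- by move=> n; apply/measurable_EFinP; exact: measurable_funM.
- by apply/measurable_EFinP; exact: measurable_funM.
- apply: aeW => x; rewrite /= in_itv/= => /andP[ax xc]; apply: cvg_EFin; first by apply: nearW.
  by apply: cvgM; [exact: cvg_cst|exact: ptw].
- exact: gi.
- have fg x : (forall n, `[a, c]%classic x -> (`|f n x| <= g x)%E).
    by move=> n _; rewrite /f /g /= lee_fin normrM mulrC ler_wpM2r.
  by apply: aeW; exact: fg.
have E n : \int[mu]_(x in I01) (v x * phi n x) = \int[mu]_(x in `[a, c]) (v x * phi n x).
  have [||//] := integrable_supp (fun x => v x * phi n x) a c a0 c1.
    by move=> x _ _ h; rewrite phi_out ?mulr0.
  apply: (le_integrable mJ (g := g)).
  - by apply/measurable_EFinP; exact: measurable_funM.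
  - move=> x _; rewrite /g /= lee_fin !normrM [`|ramp 1|]gtr0_norm// normr_id mulrC ler_wpM2r//.
  - exact: gi.
have L : \int[mu]_(x in `[a, c]) (v x * ind x) = ramp 1 * \int[mu]_(x in `[a, b]) v x.
  have sub : `]a, b]%classic `<=` `[a, c]%classic.
    by move=> x; rewrite /= !in_itv/= => /andP[? ?]; have := bc; move=> ?; apply/andP; split; lra.
  have iab : mu.-integrable `]a, b]%classic (EFin \o v) by apply: integrableS iv.
  have <- : \int[mu]_(x in `]a, b]) v x = \int[mu]_(x in `[a, b]) v x by exact: Rintegral_itv_obnd_cbnd.
  rewrite -RintegralZl// -[in RHS](setIidr sub).
  rewrite /Rintegral integral_mkcondr; congr fine; apply: eq_integral => x _.
  rewrite patchE /ind indicE; case: ifPn => _; first by rewrite mulr1 mulrC.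
  by rewrite !mulr0.
rewrite -L (_ : (fun n => _) = fine \o (fun n => \int[mu]_(x in `[a, c]) f n x)%E); last first.
  by apply/funext => n; rewrite E.
apply: fine_cvg; rewrite /Rintegral fineK; first exact: flim.
exact: integrable_fin_num.
Qed.

(** The derivative of [phi n] is a difference of approximate Dirac masses at a and b, while [phi n]
    itself converges boundedly; the two limits of the weak identity give the claim. *)
Lemma weak_increment : u b - u a = \int[mu]_(x in `[a, b]) v x.
Proof.
have [_ _ test] := uv; have s1 := ramp1_gt0 (R := R).
have E n : \int[mu]_(x in I01) (u x * dphi n x) = - \int[mu]_(x in I01) (v x * phi n x).
  have e : (phi n)^`()%classic = dphi n by apply/funext => x; exact: dv_derive1 (dv_phi n x).
  by have := test _ (phi_test n); rewrite e /Rintegral => ->; rewrite fineN.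
have := left_limit; rewrite (_ : (fun n => _) = fun n => - \int[mu]_(x in I01) (v x * phi n x)); last first.
  by apply/funext => n; rewrite E.
move=> h1.
have h2 : (- (\int[mu]_(x in I01) (v x * phi n x))) @[n --> \oo] --> - (ramp 1 * \int[mu]_(x in `[a, b]) v x).
  by apply: cvgN; exact: right_limit.
have h := cvg_unique (@Rhausdorff R) h1 h2; rewrite -mulrN in h.
have h3 : u a - u b = - (\int[mu]_(x in `[a, b]) v x).
  by apply: (mulfI (lt0r_neq0 s1)); exact: h.
by rewrite -opprB h3 opprK.
Qed.

End WeakIncrement.

(** * The energy of a competitor *)

Section Energy.
Context {R : realType} {p : R}.
Local Notation mu := (@lebesgue_measure R).
Local Notation I01 := (`]0%R, 1%R[%classic : set R).

Lemma wderiveP {u : R -> R} : admissible p u -> weak_derivative_01 u (wderive u).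
Proof. by move=> [_ [v [uv _ _]] _]; apply: (@xgetPex _ (cst 0)); exists v. Qed.

Lemma measurable_dens {u v : R -> R} : measurable_fun I01 u -> measurable_fun I01 v ->
  measurable_fun I01 (fun r => dens p r (u r) (v r)).
Proof.
move=> mu' mv; apply: measurable_funM => //.
apply: (measurableT_comp (measurable_powR (p / 2))).
apply: measurable_funD; first exact: measurable_funX.
apply: measurable_funM.
  apply: measurable_funX; apply: (measurableT_comp _ mu').
  by apply: continuous_measurable_fun; exact: continuous_sin.
apply: open_continuous_measurable_fun => // r; rewrite inE/= in_itv/= => /andP[r0 _].
by apply: cvgV; [rewrite expf_neq0// gt_eqF|exact: exprn_continuous].
Qed.

Lemma dens_ge0 (r h v : R) : 0 <= r -> 0 <= dens p r h v.
Proof. by move=> r0; rewrite mulr_ge0 ?powR_ge0. Qed.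

(** E b is the energy on ]0, b]. Integrating A + B v at v = [wderive u] turns the second term into
    an increment of u by [weak_increment]; from here on the weak derivative disappears. *)
Lemma energy_minorant {u : R -> R} : admissible p u -> (Ep p u < +oo)%E ->
  exists E, [/\ affine_minorant p u E, (forall b, 0 < b -> b < 1 -> E b <= fine (Ep p u)) &
    forall a, 0 < a -> a < 1 -> 0 <= E a].
Proof.
move=> au Efin; have uv := wderiveP au; have [cu _ _] := au.
have [[mu' _ _] lv _] := uv; have [mv _ _] := lv.
pose g r := dens p r (u r) (wderive u r).
have mg : measurable_fun I01 g by exact: measurable_dens.
have g0 r : I01 r -> 0 <= g r by rewrite /= in_itv/= => /andP[/ltW r0 _]; exact: dens_ge0.
have ig : mu.-integrable I01 (EFin \o g).
  apply/integrableP; split; first exact/measurable_EFinP.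
  suff -> : (\int[mu]_(r in I01) `|(EFin \o g) r| = Ep p u)%E by exact: Efin.
  by apply: eq_integral => r; rewrite inE => /g0 h; rewrite /= ger0_norm.
have sub b : b < 1 -> `]0, b]%classic `<=` I01.
  by move=> b1 r; rewrite /= !in_itv/= => /andP[-> rb]; exact: le_lt_trans b1.
have igb b : b < 1 -> mu.-integrable `]0, b]%classic (EFin \o g).
  by move=> b1; apply: integrableS ig => //; exact: sub.
pose E b := \int[mu]_(r in `]0, b]) g r.
exists E; split.
- move=> a b A B a0 ab b1 h.
  have bb : {within `[a, b], continuous (fun=> A : R)} by apply: continuous_subspaceT => x; exact: cvg_cst.
  have iA := integrable_seg _ _ _ bb.
  have iv := integrable_sub (wderive u) a b a0 b1 lv.
  have mab : measurable (`[a, b]%classic : set (measurableTypeR R)) by exact: measurable_itv.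
  have iBv : mu.-integrable `[a, b]%classic (EFin \o (fun x => B * wderive u x)).
    exact: (integrableZl mab B iv).
  have i1 : mu.-integrable `[a, b]%classic (EFin \o (fun x => A + B * wderive u x)).
    exact: (integrableD mab iA iBv).
  have i2 : mu.-integrable `[a, b]%classic (EFin \o g).
    by apply: integrableS ig => //; exact: sub_I01.
  have -> : A * (b - a) + B * (u b - u a) = \int[mu]_(x in `[a, b]) (A + B * wderive u x).
    rewrite RintegralD// RintegralZl// -(weak_increment uv cu a0 ab b1).
    rewrite (Rintegral_seg (fun x => A * x) _ _ _ ab)//; first by rewrite mulrBr.
    by move=> r _; dstep; ring.
  have -> : E b - E a = \int[mu]_(x in `[a, b]) g x.
    rewrite /E Rintegral_itvB ?bnd_simp//; [|exact: igb|exact: ltW|exact: ltW].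
    apply: Rintegral_itv_obnd_cbnd; apply: integrableS i2 => //.
    by apply: subset_itvr; rewrite bnd_simp.
  apply: (le_Rintegral mab i1 i2) => r; rewrite /= in_itv/= => /andP[ar rb].
  exact: h.
- move=> b b0 b1; rewrite /E /Rintegral fine_le//.
  + exact: (integrable_fin_num _ (igb _ b1)).
  + exact: (integrable_fin_num _ ig).
  + apply: ge0_subset_integral => //; first exact/measurable_EFinP.
      exact: sub.
- move=> a a0 a1; apply: Rintegral_ge0 => r; rewrite /= in_itv/= => /andP[/ltW r0 _].
  exact: dens_ge0.
Qed.

End Energy.

(** * Lower bound for the energy and its equality case *)

Section LowerBound.
Context {R : realType} {p : R} (hp1 : 1 < p) (hp2 : p < 2).
Local Ltac plra := move: (hp1) (hp2) => ? ?; lra.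
Let pi_pos : 0 < pi :> R := pi_gt0 R.
Context {X Y : R -> R} (hX : special (p := p) X Y) {tau : R} {Ti : R -> R}.
Hypothesis Ypos : forall t, t < tau -> 0 < Y t.
Hypothesis Xtau : pi / 2 < X tau.
Hypothesis XTi : forall u, 0 < u -> u < X tau -> Ti u < tau /\ X (Ti u) = u.
Hypothesis dTi : forall t, t < tau -> dv Ti (X t) (Y t)^-1.
Local Notation sig := (sig (p := p) (X := X) (Y := Y) (Ti := Ti)).

Context {u : R -> R} {l : R} (au : admissible p u) (ul : u 1 = l) (l0 : 0 < l) (lpi : l <= pi / 2).
Local Notation w := (fold \o u).
Local Notation cal := (cal (p := p) (X := X) (Y := Y) (Ti := Ti) (w := w)).

Let p2 : 0 < 2 - p. Proof. by rewrite subr_gt0. Qed.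
Let cu : {within `[0, 1], continuous u}. Proof. by case: au. Qed.

Let cw r : 0 < r -> r < 1 -> {for r, continuous w}.
Proof.
move=> r0 r1; apply: (continuous_comp (f := u)); first exact: within_cont cu r0 r1.
exact: continuous_fold.
Qed.

Let w0 r : 0 < r -> r < 1 -> 0 <= w r. Proof. by move=> _ _; exact: fold_ge0. Qed.
Let wpi r : 0 < r -> r < 1 -> w r <= pi / 2. Proof. by move=> _ _; exact: fold_le. Qed.

Let w_at1 : w x @[x --> 1^'-] --> l.
Proof.
have /(continuous_within_itvP _ (@ltr01 R))[_ _ c1] := cu.
rewrite -[X in _ --> X](fold_id l (ltW l0) lpi) -ul.
exact: (@continuous_cvg _ R R _ _ u fold _ (continuous_fold (u 1)) c1).
Qed.

(** The calibrating function tends to sig l at 1, and to 0 at 0, where r^(2 - p) -> 0 and sig is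
    bounded. Restricting to a < y and b > x lets the equality case single out the interval from y to
    x. *)
Lemma cal_limit M y x : 0 < y -> x < 1 ->
  (forall a b, 0 < a -> a < y -> x < b -> b < 1 -> cal b - cal a <= M) -> sig l <= M.
Proof.
move=> y0 x1 h; rewrite leNgt; apply/negP => Ml.
pose d := sig l - M; have d0 : 0 < d by rewrite subr_gt0.
have c1 : cal x @[x --> 1^'-] --> sig l.
  have sl : {for l, continuous sig}.
    apply: dv_cont (dv_sig hp1 hp2 hX Ypos XTi dTi l l0 _); exact: le_lt_trans lpi Xtau.
  have pw : (r : R) `^ (2 - p) @[r --> 1^'-] --> (1 : R).
    have e1 : (1 : R) `^ (2 - p) = 1 by rewrite powR1.
    rewrite -[X in _ --> X]e1; apply: cvg_at_left_filter.
    exact: dv_cont (is_derive1_powR _ ltr01).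
  rewrite -[sig l]mul1r; apply: cvgM pw _.
  exact: (@continuous_cvg _ R R _ _ w sig _ sl w_at1).
have d2 : 0 < d / 2 by rewrite divr_gt0.
have [b [xb b1 cb]] : exists b, [/\ x < b, b < 1 & sig l - d / 2 < cal b].
  have /cvgrPdist_lt/(_ _ d2) c2 := c1.
  have c3 : \forall b \near 1^'-, x < b /\ (b < 1 /\ `|sig l - cal b| < d / 2).
    by apply: filter_app c2; near=> b => ?.
  have [b [? [? hb]]] := filter_ex c3; exists b; split=> //.
  by move: hb; rewrite ltr_norml => /andP[? ?]; lra.
(* As sig <= 1 / (2 - p), a^(2 - p) <= q gives cal a <= d / 4. *)
pose q := d * (2 - p) / 4; have q0 : 0 < q by rewrite divr_gt0// mulr_gt0.
pose a := Num.min (y / 2) (q `^ (2 - p)^-1).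
have a0 : 0 < a by rewrite lt_min powR_gt0// divr_gt0.
have ay : a < y.
  have : a <= y / 2 by rewrite ge_min lexx.
  lra.
have ca : cal a <= d / 4.
  have aq : a `^ (2 - p) <= q.
    have -> : q = (q `^ (2 - p)^-1) `^ (2 - p).
      by rewrite -powRrM mulVf ?gt_eqF// powRr1// ltW.
    apply: ge0_ler_powR; rewrite ?nnegrE ?powR_ge0 ?(ltW p2) ?(ltW a0)//.
    by rewrite ge_min lexx orbT.
  have sl := sig_le hp1 hp2 hX Xtau XTi (w a) (fold_le _).
  have sg := sig_ge0 hp1 hp2 hX Xtau XTi (w a) (fold_le _).
  apply: (le_trans (y := q * (2 - p)^-1)); first by apply: ler_pM; rewrite ?powR_ge0.
  by rewrite /q mulrAC mulfK ?gt_eqF.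
have := h a b a0 ay xb b1; rewrite /d in ca cb d0 *; lra.
Unshelve. all: by end_near. Qed.

Lemma energy_lower : ((sig l)%:E <= Ep p u)%E.
Proof.
have [Efin|] := ltP (Ep p u) +oo%E; last by apply: le_trans; rewrite leey.
have [E [hE Eb Ea]] := energy_minorant au Efin.
have E0 : (0 <= Ep p u)%E.
  apply: integral_ge0 => r; rewrite /= in_itv/= => /andP[/ltW r0 _].
  by rewrite lee_fin; exact: (dens_ge0 (p := p) r (u r) (wderive u r) r0).
have fE : Ep p u \is a fin_num by rewrite ge0_fin_numE.
rewrite -(fineK fE) lee_fin.
have h1 : 0 < (1 / 2 : R) by [].
apply: (cal_limit _ (1 / 2) (1 / 2)) => //; first by lra.
move=> a b a0 a1 b0 b1; apply: (le_trans (y := E b - E a)).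
  apply: (cal_lower hp1 hp2 hX Ypos Xtau XTi dTi (fold_minorant hE) cw w0 wpi) => //.
  exact: ltW (lt_trans a1 b0).
rewrite -[leRHS]subr0; apply: lerB; [apply: Eb => //; exact: lt_trans h1 b0|].
by apply: Ea => //; lra.
Qed.

(** A positive defect between y and x would add to the lower bounds on the two outer intervals and
    push the energy above sig l. So equality holds on every interval, and [rigidity] applies. *)
Lemma energy_rigid : (Ep p u <= (sig l)%:E)%E ->
  exists C, forall r, 0 < r -> r < 1 -> fold (u r) = X (ln r + C) /\ fold (u r) < pi / 2.
Proof.
move=> Eu; have Efin : (Ep p u < +oo)%E by apply: le_lt_trans Eu _; rewrite ltry.
have [E [hE Eb Ea]] := energy_minorant au Efin.
have fE : Ep p u \is a fin_num.
  by rewrite fin_numElt Efin andbT; apply: lt_le_trans energy_lower; rewrite ltNyr.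
have {}Eu : fine (Ep p u) <= sig l by move: Eu; rewrite -{1}(fineK fE) lee_fin.
have low a b : 0 < a -> a <= b -> b < 1 -> cal b - cal a <= E b - E a.
  by apply: (cal_lower hp1 hp2 hX Ypos Xtau XTi dTi (fold_minorant hE) cw w0 wpi).
have eqE y x : 0 < y -> y < x -> x < 1 -> cal x - cal y = E x - E y.
  move=> y0 yx x1; have l0' := low y x y0 (ltW yx) x1.
  have h : sig l <= sig l - ((E x - E y) - (cal x - cal y)).
    apply: (cal_limit _ y x y0 x1) => a b a0 ay xb b1.
    have l1 := low a y a0 (ltW ay) (lt_trans yx x1).
    have l2 := low x b (lt_trans y0 yx) (ltW xb) b1.
    have b0 : 0 < b by apply: lt_trans xb; exact: lt_trans yx.
    have e1 := Eb b b0 b1; have e2 := Ea a a0 (lt_trans ay (lt_trans yx x1)).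
    lra.
  by apply/eqP; rewrite eq_le l0'/=; move: h; rewrite lerBrDl gerDr subr_le0.
have [r1 [r10 r11 wr1]] : exists r1, [/\ 0 < r1, r1 < 1 & 0 < w r1].
  have /cvgrPdist_lt/(_ _ l0) c2 := w_at1.
  have c3 : \forall b \near 1^'-, 0 < b /\ (b < 1 /\ `|l - w b| < l).
    by apply: filter_app c2; near=> b => ?.
  have [b [? [? hb]]] := filter_ex c3; exists b; split=> //.
  by move: hb; rewrite ltr_norml => /andP[? ?]; lra.
have [C hC] := rigidity hp1 hp2 hX Ypos Xtau XTi dTi (fold_minorant hE) cw wpi eqE r1 r10 r11 wr1.
exists C => r r0 rl; split; first exact: hC.
exact: (w_lt_pihalf hp1 hp2 hX Ypos Xtau XTi dTi (fold_minorant hE) cw wpi eqE r r0 rl).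
Unshelve. all: by end_near. Qed.

End LowerBound.

(** * Minimizers *)

Section ClassicalCompetitor.
Context {R : realType} {p : R} (hp1 : 1 < p).
Local Notation mu := (@lebesgue_measure R).
Local Notation I01 := (`]0%R, 1%R[%classic : set R).

Lemma within_bounded {U : R -> R} : {within `[0, 1], continuous U} ->
  exists M, forall r, 0 <= r -> r <= 1 -> `|U r| <= M.
Proof.
move=> cU; have /compact_bounded[M [_ hM]] := continuous_compact cU (@segment_compact _ _ _).
exists (M + 1) => r r0 r1; apply: (hM (M + 1)); first by rewrite ltrDl.
by exists r => //; rewrite /= in_itv/= r0.
Qed.

Lemma within_measurable {U : R -> R} : {within `[0, 1], continuous U} -> measurable_fun I01 U.
Proof.
move=> cU; apply: open_continuous_measurable_fun => // r; rewrite inE/= in_itv/= => /andP[r0 r1].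
exact: within_cont.
Qed.

Lemma bounded_integrable {f : R -> R} M : measurable_fun I01 f ->
  (forall r, 0 < r -> r < 1 -> `|f r| <= M) -> mu.-integrable I01 (EFin \o f).
Proof.
move=> mf hM.
have fin : (lebesgue_measure I01 < +oo)%E by rewrite lebesgue_measure_itv/= lte_fin ltr01 -EFinB ltry.
apply: (measurable_bounded_integrable _ fin mf); first exact: measurable_itv.
exists M; split; first exact: num_real.
move=> N MN r /=; rewrite in_itv/= => /andP[r0 r1].
exact: le_trans (hM r r0 r1) (ltW MN).
Qed.

Context {U V : R -> R} (cU : {within `[0, 1], continuous U}) (cV : {within `[0, 1], continuous V}).
Hypothesis dU : forall r, 0 < r -> r < 1 -> dv U r (V r).

Let within_integrable {W : R -> R} : {within `[0, 1], continuous W} -> mu.-integrable I01 (EFin \o W).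
Proof.
move=> cW; have [M hM] := within_bounded cW.
apply: (bounded_integrable M); first exact: within_measurable.
by move=> r r0 r1; apply: hM; exact: ltW.
Qed.

Let open01 : open I01. Proof. exact: interval_open. Qed.

Let LR : derivable_oo_LRcontinuous U 0 1.
Proof.
have /(continuous_within_itvP _ (@ltr01 R))[_ h0 h1] := cU; split=> //.
by move=> r; rewrite in_itv/= => /andP[r0 r1]; exact: dv_derivable (dU r r0 r1).
Qed.

Lemma weak_of_classical : weak_derivative_01 U V.
Proof.
split; [exact: open_integrable_locally open01 (within_integrable cU)|
  exact: open_integrable_locally open01 (within_integrable cV)|].
move=> phi [dphi cphi [K [cK K01 Kout]]].
have K0 (x : R) : x <= 0 \/ 1 <= x -> phi x = 0.
  move=> hx; apply: Kout => /K01; rewrite /= in_itv/= => /andP[? ?].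
  by case: hx; rewrite leNgt => /negP.
have cphi' : continuous phi by move=> x; apply: dv_cont; exact: derivable_dv.
have mphi : measurable_fun I01 phi by apply: measurable_funTS; exact: continuous_measurable_fun.
have mdphi : measurable_fun I01 (phi^`()%classic).
  by apply: measurable_funTS; exact: continuous_measurable_fun.
have Lphi : derivable_oo_LRcontinuous phi 0 1.
  split=> [r _| |]; [exact: dphi|apply: cvg_at_right_filter; exact: cphi'|].
  by apply: cvg_at_left_filter; exact: cphi'.
have := @integration_by_parts R U phi V (phi^`()%classic) 0 1 ltr01 cV LR.
move=> /(_ _ (continuous_subspaceT cphi) Lphi (fun r _ => erefl)).
have k0 : phi 0 = 0 by apply: K0; left.
have k1 : phi 1 = 0 by apply: K0; right.
have e (W psi : R -> R) : measurable_fun I01 W -> measurable_fun I01 psi ->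
    (\int[mu]_(x in `[0%R, 1%R]) (W x * psi x)%:E = \int[mu]_(x in I01) (W x * psi x)%:E)%E.
  move=> mW mpsi; apply: integral_itv_bndoo; apply/measurable_EFinP; exact: measurable_funM.
have mU := within_measurable cU; have mV := within_measurable cV.
rewrite k0 k1 !mulr0 subrr sub0e (e _ _ mU mdphi) (e _ _ mV mphi).
by apply => r; rewrite in_itv/= => /andP[r0 r1]; exact: dv_derive1 (dU r r0 r1).
Qed.

Lemma admissible_classical : admissible p U.
Proof.
have uv := weak_of_classical; split=> //.
  by exists V; split=> //; exact: within_integrable.
have pw (W : R -> R) : {within `[0, 1], continuous W} -> locally_integrable I01 (fun x => `|W x| `^ p).
  move=> cW; apply: open_integrable_locally => //; have [M hM] := within_bounded cW.
  apply: (bounded_integrable (M `^ p)).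
    apply: (measurableT_comp (measurable_powR p)); apply: measurableT_comp => //.
    exact: within_measurable.
  move=> r /ltW r0 /ltW r1; rewrite ger0_norm ?powR_ge0//.
  apply: ge0_ler_powR; rewrite ?nnegrE ?hM//; first exact: ltW (lt_trans ltr01 hp1).
  exact: le_trans (normr_ge0 (W r)) (hM r r0 r1).
by exists V; split=> //; exact: pw.
Qed.

(** [wderive] is an arbitrary choice of weak derivative, so it equals V only almost everywhere. By
    [weak_increment] its integrals are the increments of U, and Lebesgue's differentiation theorem
    applies on each [a n, b n]; these exhaust (0, 1). *)
Lemma wderive_ae : {ae mu, forall r, I01 r -> wderive U r = V r}.
Proof.
have uv := wderiveP admissible_classical; have [_ lv _] := uv.
(* With n + 3 the interval is nondegenerate already for n = 0. *)
pose a (n : nat) : R := n.+3%:R^-1; pose b n : R := 1 - a n.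
have a0 n : 0 < a n by rewrite invr_gt0.
have a3 n : a n <= 3^-1 by rewrite lef_pV2 ?posrE// ler_nat.
have ab n : a n < b n by have := a3 n; rewrite /b; lra.
have b1 n : b n < 1 by rewrite /b gtrBl.
pose f n : R -> R := wderive U \_ `[a n, b n].
have key n : {ae mu, forall r, a n < r -> r < b n -> wderive U r = V r}.
  have iab := integrable_sub (wderive U) (a n) (b n) (a0 n) (b1 n) lv.
  have mab : measurable (`[a n, b n]%classic : set (measurableTypeR R)) by exact: measurable_itv.
  have lf : locally_integrable setT (f n) by exact: integrable_locally_restrict.
  have fint y : mu.-integrable `[a n, y]%classic (EFin \o f n).
    have : mu.-integrable setT (EFin \o f n).
      by rewrite /f -restrict_EFin; apply/(integrable_mkcond _ mab).
    by apply: integrableS.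
  have := FTC1 fint lf; apply: filterS; first exact: (ae_filter_ringOfSetsType mu).
  move=> r h ar rb.
  case: h => [|_ e].
    by rewrite lte_fin.
  rewrite -[LHS](_ : f n r = _); last by rewrite /f patchE mem_set//= in_itv/= !ltW.
  rewrite -e; apply: dv_derive1.
  apply: (dv_near (f := fun x => U x - U (a n))).
    near=> x.
    have ax : a n < x by near: x; exact: lt_nbhsr.
    have xb : x < b n by near: x; exact: lt_nbhsl.
    rewrite (weak_increment uv cU (a0 n) ax (lt_trans xb (b1 n))).
    apply: eq_Rintegral => z; rewrite inE/= in_itv/= => /andP[az zx].
    by rewrite /f patchE mem_set//= in_itv/= az (le_trans zx (ltW xb)).
  have d := dU r (lt_trans (a0 n) ar) (lt_trans rb (b1 n)).
  by dstep; ring.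
apply: filterS (ae_foralln key) => r h; rewrite /= in_itv/= => /andP[r0 r1].
have m0 : 0 < Num.min r (1 - r) by rewrite lt_min r0 subr_gt0.
have [N hN] := nat_large (Num.min r (1 - r))^-1.
have : a N < Num.min r (1 - r).
  rewrite -[ltRHS]invrK ltf_pV2 ?posrE ?invr_gt0//; apply: lt_trans (hN N (leqnn N)) _.
  by rewrite ltr_nat -addn3 -[ltnLHS]addn0 ltn_add2l.
by rewrite lt_min => /andP[h1 h2]; apply: (h N); rewrite /b; lra.
Unshelve. all: by end_near. Qed.

Lemma Ep_classical : Ep p U = (\int[mu]_(r in I01) (dens p r (U r) (V r))%:E)%E.
Proof.
have uv := wderiveP admissible_classical; have [_ [mw _ _] _] := uv.
have mU := within_measurable cU; have mV := within_measurable cV.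
apply: ae_eq_integral => //.
- by apply/measurable_EFinP; exact: (measurable_dens (p := p) mU mw).
- by apply/measurable_EFinP; exact: (measurable_dens (p := p) mU mV).
- have := wderive_ae; apply: filterS; first exact: (ae_filter_ringOfSetsType mu).
  by move=> r h /h e; rewrite e.
Qed.

End ClassicalCompetitor.

(** * Energy of the dilations of the special solution *)

Section Minimizers.
Context {R : realType} {p : R} (hp1 : 1 < p) (hp2 : p < 2).
Local Ltac plra := move: (hp1) (hp2) => ? ?; lra.
Let pi_pos : 0 < pi :> R := pi_gt0 R.
Local Notation mu := (@lebesgue_measure R).
Local Notation I01 := (`]0%R, 1%R[%classic : set R).

Lemma cvg_at0 (f : R -> R) v : (forall e, 0 < e -> exists2 d, 0 < d & forall r, 0 < r -> r < d -> `|f r - v| < e) ->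
  f r @[r --> 0^'+] --> v.
Proof.
move=> h; apply/cvgrPdist_lt => e /h[d d0 hd]; exists d => // r.
rewrite /= sub0r normrN => rd r0; rewrite distrC; apply: hd => //.
by rewrite -(gtr0_norm r0).
Qed.

Lemma within_eq {f g : R -> R} : {within `[0, 1], continuous f} -> {within `[0, 1], continuous g} ->
  (forall r, 0 < r -> r < 1 -> f r = g r) -> forall r, 0 <= r -> r <= 1 -> f r = g r.
Proof.
move=> /(continuous_within_itvP _ (@ltr01 R))[_ f0 f1] /(continuous_within_itvP _ (@ltr01 R))[_ g0 g1] e r.
have n0 : \forall r \near 0^'+, g r = f r.
  by near=> z; apply/esym/e.
have n1 : \forall r \near 1^'-, g r = f r.
  by near=> z; apply/esym/e.
rewrite le_eqVlt => /orP[/eqP<- _|r0].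
  by apply: (cvg_unique (@Rhausdorff R) f0); apply: cvg_trans g0; exact: near_eq_cvg.
rewrite le_eqVlt => /orP[/eqP->|r1]; last exact: e.
by apply: (cvg_unique (@Rhausdorff R) f1); apply: cvg_trans g1; exact: near_eq_cvg.
Unshelve. all: by end_near. Qed.

Context {X Y : R -> R} (hX : special (p := p) X Y) {tau : R} {Ti : R -> R}.
Hypothesis Ypos : forall t, t < tau -> 0 < Y t.
Hypothesis Xtau : pi / 2 < X tau.
Hypothesis XTi : forall u, 0 < u -> u < X tau -> Ti u < tau /\ X (Ti u) = u.
Hypothesis TiX : forall t, t < tau -> Ti (X t) = t.
Hypothesis dTi : forall t, t < tau -> dv Ti (X t) (Y t)^-1.
Local Notation sig := (sig (p := p) (X := X) (Y := Y) (Ti := Ti)).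
Local Notation prof := (profile (X := X)).

Section Dilation.
Context {al : R} (al0 : 0 < al).
Let U r : R := prof (al * r).

Lemma dilation_within : {within `[0, 1], continuous U}.
Proof.
have dP r : 0 < r -> {for r, continuous U}.
  move=> r0; have := dv_global (sp_sol hX) (f := prof) profileE (al * r) (mulr_gt0 al0 r0) => d.
  have d2 : dv (fun r => al * r) r al by dstep; ring.
  exact: (dv_cont (dv_comp (f := prof) (g := fun r => al * r) d d2)).
apply/(continuous_within_itvP _ (@ltr01 R)); split.
- by move=> r; rewrite in_itv/= => /andP[r0 _]; exact: dP.
- rewrite /U mulr0 profile0; apply: cvg_at0 => e e0.
  exists (Num.min al^-1 (e / (2 * al))); first by rewrite lt_min invr_gt0 al0 divr_gt0// mulr_gt0.
  move=> r r0; rewrite lt_min => /andP[r1 r2]; have ar := mulr_gt0 al0 r0.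
  rewrite subr0 profileE//; have /andP[x0 _] := sp_strip hp1 hp2 hX (ln (al * r)).
  rewrite gtr0_norm//; apply: (le_lt_trans (y := 2 * expR (ln (al * r)))).
    apply: (sp_X_le hX); rewrite -ler_expR lnK ?posrE// expR0.
    by rewrite mulrC -ler_pdivlMr// mul1r ltW.
  by rewrite lnK ?posrE//; move: r2; rewrite ltr_pdivlMr ?mulr_gt0//; lra.
- by apply: cvg_at_left_filter; exact: dP.
Qed.

Lemma dilation_slope : exists V : R -> R, [/\ {within `[0, 1], continuous V},
  (forall r, 0 < r -> V r = Y (ln (al * r)) / r), (forall r, 0 < r -> {for r, continuous V}) &
  forall r, 0 < r -> dv U r (V r)].
Proof.
have [g [cg _ gE]] := profile_slope hp1 hp2 hX.
pose V r := al * g (al * r).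
have VE r : 0 < r -> V r = Y (ln (al * r)) / r.
  by move=> r0; rewrite /V gE ?mulr_gt0//; field; rewrite !gt_eqF.
have cV r : 0 < r -> {for r, continuous V}.
  move=> r0; apply: (cont_near (f := fun r => al * (Y (ln (al * r)) / (al * r)))).
    by apply: near_pos => // s s0; rewrite /V gE ?mulr_gt0.
  have d := dv_global1 (sp_sol hX) (al * r) (mulr_gt0 al0 r0).
  have d2 : dv (fun r => al * r) r al by dstep; ring.
  have d3 := dv_comp (f := fun r => Y (ln r) / r) (g := fun r => al * r) d d2.
  exact: (dv_cont (dvM (dv_cst al r) d3)).
exists V; split=> //.
- apply/(continuous_within_itvP _ (@ltr01 R)); split.
  + by move=> r; rewrite in_itv/= => /andP[r0 _]; exact: cV.
  + rewrite {2}/V mulr0; apply: cvg_at0 => e e0.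
    have i0 : (`[0, +oo[%classic : set R) 0 by rewrite /= in_itv/= lexx.
    have /subspace_continuousP/(_ 0 i0) c0 := cg.
    have /cvgrPdist_lt/(_ _ (divr_gt0 e0 al0)) h := c0.
    have [d d0 hd] := near_pball h.
    exists (d / al); first by rewrite divr_gt0.
    move=> r r0; rewrite ltr_pdivlMr// mulrC => rd; have ar := mulr_gt0 al0 r0.
    rewrite /V -mulrBr normrM (gtr0_norm al0) mulrC -ltr_pdivlMr// distrC; apply: hd.
      by rewrite subr0 gtr0_norm.
    by rewrite /= in_itv/= ltW.
  + by apply: cvg_at_left_filter; exact: cV.
- move=> r r0; rewrite VE//.
  have d := dv_global (sp_sol hX) (f := prof) profileE (al * r) (mulr_gt0 al0 r0).
  have d2 : dv (fun r => al * r) r al by dstep; ring.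
  apply: dv_eq (dv_comp (f := prof) (g := fun r => al * r) d d2) _.
  by field; rewrite !gt_eqF.
Qed.

End Dilation.

Section Competitor.
Context {l : R} (l0 : 0 < l) (lpi : l <= pi / 2).
(** The dilation that takes the value l at r = 1 while still on the increasing branch. *)
Let al : R := expR (Ti l).
Let U r : R := prof (al * r).

Let al0 : 0 < al. Proof. exact: expR_gt0. Qed.
Let lt : l < X tau. Proof. exact: le_lt_trans Xtau. Qed.
Let p2 : 0 < 2 - p. Proof. by rewrite subr_gt0. Qed.

Let UE r : 0 < r -> U r = X (Ti l + ln r).
Proof. by move=> r0; rewrite /U profileE ?mulr_gt0// lnM ?posrE// /al expRK. Qed.

Let U1 : U 1 = l.
Proof. by rewrite UE// ln1 addr0; have [_ ->] := XTi l l0 lt. Qed.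

Let before r : 0 < r -> r <= 1 -> Ti l + ln r < tau.
Proof.
move=> r0 r1; have [h _] := XTi l l0 lt; apply: le_lt_trans h.
by rewrite gerDl -ln1 ler_ln ?posrE.
Qed.

Let XmonoTau t : t < tau -> X t < X tau.
Proof.
move=> tt; apply: (incr_dv tt (f := X) (df := Y)) => [s _|s /andP[_ st]].
  exact: (sp_sol hX s).1.
exact: Ypos.
Qed.

Let pow_small e : 0 < e -> exists2 d, 0 < d & forall r, 0 < r -> r < d -> r `^ (2 - p) < e.
Proof.
move=> e0; exists (e `^ (2 - p)^-1); first exact: powR_gt0.
move=> r r0 rd; have -> : e = (e `^ (2 - p)^-1) `^ (2 - p).
  by rewrite -powRrM mulVf ?gt_eqF// powRr1// ltW.
by apply: gt0_ltr_powR; rewrite ?nnegrE ?powR_ge0 ?(ltW r0).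
Qed.

(** Along this dilation the slope is the special one, so the density f is exactly the derivative of
    F = r^(2 - p) sig (U r), which vanishes at 0 and equals sig l at 1. *)
Lemma competitor_energy : admissible p U /\ Ep p U = (sig l)%:E.
Proof.
have cU := dilation_within al0; have [V [cV VE cVr dU]] := dilation_slope al0.
have dU' r : 0 < r -> r < 1 -> dv U r (V r) by move=> r0 _; exact: dU.
split; first exact: (admissible_classical hp1 cU cV dU').
rewrite (Ep_classical hp1 cU cV dU').
pose f r := dens p r (U r) (V r); pose F r := r `^ (2 - p) * sig (U r).
have sU r : 0 < r -> 0 < sin (U r).
  by move=> r0; apply: sin_gt0_pi; rewrite UE//; exact: (sp_strip hp1 hp2 hX).
have cf r : 0 < r -> {for r, continuous f}.
  move=> r0; apply: cvgM; first exact: cvg_id.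
  pose N r := V r ^+ 2 + sin (U r) ^+ 2 / r ^+ 2.
  have cN : {for r, continuous N}.
    have c1 := cVr r r0; have dS := dv_sin (dU r r0).
    apply: cvgD; first by apply: (continuous_comp (f := V) (g := fun z : R => z ^+ 2)) => //; exact: exprn_continuous.
    apply: cvgM.
      apply: (continuous_comp (f := fun r => sin (U r)) (g := fun z : R => z ^+ 2)); last exact: exprn_continuous.
      exact: dv_cont dS.
    by apply: cvgV; [rewrite expf_neq0// gt_eqF|exact: exprn_continuous].
  have N0 : 0 < N r.
    by rewrite /N ltr_wpDl ?sqr_ge0// divr_gt0// exprn_gt0// sU.
  apply: (continuous_comp (f := N) (g := fun z : R => z `^ (p / 2))) => //.
  exact: dv_cont (is_derive1_powR _ N0).
have dF r : 0 < r -> r <= 1 -> dv F r (f r).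
  move=> r0 r1; have tt := before r r0 r1.
  have U0 : 0 < U r by rewrite UE//; have /andP[] := sp_strip hp1 hp2 hX (Ti l + ln r).
  have Ut : U r < X tau by rewrite UE//; exact: XmonoTau.
  have sp : speed (Y := Y) (Ti := Ti) (U r) = Y (Ti l + ln r) by rewrite /speed UE// TiX.
  have VrE : V r = speed (Y := Y) (Ti := Ti) (U r) / r.
    by rewrite sp VE// lnM ?posrE// /al expRK.
  have dS := dv_comp (f := sig) (g := U) (dv_sig hp1 hp2 hX Ypos XTi dTi (U r) U0 Ut) (dU r r0).
  have dp : dv (fun r => r `^ (2 - p)) r ((2 - p) * r `^ (2 - p - 1)) := is_derive1_powR _ r0.
  have [e1 e2] := frozen_identities hp1 hp2 Ypos XTi r (U r) r0 U0 Ut.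
  apply: dv_eq (dvM dp dS) _.
  have -> : f r = Lag p r (sin (U r) / r) (V r).
    by rewrite /f /dens /Lag expr_div_n.
  rewrite -VrE in e1 e2.
  by rewrite [_ * (_ * V r)]mulrA -e1 -mulrA [sig _ * _]mulrC in e2 *; rewrite -?e2; ring.
have F0 : F 0 = 0 by rewrite /F powR0 ?mul0r// gt_eqF.
have LR : derivable_oo_LRcontinuous F 0 1.
  split.
  - by move=> r; rewrite in_itv/= => /andP[r0 /ltW r1]; exact: dv_derivable (dF r r0 r1).
  - rewrite F0; apply: cvg_at0 => e e0.
    have [d d0 hd] := pow_small _ (mulr_gt0 e0 p2).
    exists (Num.min d 1) => [|r r0]; first by rewrite lt_min d0 ltr01.
    rewrite lt_min => /andP[rd /ltW r1]; rewrite subr0 /F.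
    have Ul : U r <= pi / 2.
      apply: le_trans lpi; rewrite -[leRHS]U1 le_eqVlt; have [->|rn1] := eqVneq r 1; first by rewrite eqxx.
      have r1' : r < 1 by rewrite lt_neqAle rn1.
      apply/orP; right; apply: (incr_dv r1' (f := U) (df := V)) => [s /andP[rs _]|s /andP[rs s1]].
        by apply: dU; exact: lt_le_trans rs.
      have s0 : 0 < s by exact: lt_trans rs.
      by rewrite VE// divr_gt0//; apply: Ypos; have := before s s0 (ltW s1); rewrite lnM ?posrE// /al expRK.
    have s1 := sig_le hp1 hp2 hX Xtau XTi (U r) Ul; have s0 := sig_ge0 hp1 hp2 hX Xtau XTi (U r) Ul.
    rewrite ger0_norm ?mulr_ge0 ?powR_ge0//.
    apply: (le_lt_trans (y := r `^ (2 - p) * (2 - p)^-1)); first by rewrite ler_wpM2l ?powR_ge0.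
    by rewrite ltr_pdivrMr//; exact: hd.
  - by apply: cvg_at_left_filter; exact: (dv_cont (dF 1 ltr01 (lexx 1))).
have cf01 : {within `[0, 1], continuous f}.
  apply/(continuous_within_itvP _ (@ltr01 R)); split.
  - by move=> r; rewrite in_itv/= => /andP[r0 _]; exact: cf.
  (* The density has a factor r, and the power beside it stays bounded near 0 because V is bounded
     and sin (U r) <= 2 al r. *)
  - have f0 : f 0 = 0 by rewrite /f /dens mul0r.
    rewrite f0; apply: cvg_at0 => e e0.
    have [M hM] := within_bounded cV.
    have M0 : 0 <= M by apply: le_trans (normr_ge0 (V 0)) (hM 0 (lexx 0) ler01).
    pose B := M ^+ 2 + (2 * al) ^+ 2; have B0 : 0 <= B by rewrite addr_ge0 ?sqr_ge0.
    pose K := B `^ (p / 2) + 1; have K0 : 0 < K by rewrite ltr_wpDl ?powR_ge0.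
    exists (Num.min (e / K) (Num.min al^-1 1)); first by rewrite !lt_min divr_gt0// invr_gt0 al0 ltr01.
    move=> r r0; rewrite !lt_min => /andP[r1 /andP[r2 /ltW r3]].
    have al1 : al * r <= 1 by rewrite mulrC -ler_pdivlMr// mul1r ltW.
    have Ur : 0 < U r /\ U r <= 2 * (al * r).
      rewrite /U profileE ?mulr_gt0//; split; first by have /andP[] := sp_strip hp1 hp2 hX (ln (al * r)).
      rewrite -{2}[al * r]lnK ?posrE ?mulr_gt0//; apply: (sp_X_le hX).
      by rewrite -ler_expR lnK ?posrE ?mulr_gt0// expR0.
    rewrite subr0 ger0_norm; last exact: (dens_ge0 (p := p) r (U r) (V r) (ltW r0)).
    have N1 : V r ^+ 2 + sin (U r) ^+ 2 / r ^+ 2 <= B.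
      apply: lerD.
        by rewrite -[V r ^+ 2]real_normK ?num_real// ler_sqr ?nnegrE//; apply: hM => //; exact: ltW.
      rewrite -expr_div_n ler_sqr ?nnegrE ?divr_ge0 ?mulr_ge0 ?(ltW r0) ?(ltW al0) ?(ltW (sU _ r0))//.
      rewrite ler_pdivrMr//; case: Ur => Ur0 Ur1; apply: le_trans (sin_le_id _ (ltW Ur0)) _.
      by rewrite -mulrA.
    apply: (le_lt_trans (y := r * K)); last by rewrite -ltr_pdivlMr.
    rewrite /f /dens ler_pM2l// /K; apply: le_trans (_ : B `^ (p / 2) <= _); last by rewrite lerDl.
    apply: ge0_ler_powR; rewrite ?nnegrE//; first by plra.
    by rewrite addr_ge0 ?divr_ge0 ?sqr_ge0.
  - by apply: cvg_at_left_filter; exact: cf.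
have mf : measurable_fun I01 (fun r => (f r)%:E) by apply/measurable_EFinP; exact: within_measurable.
have e1 := @integral_itv_bndoo R 0 1 (fun r => (f r)%:E) true false mf.
rewrite -[LHS]e1 (@continuous_FTC2 R f F 0 1 ltr01 cf01 LR); last first.
  by move=> r; rewrite in_itv/= => /andP[r0 /ltW r1]; exact: dv_derive1 (dF r r0 r1).
by rewrite F0 sube0 /F powR1 mul1r U1.
Qed.

End Competitor.

End Minimizers.

(** * Classification of the minimizers *)

Section MinimizerClassification.
Context {R : realType} {p : R} (hp1 : 1 < p) (hp2 : p < 2).
Let pi_pos : 0 < pi :> R := pi_gt0 R.
Context {X Y : R -> R} (hX : special (p := p) X Y).
Local Notation prof := (profile (X := X)).

(** u avoids 0, pi/2 and pi, whose folds are 0 or pi/2; being continuous, it stays on the side of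
    each of them where it is at a point r1 close to 1. *)
Lemma fold_interior_sign {u : R -> R} {l : R} : {within `[0, 1], continuous u} -> u 1 = l ->
  0 < l -> l <= pi / 2 ->
  (forall r, 0 < r -> r < 1 -> 0 < fold (u r) /\ fold (u r) < pi / 2) ->
  (forall r, 0 < r -> r < 1 -> fold (u r) = u r) \/
  (forall r, 0 < r -> r < 1 -> fold (u r) = pi - u r /\ pi / 2 < u r).
Proof.
move=> cu ul l0 lpi inn.
have [r1 [r10 r11 ur0 urpi]] : exists r1, [/\ 0 < r1, r1 < 1, 0 < u r1 & u r1 < pi].
  have /(continuous_within_itvP _ (@ltr01 R))[_ _ /cvgrPdist_lt/(_ _ l0) c1] := cu.
  have c2 : \forall b \near 1^'-, 0 < b /\ (b < 1 /\ `|u 1 - u b| < l).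
    by apply: filter_app c1; near=> b => ?.
  have [b [b0 [b1 hb]]] := filter_ex c2; exists b; split=> //.
    by move: hb; rewrite ul ltr_norml => /andP[? ?]; lra.
  by move: hb lpi; rewrite ul ltr_norml => /andP[? ?] ?; lra.
have sgn (f : R -> R) : (forall r, 0 < r -> r < 1 -> {for r, continuous f}) ->
    (forall r, 0 < r -> r < 1 -> f r != 0) -> 0 < f r1 -> forall r, 0 < r -> r < 1 -> 0 < f r.
  move=> cf f0 fr1 r r0 rl; have [h|/ltW h] := leP r r1.
    rewrite (const_sign h (f := f)) => [//|x /andP[rx xr]|x /andP[rx xr]].
      by apply: cf; [exact: lt_le_trans rx|exact: le_lt_trans r11].
    by apply: f0; [exact: lt_le_trans rx|exact: le_lt_trans r11].
  rewrite -(const_sign h (f := f)) => [//|x /andP[rx xr]|x /andP[rx xr]].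
    by apply: cf; [exact: lt_le_trans rx|exact: le_lt_trans rl].
  by apply: f0; [exact: lt_le_trans rx|exact: le_lt_trans rl].
have cu' r : 0 < r -> r < 1 -> {for r, continuous u} by exact: within_cont.
have ccst (c r : R) : {for r, continuous (fun=> c)} by exact: cvg_cst.
have u0 r : 0 < r -> r < 1 -> u r != 0.
  move=> r0 rl; apply/eqP => e; have [h _] := inn r r0 rl.
  by move: h; rewrite e fold_id ?ltxx// divr_ge0// ltW.
have upi r : 0 < r -> r < 1 -> pi - u r != 0.
  move=> r0 rl; rewrite subr_eq0; apply/eqP => e; have [h _] := inn r r0 rl.
  by move: h; rewrite -e fold_refl ?subrr ?ltxx//; have := pi_pos; lra.
have uh r : 0 < r -> r < 1 -> u r - pi / 2 != 0.
  move=> r0 rl; rewrite subr_eq0; apply/eqP => e; have [_ h] := inn r r0 rl.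
  by move: h; rewrite e fold_id ?ltxx// divr_ge0// ltW.
have pos := sgn u cu' u0 ur0.
have ltpi r : 0 < r -> r < 1 -> 0 < pi - u r.
  apply: (sgn (fun r => pi - u r)) => [s s0 s1|//|]; last by rewrite subr_gt0.
  by apply: cvgB; [exact: ccst|exact: cu'].
have cuh r : 0 < r -> r < 1 -> {for r, continuous (fun r => u r - pi / 2)}.
  by move=> r0 rl; apply: cvgB; [exact: cu'|exact: ccst].
case: (ltgtP (u r1) (pi / 2)) => h; last by have := uh r1 r10 r11; rewrite h subrr eqxx.
  left=> r r0 rl; have := sgn (fun r => pi / 2 - u r) _ _ _ r r0 rl.
  rewrite !subr_gt0 => hr; rewrite fold_id//; first exact: ltW (pos r r0 rl).
  apply: ltW; apply: hr => // s s0 s1.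
    by apply: cvgB; [exact: ccst|exact: cu'].
  by rewrite subr_eq0 eq_sym -subr_eq0; exact: uh.
right=> r r0 rl; have := sgn (fun r => u r - pi / 2) cuh uh _ r r0 rl.
rewrite !subr_gt0 => /(_ h) hr; split=> //; apply: fold_refl; first exact: ltW.
by have := ltpi r r0 rl; rewrite subr_gt0 => /ltW.
Unshelve. all: by end_near. Qed.

Lemma minimizer_classification l : 0 < l -> l <= pi / 2 ->
  (exists u, is_minimizer p l u) /\
  (forall u, is_minimizer p l u -> exists2 a : R, 0 < a &
    (forall r, 0 <= r -> r <= 1 -> u r = prof (a * r)) \/
    (l = pi / 2 /\ forall r, 0 <= r -> r <= 1 -> u r = pi - prof (a * r))).
Proof.
move=> l0 lpi; have [tau [Ti [Ypos Xtau XTi TiX dTi]]] := sp_inverse hp1 hp2 hX.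
have [aU EU] := competitor_energy hp1 hp2 hX Ypos Xtau XTi TiX dTi l0 lpi.
set U := (fun r => _) in aU EU.
have U1 : U 1 = l.
  rewrite /U mulr1 profileE ?expR_gt0// expRK.
  by have [_ ->] := XTi l l0 (le_lt_trans lpi Xtau).
have low (v : R -> R) : admissible p v -> v 1 = l -> (Ep p U <= Ep p v)%E.
  by move=> av vl; rewrite EU; exact: (energy_lower hp1 hp2 hX Ypos Xtau XTi dTi av vl l0 lpi).
split.
  exists U; split; first exact: aU.
  move=> v av; rewrite /Gpl U1 eqxx; case: eqVneq => [vl|_]; last by rewrite leey.
  exact: low.
(* A minimizer must satisfy u 1 = l: otherwise its value is infinite, while U has finite energy. *)
move=> u [au /(_ U aU)]; rewrite /Gpl U1 eqxx; case: eqVneq => [ul|_]; last first.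
  by rewrite EU leye_eq.
rewrite EU => Eu; have [cu _ _] := au.
have [C hC] := energy_rigid hp1 hp2 hX Ypos Xtau XTi dTi au ul l0 lpi Eu.
have C0 : 0 < expR C := expR_gt0 C.
have cP := dilation_within hp1 hp2 hX C0.
have fE r : 0 < r -> r < 1 -> fold (u r) = prof (expR C * r).
  by move=> r0 rl; have [-> _] := hC r r0 rl; rewrite profileE ?mulr_gt0// lnM ?posrE// expRK addrC.
exists (expR C) => //.
have [r r0 rl||] := fold_interior_sign cu ul l0 lpi.
- have [e h] := hC r r0 rl; split=> //; rewrite e.
  by have /andP[] := sp_strip hp1 hp2 hX (ln r + C).
- by move=> h; left; apply: (within_eq cu cP) => r r0 rl; rewrite -fE// h.
- move=> h; right.
  have cP' : {within `[0, 1], continuous (fun r => pi - prof (expR C * r))}.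
    by move=> x; apply: cvgB; [exact: cvg_cst|exact: cP].
  have e : forall r, 0 <= r -> r <= 1 -> u r = pi - prof (expR C * r).
    apply: (within_eq cu cP') => r r0 rl; have [e _] := h r r0 rl.
    by rewrite -fE// e opprB addrC subrK.
  (* u > pi/2 on (0, 1), so by continuity at 1 the value l is at least pi/2. *)
  split=> //; apply/eqP; rewrite eq_le lpi/= -ul.
  have /(continuous_within_itvP _ (@ltr01 R))[_ _ c1] := cu.
  rewrite leNgt; apply/negP => lt1.
  have /cvgrPdist_lt/(_ (pi / 2 - u 1)) := c1; rewrite subr_gt0 => /(_ lt1) c2.
  have c3 : \forall b \near 1^'-, 0 < b /\ (b < 1 /\ `|u 1 - u b| < pi / 2 - u 1).
    by apply: filter_app c2; near=> b => ?.
  have [b [b0 [b1 hb]]] := filter_ex c3; have [_ h2] := h b b0 b1.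
  by move: hb; rewrite ltr_norml => /andP[? ?]; lra.
Unshelve. all: by end_near. Qed.

End MinimizerClassification.

Theorem theorem2 (R : realType) (p : R) (hp1 : 1 < p) (hp2 : p < 2) :
  exists h : R -> R,
    (* h is a global solution, smooth on (0,oo) and C^1 on [0,oo) *)
    (global_solution p h /\ smooth_pos h /\ C1_nonneg h) /\
    (* (a) *)
    (h 0 = 0 /\ h r @[r --> +oo] --> pi / 2) /\
    (* (b) *)
    (exists s : nat -> R,
       oscillates h (pi / 2) (max_above h (pi / 2)) (min_below h (pi / 2)) s) /\
    (* (c) *)
    (forall l : R, 0 < l -> l <= pi / 2 ->
       (exists u : R -> R, is_minimizer p l u) /\
       (forall u : R -> R, is_minimizer p l u ->
          exists2 a : R, 0 < a &
            (forall r : R, 0 <= r -> r <= 1 -> u r = h (a * r)) \/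
            (l = pi / 2 /\
             forall r : R, 0 <= r -> r <= 1 -> u r = pi - h (a * r)))) /\
    (* (d) *)
    (forall f : R -> R,
       global_solution p f -> finite_at0 f -> nonconstant_pos f ->
       exists (a : R) (k : int), 0 < a /\
         ((forall r : R, 0 < r -> f r = k%:~R * pi + h (a * r)) \/
          (forall r : R, 0 < r -> f r = k%:~R * pi - h (a * r)))) /\
    (* (e), limit -oo at 0 *)
    (infinitely_many_pos (solutions_from_ninfty p) /\
     forall f : R -> R, solutions_from_ninfty p f ->
       (increasing_on `]0, +oo[%classic f /\
        (f r @[r --> +oo] --> +oo \/
         exists k : int, f r @[r --> +oo] --> k%:~R * pi)) \/
       (exists (k : int) (s : nat -> R),
          [/\ increasing_on `]0, s 0%N]%classic f,
              oscillates f (odd_half_pi R k)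
                (max_above f (odd_half_pi R k))
                (min_below f (odd_half_pi R k)) s &
              all_critical f s])) /\
    (* (e), limit +oo at 0 *)
    (infinitely_many_pos (solutions_from_pinfty p) /\
     forall f : R -> R, solutions_from_pinfty p f ->
       (decreasing_on `]0, +oo[%classic f /\
        (f r @[r --> +oo] --> -oo \/
         exists k : int, f r @[r --> +oo] --> k%:~R * pi)) \/
       (exists (k : int) (s : nat -> R),
          [/\ decreasing_on `]0, s 0%N]%classic f,
              oscillates f (odd_half_pi R k)
                (min_below f (odd_half_pi R k))
                (max_above f (odd_half_pi R k)) s &
              all_critical f s])).
Proof.
have [X [Y hX]] := special_solution hp1 hp2.
have hs := sp_sol hX; have nt := sp_nt hp1 hp2 hX.
have nd t : ~ (Y t = 0 /\ sin (X t) = 0).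
  by move=> [_ /eqP]; apply/negP; exact: (sin_neq0 hp1 nt _ (sp_V hp1 hp2 hX t)).
exists (profile (X := X)); split; [split; [|split]|split; [|split; [|split; [|split; [|split]]]]].
- exact: (global_of_sol hp1 hp2 hs profileE).
- exact: (smooth_of_sol hp1 hs profileE nd).
- exact: (C1_nonneg_profile hp1 hp2 hX).
- split; first exact: profile0.
  apply: (tends_ln profileE).
  by have [] := converge hp1 hp2 hs nt 0 (sp_V hp1 hp2 hX 0) (sp_strip hp1 hp2 hX 0).
- have [s [_ osc _]] := oscillates_of_sol hp1 hp2 hs nt profileE 0 0
    (sp_V hp1 hp2 hX 0) (sp_strip hp1 hp2 hX 0) (sp_Ypos hX).
  by exists s.
- exact: (minimizer_classification hp1 hp2 hX).
- by move=> f hf f0 fn; exact: (finite_solutions hp1 hp2 hX hf f0 fn).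
- split; first exact: (ninfty_infinite hp1 hp2).1.
  exact: (@ninfty_classification R p hp1 hp2).
- split; first exact: (ninfty_infinite hp1 hp2).2.
  exact: (@pinfty_classification R p hp1 hp2).
Qed.
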